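(* Let $\sigma$ be an activation function satisfying the admissibility and non-vanishing hypotheses given in the context, with differentiation order $\alpha$ and $g=D^\alpha\sigma$. Let $p\ge0$ be an integer, $m=p+2$, and let $f\in L^1_p(\mathbb{R}^d)$. For $w\in\mathbb{S}^{d-1}$ let $$\widehat H_w(\rho)=c_d\,\frac{(i\rho)^\alpha|\rho|^{d-1}}{\widehat g(\rho)}\,\widehat f(\rho w),\qquad c_d=\frac{|\mathbb{S}^{d-1}|}{2(2\pi)^{d-1}},\qquad \rho\in\mathbb{R}.$$ Assume that: 1. for almost every $w\in\mathbb{S}^{d-1}$, $\widehat H_w\in W^{m,1}(\mathbb{R}\setminus\{0\})$, and $\int_{\mathbb{S}^{d-1}}\|\widehat H_w\|_{W^{m,1}(\mathbb{R}\setminus\{0\})}\,\underline{dw}<\infty$; 2. for almost every $w\in\mathbb{S}^{d-1}$, the one-sided traces at the origin satisfy $\lim_{\rho\to0^+}\widehat H_w^{(k)}(\rho)=\lim_{\rho\to0^-}\widehat H_w^{(k)}(\rho)$ for all $k=0,1,\dots,m-1$. Then the filtered analysis distribution $\mu=(-\Delta_b)^\alpha\mathcal{T}_g*_b\mathcal{R}_\sigma f$ (see context) extends uniquely to a finite weighted Radon measure in $\mathcal{M}_p(\mathbb{S}^{d-1}\times\mathbb{R})$, and $$\|\mu\|_{\mathrm{TV},p}\le C\int_{\mathbb{S}^{d-1}}\|\widehat H_w\|_{W^{m,1}(\mathbb{R})}\,\underline{dw}$$ for a constant $C>0$ independent of $f$.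
   Context: Notation. $\mathbb{S}^{d-1}$ is the unit sphere of $\mathbb{R}^d$, $\underline{dw}$ its normalized (total mass $1$) Lebesgue measure, $|\mathbb{S}^{d-1}|$ its unnormalized surface area. Fourier transform on $\mathbb{R}^n$: $\widehat u(\xi)=\int u(x)e^{-i\langle\xi,x\rangle}dx$, extended to tempered distributions by $\langle\widehat T,\phi\rangle=\langle T,\widehat\phi\rangle$. $L^1_p(\mathbb{R}^d)=L^1(\mathbb{R}^d;(1+|x|)^p\,dx)$. $W^{m,1}$ is the usual Sobolev space of functions with weak derivatives up to order $m$ in $L^1$. $\mathcal{M}_p(\mathbb{S}^{d-1}\times\mathbb{R})$ is the space of signed Radon measures $\mu$ with $\|\mu\|_{\mathrm{TV},p}=\int(1+|b|)^p\,d|\mu|(w,b)<\infty$. $\mathcal{S}(\mathbb{S}^{d-1}\times\mathbb{R})$ is the space of smooth functions all of whose derivatives decay rapidly in $b$, uniformly in $w$. Functions $f$ are real-valued. Hypotheses on $\sigma$. $\sigma:\mathbb{R}\to\mathbb{R}$ is continuous with $|\sigma(t)|\le C(1+|t|)^{k_\sigma}$ for some $C>0$ and integer $k_\sigma\ge0$, and there is an integer $\alpha\ge 0$ such that the distribution $g=D^\alpha\sigma$, with Fourier transform $\widehat g(\rho)=(i\rho)^\alpha\widehat\sigma(\rho)$, satisfies: (i) $\widehat g\in C^\infty(\mathbb{R})$; (ii) $\widehat g(\rho)\ne0$ for almost every $\rho$; (iii) there are $C,N>0$ such that $|\widehat g(\rho)|\ge C|\rho|^{-N}$ as $|\rho|\to\infty$;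 (iv) $|\rho|^{d-1}/|\widehat g(\rho)|^2$ has at most isolated singularities, of algebraic order uniformly bounded by a finite integer over $\mathbb{R}$, with local coefficients of divergence growing at most polynomially as $|\rho|\to\infty$; (v) (non-vanishing) $\widehat g(\rho)\neq0$ for all $\rho\in\mathbb{R}\setminus\{0\}$, and if $\widehat g(0)=0$ then the order of vanishing of $\widehat g$ at $0$ is strictly less than $\alpha+d-1$. Under these hypotheses $\widehat H_w$ is a continuous function of at most polynomial growth (extended by continuity at $\rho=0$). Filtered analysis distribution. $H_w\in\mathcal{S}'(\mathbb{R})$ denotes the tempered distribution with Fourier transform $\widehat H_w$, and $(-\Delta_b)^\alpha\mathcal{T}_g*_b\mathcal{R}_\sigma f$ denotes the functional $\phi\mapsto\int_{\mathbb{S}^{d-1}}\langle H_w,\phi(w,\cdot)\rangle_{\mathbb{R}}\,\underline{dw}$ on $\mathcal{S}(\mathbb{S}^{d-1}\times\mathbb{R})$. That it extends to a measure in $\mathcal{M}_p(\mathbb{S}^{d-1}\times\mathbb{R})$ means that there is $\mu\in\mathcal{M}_p(\mathbb{S}^{d-1}\times\mathbb{R})$ with $$\int_{\mathbb{S}^{d-1}}\langle H_w,\phi(w,\cdot)\rangle_{\mathbb{R}}\,\underline{dw}=\int_{\mathbb{S}^{d-1}\times\mathbb{R}}\phi(w,b)\,d\mu(w,b)\quad\forall\phi\in\mathcal{S}(\mathbb{S}^{d-1}\times\mathbb{R}).$$ *)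

(* Defs.v *)
From HB Require Import structures.
From mathcomp Require Import all_boot all_order all_algebra.
From mathcomp Require Import all_classical all_reals all_analysis.
From mathcomp Require Import measurable_realfun complex.

Set Implicit Arguments.
Unset Strict Implicit.
Unset Printing Implicit Defensive.

Import Order.TTheory GRing.Theory Num.Theory.
Import numFieldNormedType.Exports.

Local Open Scope classical_set_scope.
Local Open Scope ring_scope.

(* The Borel sigma-algebra of R^d = 'rV[R]_d, generated by the coordinates. *)
Section rV_measurable.
Context {R : realType} {d : nat}.

Definition rV_coord (i : 'I_d) (x : 'rV[R]_d) : R := x ord0 i.

Let rV_set0 : g_sigma_preimage rV_coord set0.
Proof. exact: sigma_algebra0. Qed.

Let rV_setC A : g_sigma_preimage rV_coord A -> g_sigma_preimage rV_coord (~` A).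
Proof. exact: sigma_algebraC. Qed.

Let rV_bigcup (F : _^nat) : (forall i, g_sigma_preimage rV_coord (F i)) ->
  g_sigma_preimage rV_coord (\bigcup_i (F i)).
Proof. exact: sigma_algebra_bigcup. Qed.

HB.instance Definition _ :=
  @isMeasurable.Build (measure_tuple_display default_measure_display)
    'rV[R]_d (g_sigma_preimage rV_coord) rV_set0 rV_setC rV_bigcup.

End rV_measurable.

Section rV_measurable_fun.
Context {R : realType}.

Lemma measurable_rV_coord d (i : 'I_d) :
  measurable_fun [set: 'rV[R]_d] (fun x => x ord0 i).
Proof.
move=> _ Y mY; rewrite setTI; apply: sub_sigma_algebra => /=.
rewrite -bigcup_seq/=; exists i => /=; first by rewrite mem_index_enum.
by exists Y => //; rewrite setTI.
Qed.

Lemma measurable_fun_rV d0 (T : measurableType d0) d (f : T -> 'rV[R]_d) :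
  (forall i, measurable_fun [set: T] (fun x => f x ord0 i)) ->
  measurable_fun [set: T] f.
Proof.
move=> mf; suff fS : g_sigma_preimage (fun i => rV_coord i \o f) `<=` measurable.
  rewrite g_sigma_preimage_comp in fS => _ A mA.
  by apply: fS; exists A.
apply: smallest_sub; first exact: sigma_algebra_measurable.
case: d f mf => [|n] f mf; first by rewrite big_ord0.
rewrite -bigcup_mkord_ord; apply: bigcup_sub => i Ii.
by move=> A [B mB <-]; exact: mf.
Qed.

Definition consV d (tx : R * 'rV[R]_d) : 'rV[R]_d.+1 :=
  row_mx (const_mx tx.1 : 'rV_1) tx.2.

Lemma consV0 d (tx : R * 'rV[R]_d) : consV tx ord0 ord0 = tx.1.
Proof.
have e : (ord0 : 'I_(1 + d)) = lshift d (ord0 : 'I_1) by exact/val_inj.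
rewrite -[LHS]/((consV tx : 'rV_(1 + d)) ord0 (ord0 : 'I_(1 + d))) e.
by rewrite row_mxEl mxE.
Qed.

Lemma consVS d (tx : R * 'rV[R]_d) i : consV tx ord0 (lift ord0 i) = tx.2 ord0 i.
Proof.
have e : (lift ord0 i : 'I_(1 + d)) = rshift 1 i by exact/val_inj.
rewrite -[LHS]/((consV tx : 'rV_(1 + d)) ord0 (lift ord0 i : 'I_(1 + d))) e.
by rewrite row_mxEr.
Qed.

Lemma measurable_consV d : measurable_fun [set: R * 'rV[R]_d] (@consV d).
Proof.
apply: measurable_fun_rV => i; case: (unliftP ord0 i) => [j|] ->.
  rewrite (_ : (fun _ => _) = rV_coord j \o snd); last first.
    by apply/funext => tx; rewrite consVS.
  by apply: measurableT_comp => //; exact: measurable_rV_coord.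
rewrite (_ : (fun _ => _) = fst) //.
by apply/funext => tx; rewrite consV0.
Qed.

Lemma measurable_unconsV d : measurable_fun [set: 'rV[R]_d.+1]
  (fun x => (x ord0 ord0, \row_i x ord0 (lift ord0 i))).
Proof.
apply: measurable_fun_pair; first exact: measurable_rV_coord.
apply: measurable_fun_rV => i.
under eq_fun do rewrite mxE.
exact: measurable_rV_coord.
Qed.

End rV_measurable_fun.

(* Lebesgue measure on R^d, as the d-fold product of the one of R. *)
Section lebesgue_rV_step.
Context {R : realType} {d : nat} (m : {sigma_finite_measure set 'rV[R]_d -> \bar R}).
Local Open Scope ereal_scope.

Definition lebesgue_consV : set 'rV[R]_d.+1 -> \bar R :=
  pushforward (@lebesgue_measure R \x m) (@consV R d).

Let lebesgue_consV0 : lebesgue_consV set0 = 0.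
Proof. by rewrite /lebesgue_consV /pushforward preimage_set0 measure0. Qed.

Let lebesgue_consV_ge0 A : 0 <= lebesgue_consV A.
Proof. by rewrite /lebesgue_consV /pushforward; apply: measure_ge0. Qed.

Let mpre (A : set 'rV[R]_d.+1) : measurable A -> measurable (@consV R d @^-1` A).
Proof. by move=> mA; rewrite -[X in measurable X]setTI; exact: measurable_consV. Qed.

Let lebesgue_consV_sigma_additive : semi_sigma_additive lebesgue_consV.
Proof.
move=> F mF tF mUF; rewrite /lebesgue_consV /pushforward preimage_bigcup.
apply: measure_semi_sigma_additive.
- by move=> n; exact: mpre.
- apply/trivIsetP => /= i j _ _ ij; rewrite -preimage_setI.
  by move/trivIsetP : tF => /(_ _ _ _ _ ij) ->//; rewrite preimage_set0.
- by rewrite -preimage_bigcup; exact: mpre.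
Qed.

HB.instance Definition _ := isMeasure.Build _ _ _ lebesgue_consV
  lebesgue_consV0 lebesgue_consV_ge0 lebesgue_consV_sigma_additive.

Let lebesgue_consV_sigma_finite : sigma_finite setT lebesgue_consV.
Proof.
have /sigma_finiteP[F [TF ndF Foo]] := sigma_finiteT (@lebesgue_measure R).
have /sigma_finiteP[G [TG ndG Goo]] := sigma_finiteT m.
pose u := fun x : 'rV[R]_d.+1 => (x ord0 ord0, \row_i x ord0 (lift ord0 i)).
have uK (tx : R * 'rV[R]_d) : u (consV tx) = tx.
  rewrite /u consV0; case: tx => t x; congr (_, _).
  by apply/rowP => i; rewrite mxE consVS.
exists (fun n => u @^-1` (F n `*` G n)).
  rewrite -preimage_bigcup -(_ : setT = \bigcup_n (F n `*` G n)) ?preimage_setT//.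
  rewrite -setXTT TF TG predeqE => -[x y]; split.
    move=> [/= [n _ Fnx] [k _ Gky]]; exists (maxn n k) => //; split.
    - by move: x Fnx; exact/subsetPset/ndF/leq_maxl.
    - by move: y Gky; exact/subsetPset/ndG/leq_maxr.
  by move=> [n _ []/= ? ?]; split; exists n.
move=> n; have [mF Fn] := Foo n; have [mG Gn] := Goo n; split.
  rewrite -[X in measurable X]setTI; apply: measurable_unconsV => //.
  exact: measurableX.
rewrite /lebesgue_consV /pushforward -comp_preimage.
rewrite (_ : u \o _ = id); last exact/funext.
rewrite preimage_id product_measure1E//.
by rewrite lte_mul_pinfty// ge0_fin_numE.
Qed.

HB.instance Definition _ := Measure_isSigmaFinite.Build _ _ _ lebesgue_consV
  lebesgue_consV_sigma_finite.

End lebesgue_rV_step.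

Fixpoint lebesgue_rV (R : realType) (d : nat) :
    {sigma_finite_measure set 'rV[R]_d -> \bar R} :=
  match d with
  | 0 => \d_(0 : 'rV[R]_0)
  | d'.+1 => lebesgue_consV (lebesgue_rV R d')
  end.

Section sphere.
Context {R : realType}.

Definition dotp d (x y : 'rV[R]_d) : R := \sum_(i < d) x ord0 i * y ord0 i.

(* The norm of 'rV[R]_d in the library is the sup norm. *)
Definition enorm d (x : 'rV[R]_d) : R := Num.sqrt (dotp x x).

Definition usphere d : set 'rV[R]_d := [set w | enorm w = 1].

Definition radial_proj d (x : 'rV[R]_d) : 'rV[R]_d := (enorm x)^-1 *: x.

Definition punctured_ball d : set 'rV[R]_d := [set x | 0 < enorm x <= 1].

Arguments usphere d : clear implicits.
Arguments punctured_ball d : clear implicits.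

Lemma measurable_enorm d : measurable_fun [set: 'rV[R]_d] (@enorm d).
Proof.
rewrite (_ : @enorm d = (@powR R ^~ 2^-1) \o (fun x => dotp x x)).
  apply: measurableT_comp; first exact: measurable_powR.
  by apply: measurable_sum => i; apply: measurable_funM;
    exact: measurable_rV_coord.
apply/funext => x /=; rewrite powR12_sqrt //.
by apply: sumr_ge0 => i _; rewrite -expr2 sqr_ge0.
Qed.

Lemma measurable_radial_proj d : measurable_fun [set: 'rV[R]_d] (@radial_proj d).
Proof.
apply: measurable_fun_rV => i; under eq_fun do rewrite mxE.
apply: measurable_funM; last exact: measurable_rV_coord.
rewrite (_ : (fun _ => _) = (@powR R ^~ (-1)) \o @enorm d).
  by apply: measurableT_comp; [exact: measurable_powR|exact: measurable_enorm].
by apply/funext => x /=; rewrite powR_inv1 // sqrtr_ge0.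
Qed.

Lemma measurable_punctured_ball d : measurable (punctured_ball d).
Proof.
rewrite (_ : punctured_ball d = @enorm d @^-1` `]0, 1]); last first.
  by apply/seteqP; split => x /=; rewrite in_itv.
by rewrite -[X in measurable X]setTI; exact: measurable_enorm.
Qed.

(* The surface measure of a Borel subset A of the sphere is d times the volume of
   the cone {r w | w \in A, 0 < r <= 1}; it is the counting measure of {-1, 1}
   when d = 1.  It is a measure on the whole of R^d, carried by the sphere. *)
Definition surface_measure d : {measure set 'rV[R]_d -> \bar R} :=
  mscale (d%:R)%:nng
    (measure_function_pushforward__canonical__measure_function_Measure
      (mrestr (lebesgue_rV R d) (@measurable_punctured_ball d))
      (@measurable_radial_proj d)).

Definition sphere_area d : R := fine (surface_measure d setT).

Lemma sphere_areaV_ge0 d : 0 <= (sphere_area d)^-1.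
Proof. by rewrite invr_ge0 fine_ge0. Qed.

Definition sphere_measure d : {measure set 'rV[R]_d -> \bar R} :=
  mscale (NngNum (sphere_areaV_ge0 d)) (surface_measure d).

End sphere.
Arguments usphere R d : clear implicits.
Arguments sphere_area R d : clear implicits.
Arguments sphere_measure R d : clear implicits.

Notation normc := ComplexField.Normc.normc.

Section complex_valued.
Context {R : realType}.
Local Notation leb := (@lebesgue_measure R).
Local Notation Re := complex.Re.
Local Notation Im := complex.Im.

Definition cintegrable d (T : measurableType d) (mu : {measure set T -> \bar R})
    (D : set T) (f : T -> R[i]) :=
  mu.-integrable D (fun x => (Re (f x))%:E) /\
  mu.-integrable D (fun x => (Im (f x))%:E).

Definition cintegral d (T : measurableType d) (mu : {measure set T -> \bar R})
    (D : set T) (f : T -> R[i]) : R[i] :=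
  Complex (Rintegral mu D (fun x => Re (f x)))
          (Rintegral mu D (fun x => Im (f x))).

Definition csmooth (f : R -> R[i]) := forall n x,
  derivable (derive1n n (fun y => Re (f y))) x 1 /\
  derivable (derive1n n (fun y => Im (f y))) x 1.

Definition cderiv n (f : R -> R[i]) (x : R) : R[i] :=
  Complex (derive1n n (fun y => Re (f y)) x) (derive1n n (fun y => Im (f y)) x).

Definition ccontinuous_at (f : R -> R[i]) (x : R) :=
  {for x, continuous (fun y => Re (f y))} /\
  {for x, continuous (fun y => Im (f y))}.

Definition ccvg (f : R -> R[i]) (F : set_system R) (l : R[i]) :=
  Re (f x) @[x --> F] --> Re l /\ Im (f x) @[x --> F] --> Im l.

Definition expi (t : R) : R[i] := Complex (cos t) (sin t).

Definition fourier (f : R -> R[i]) (xi : R) : R[i] :=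
  cintegral leb setT (fun x => f x * expi (- (xi * x))).

Definition fourier_rV d (f : 'rV[R]_d -> R) (xi : 'rV[R]_d) : R[i] :=
  cintegral (lebesgue_rV R d) setT
    (fun x => real_complex R (f x) * expi (- dotp xi x)).

(* C_c^oo(O), complex valued. *)
Definition test_fun (O : set R) (phi : R -> R[i]) :=
  csmooth phi /\
  exists K : set R, [/\ compact K, K `<=` O & forall x, ~ K x -> phi x = 0].

Definition schwartz (phi : R -> R[i]) :=
  csmooth phi /\
  forall j k, exists M : R, forall x, (1 + `|x|) ^+ j * normc (cderiv k phi x) <= M.

Definition distr := (R -> R[i]) -> R[i].

Definition distr_of (u : R -> R[i]) : distr :=
  fun phi => cintegral leb setT (fun x => u x * phi x).

Definition distr_deriv n (T : distr) : distr :=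
  fun phi => (-1) ^+ n * T (cderiv n phi).

Definition distr_fourier (T : distr) : distr := fun phi => T (fourier phi).

Definition tempered (T : distr) :=
  (forall (a : R[i]) phi psi, schwartz phi -> schwartz psi ->
    T (fun x => a * phi x + psi x) = a * T phi + T psi) /\
  exists (C : R) (N : nat), forall phi (M : R), schwartz phi ->
    (forall j k x, (j <= N)%N -> (k <= N)%N ->
      (1 + `|x|) ^+ j * normc (cderiv k phi x) <= M) ->
    normc (T phi) <= C * M.

(* Weak derivatives on an open subset O of R. *)
Definition weak_deriv (O : set R) (n : nat) (u v : R -> R[i]) :=
  forall phi, test_fun O phi ->
    cintegral leb O (fun x => u x * cderiv n phi x) =
    (-1) ^+ n * cintegral leb O (fun x => v x * phi x).

Definition sobolev_derivs (m : nat) (O : set R) (u : R -> R[i])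
    (v : nat -> R -> R[i]) :=
  cintegrable leb O u /\
  forall k, (k <= m)%N -> cintegrable leb O (v k) /\ weak_deriv O k u (v k).

(* u \in W^{m,1}(O) *)
Definition sobolev m O u := exists v, sobolev_derivs m O u v.

(* All the families v agree almost everywhere on O, so that the infimum is taken
   over a singleton when u \in W^{m,1}(O); it is +oo otherwise. *)
Definition sobolev_norm m O u : \bar R :=
  ereal_inf [set (\sum_(k < m.+1) \int[leb]_(x in O) (normc (v k x))%:E)%E
            | v in sobolev_derivs m O u].

(* The traces are those of the continuous representatives, on R \ {0}, of the
   weak derivatives of order < m. *)
Definition traces_agree m (u : R -> R[i]) :=
  exists v, sobolev_derivs m [set~ 0] u v /\
  forall k, (k < m)%N ->
    (forall x, x != 0 -> ccontinuous_at (v k) x) /\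
    exists l, ccvg (v k) (0 : R)^'+ l /\ ccvg (v k) (0 : R)^'- l.

End complex_valued.
Arguments distr R : clear implicits.

Section activation.
Context {R : realType}.

(* ghat is the Fourier transform of the distribution D^alpha sigma; being smooth
   but a priori not of polynomial growth, it is paired with C_c^oo(R), which is
   dense in S(R). *)
Record admissible (d : nat) (sigma : R -> R) (alpha : nat) (ghat : R -> R[i])
    : Prop := Admissible {
  adm_continuous : continuous sigma ;
  adm_growth : exists C (k : nat), 0 < C /\
    forall t, `|sigma t| <= C * (1 + `|t|) ^+ k ;
  adm_fourier : forall phi, test_fun setT phi ->
    distr_fourier (distr_deriv alpha (distr_of (fun t => real_complex R (sigma t))))
      phi = distr_of ghat phi ;
  adm_smooth : csmooth ghat ;
  adm_ae_neq0 : {ae @lebesgue_measure R, forall rho, ghat rho != 0} ;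
  adm_lower_bound : exists C N r : R, [/\ 0 < C, 0 < N, 0 < r &
    forall rho, r <= `|rho| -> C * `|rho| `^ (- N) <= normc (ghat rho)] ;
  (* The singularities are the zeros of ghat; K bounds the orders, and
     A (1 + |s|)^L the coefficients of divergence. *)
  adm_singularities : exists (K : nat) (A : R) (L : nat),
    forall s, ghat s = 0 -> exists (k : nat) (c r : R),
      [/\ (k <= K)%N, 0 < r, c <= A * (1 + `|s|) ^+ L &
       forall rho, 0 < `|rho - s| < r -> ghat rho != 0 /\
         `|rho| ^+ d.-1 / normc (ghat rho) ^+ 2 <= c * `|rho - s| ^- k] ;
  adm_nonvanishing : forall rho, rho != 0 -> ghat rho != 0 ;
  adm_order0 : ghat 0 = 0 -> exists k : nat,
    [/\ (k < alpha + d.-1)%N, forall j, (j < k)%N -> cderiv j ghat 0 = 0 &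
     cderiv k ghat 0 != 0]
}.

(* At rho = 0 this is the extension by continuity: since _ / 0 = 0, the value is 0
   when ghat 0 = 0, which is the limit by adm_order0. *)
Definition Hhat d (alpha : nat) (ghat : R -> R[i]) (f : 'rV[R]_d -> R)
    (w : 'rV[R]_d) (rho : R) : R[i] :=
  real_complex R (sphere_area R d / (2 * (2 * pi) ^+ d.-1)) *
  (Complex 0 rho ^+ alpha * real_complex R (`|rho| ^+ d.-1) / ghat rho) *
  fourier_rV f (rho *: w).

(* L^1_p(R^d) *)
Definition weightedL1 d (p : nat) (f : 'rV[R]_d -> R) :=
  measurable_fun setT f /\
  (\int[lebesgue_rV R d]_x ((1 + enorm x) ^+ p * `|f x|)%:E < +oo)%E.

End activation.

Section sphere_measures.
Context {R : realType} {d : nat}.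
Local Notation Re := complex.Re.
Local Notation Im := complex.Im.

Definition iderive (V : normedModType R) (vs : seq V) (F : V -> R) : V -> R :=
  foldr (fun v G => (fun x => 'D_v G x)) F vs.

Definition smooth_on (V : normedModType R) (U : set V) (F : V -> R) :=
  forall vs v x, U x ->
    derivable (iderive vs F) x v /\ {for x, continuous (iderive vs F)}.

(* Functions on S^{d-1} x R are the restrictions of functions on R^d x R; they are
   differentiated through their extension constant along the rays of R^d. *)
Definition radial_ext (F : 'rV[R]_d * R -> R) (x : 'rV[R]_d * R) : R :=
  F (radial_proj x.1, x.2).

Definition rschwartz_sphere (F : 'rV[R]_d * R -> R) :=
  smooth_on [set x | x.1 != 0] (radial_ext F) /\
  forall (k : nat) vs, exists M : R, forall w b, usphere R d w ->
    (1 + `|b|) ^+ k * `|iderive vs (radial_ext F) (w, b)| <= M.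

(* S(S^{d-1} x R), complex valued *)
Definition schwartz_sphere (phi : 'rV[R]_d * R -> R[i]) :=
  rschwartz_sphere (fun x => Re (phi x)) /\
  rschwartz_sphere (fun x => Im (phi x)).

Section charge.
Variable nu : {charge set ('rV[R]_d * R)%type -> \bar R}.

Let P := projT1 (cid (Hahn_decomposition nu)).
Let exN := projT2 (cid (Hahn_decomposition nu)).
Let N := projT1 (cid exN).

Definition hahn : hahn_decomposition nu P N := projT2 (cid exN).

Definition charge_integral (phi : 'rV[R]_d * R -> R[i]) : R[i] :=
  cintegral (jordan_pos hahn) setT phi - cintegral (jordan_neg hahn) setT phi.

Definition tv_norm (p : nat) : \bar R :=
  (\int[charge_variation hahn]_x ((1 + `|x.2|) ^+ p)%:E)%E.

(* M_p(S^{d-1} x R): the measures on S^{d-1} x R are the measures on R^d x R that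
   vanish off S^{d-1} x R. *)
Definition weighted_measure (p : nat) :=
  (forall A, measurable A -> A `&` (usphere R d `*` setT) = set0 -> nu A = 0) /\
  (tv_norm p < +oo)%E.

(* nu extends the functional phi |-> \int_(S^{d-1}) <H_w, phi(w, .)> dw. *)
Definition extends (H : 'rV[R]_d -> distr R) :=
  forall phi, schwartz_sphere phi ->
    cintegral (sphere_measure R d) (usphere R d) (fun w => H w (fun b => phi (w, b)))
    = charge_integral phi.

End charge.
End sphere_measures.

(* Main.v *)
(** The measure is h times the product of the measure of the sphere and of Lebesgue
    measure, where h(w, b) = (2 pi)^-1 \int Hhat_w(rho) e^(i b rho) drho. It is real
    because ghat, hence Hhat_w, is hermitian. Since the traces of Hhat_w agree at the
    origin, its weak derivatives on R \ {0} are weak derivatives on R, so that p + 2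
    integrations by parts give
    (1 + |b|)^(p + 2) |h(w, b)| <= C ||Hhat_w||_(W^(p+2,1)), and the factor
    (1 + |b|)^-2 left over is integrable. The measure extends the functional by
    Fourier inversion on Schwartz functions and Fubini. Uniqueness holds because
    indicators of open boxes are limits of bounded sequences of Schwartz functions and
    the boxes form a pi-system generating the Borel sets. *)
Require Import Defs.
From HB Require Import structures.
From mathcomp Require Import all_boot all_order all_algebra.
From mathcomp Require Import all_classical all_reals all_analysis.
From mathcomp Require Import measurable_realfun complex ring lra.

Set Implicit Arguments.
Unset Strict Implicit.
Unset Printing Implicit Defensive.

Import Order.TTheory GRing.Theory Num.Theory.
Import numFieldNormedType.Exports.

Local Open Scope classical_set_scope.
Local Open Scope ring_scope.

(** The traces must match because a jump c of the k-th derivative of Hhat_w at 0 would add c times a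
    Dirac mass to the next one, and h would then decay no faster than |b|^-(k+1). Complex
    exponentials are avoided: everything reduces to [trig th g b], the integral of g(r) cos(b r +
    th). Differentiating in b, like multiplying by b, only advances the phase [th] by pi / 2, so one
    induction serves the cosine and the sine transforms. On the sphere the obstacle is that w |->
    ||Hhat_w|| is not known to be measurable, while the traces match only for almost every w. Its
    integral is that of an arbitrary nonnegative function, so only monotonicity and restriction to
    sets of full measure are applied to it, and constants are moved through the integrals of
    measurable functions instead. The total variation is defined by a Hahn decomposition obtained by
    choice; uniqueness of such decompositions up to null sets replaces it by the sign of h. For the
    uniqueness of mu, signed measures are compared through sums of Jordan parts, which are finite
    nonnegative measures. *)

(** * Smooth functions of a real variable *)

Section smooth_real.
Context {R : realType}.
Implicit Types (f g : R -> R) (x : R) (A : (R -> R) -> Prop).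

Record smooth f : Prop := Smooth {
  smoothP : forall n x, derivable (derive1n n f) x 1 }.

(** Coinduction: a class of derivable functions stable under derivation contains only smooth
    functions, so smoothness needs no closed form of the n-th derivative. *)
Lemma smooth_class A f : A f ->
  (forall g, A g -> (forall x : R, derivable g x 1) /\ A (derive1 g)) -> smooth f.
Proof.
move=> Af AP; split=> n; suff : A (derive1n n f) by move=> /AP[].
by elim: n => [//|n ih]; rewrite derive1nS; apply: (AP _ ih).2.
Qed.

Lemma smooth_derive f : smooth f -> smooth (derive1 f).
Proof. by move=> [sf]; split=> n x; rewrite -derive1Sn; exact: sf. Qed.

Lemma smooth_derive1n n f : smooth f -> smooth (derive1n n f).
Proof.
move=> sf; elim: n => [//|n ih].
by rewrite derive1nS; exact: (smooth_derive ih).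
Qed.

Lemma smooth_derivable f x : smooth f -> derivable f x 1.
Proof. by move=> [/(_ 0%N x)]. Qed.

Lemma smooth_is_derive f x : smooth f -> is_derive x (1 : R) f (derive1 f x).
Proof. by move=> sf; rewrite derive1E; apply: derivableP; exact: smooth_derivable. Qed.

Lemma is_derive_derive1 f x (df : R) : is_derive x (1 : R) f df -> derive1 f x = df.
Proof. by move=> fdf; rewrite derive1E derive_val. Qed.

Lemma derive1_ext f (df : R -> R) : (forall x : R, is_derive x (1 : R) f (df x)) -> derive1 f = df.
Proof. by move=> fdf; apply/funext => x; exact: is_derive_derive1. Qed.

Lemma smooth_continuous f : smooth f -> continuous f.
Proof.
move=> sf x; apply/differentiable_continuous/derivable1_diffP.
exact: smooth_derivable.
Qed.

Lemma smooth_cst (c : R) : smooth (fun=> c).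
Proof.
apply: (@smooth_class (fun g => exists c : R, g = fun=> c)) => [|g [k ->]].
  by exists c.
split=> //; exists 0; apply: derive1_ext => x; exact: is_derive_cst.
Qed.

Lemma smooth_id : smooth (fun x => x).
Proof.
apply: (@smooth_class (fun g => smooth g \/ g = fun x => x)) => [|g]; first by right.
move=> [sg|->]; first by split=> [x|]; [exact: smooth_derivable|left; exact: smooth_derive].
split=> //; left; rewrite (derive1_ext (df := fun=> 1)); exact: smooth_cst.
Qed.

(** A class to feed to [smooth_class]. The product and chain rules do not leave it, which dispenses
    with higher-order formulas; composition is restricted to smooth factors so that the chain rule
    yields a composition times a base element. *)
Inductive smooth_alg : (R -> R) -> Prop :=
| SA_base f : smooth f -> smooth_alg f
| SA_add f g : smooth_alg f -> smooth_alg g -> smooth_alg (fun x => f x + g x)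
| SA_mul f g : smooth_alg f -> smooth_alg g -> smooth_alg (fun x => f x * g x)
| SA_comp f g : smooth f -> smooth g -> smooth_alg (f \o g).

Lemma smooth_alg_smooth f : smooth_alg f -> smooth f.
Proof.
move=> /smooth_class; apply=> g; elim=> {g} [g sg|g h _ [dg sg] _ [dh sh]|
    g h Ag [dg sg] Ah [dh sh]|g h sg sh].
- by split=> [x|]; [exact: smooth_derivable|exact/SA_base/smooth_derive].
- split=> [x|]; first exact: derivableD.
  have D x : is_derive x (1 : R) (fun x => g x + h x) (derive1 g x + derive1 h x).
    by rewrite !derive1E; apply: is_deriveD; exact: derivableP.
  by rewrite (derive1_ext D); exact: SA_add.
- split=> [x|]; first exact: derivableM.
  have D x : is_derive x (1 : R) (fun x => g x * h x) (g x * derive1 h x + h x * derive1 g x).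
    by rewrite !derive1E; apply: is_deriveM; exact: derivableP.
  by rewrite (derive1_ext D); apply: SA_add; apply: SA_mul.
- have D x : is_derive x (1 : R) (g \o h) (derive1 g (h x) * derive1 h x).
    by apply: is_derive1_comp; exact: smooth_is_derive.
  split=> [x|]; first by have [] := D x.
  rewrite (derive1_ext D); apply: SA_mul.
    exact: (SA_comp (smooth_derive sg) sh).
  exact/SA_base/smooth_derive.
Qed.

Lemma smoothD f g : smooth f -> smooth g -> smooth (fun x => f x + g x).
Proof. by move=> sf sg; apply/smooth_alg_smooth/SA_add; apply: SA_base. Qed.

Lemma smoothM f g : smooth f -> smooth g -> smooth (fun x => f x * g x).
Proof. by move=> sf sg; apply/smooth_alg_smooth/SA_mul; apply: SA_base. Qed.

Lemma smooth_comp f g : smooth f -> smooth g -> smooth (f \o g).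
Proof. by move=> sf sg; apply/smooth_alg_smooth/SA_comp. Qed.

Lemma smoothZ (c : R) f : smooth f -> smooth (fun x => c * f x).
Proof. by move=> sf; exact: smoothM (smooth_cst c) sf. Qed.

Lemma smoothN f : smooth f -> smooth (fun x => - f x).
Proof.
by move=> /(@smoothZ (-1)); under eq_fun do rewrite mulN1r.
Qed.

Lemma smoothB f g : smooth f -> smooth g -> smooth (fun x => f x - g x).
Proof. by move=> sf sg; exact: smoothD sf (smoothN sg). Qed.

Lemma smooth_affine (a b : R) : smooth (fun x => a * x + b).
Proof. by apply: smoothD; [apply: smoothZ; exact: smooth_id|exact: smooth_cst]. Qed.

(** Derivation is a quarter-turn of the phase. With the phase as a parameter, the shifted cosines,
    sine included, are stable under derivation. *)
Lemma derive1_cosD (a : R) : derive1 (fun x : R => cos (x + a)) = fun x => cos (x + (a + pi / 2)).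
Proof.
apply: derive1_ext => x.
rewrite addrA cosD cos_pihalf mulr0 sub0r sin_pihalf mulr1.
rewrite -[X in is_derive _ _ _ X]mulr1.
apply: is_derive1_comp.
by rewrite -[X in is_derive _ _ _ X]addr0; apply: is_deriveD.
Qed.

Lemma smooth_cosD (a : R) : smooth (fun x => cos (x + a)).
Proof.
apply: (@smooth_class (fun g => exists a : R, g = fun x => cos (x + a))); first by exists a.
move=> g [{}a ->]; split; last by exists (a + pi / 2); rewrite derive1_cosD.
by move=> x; rewrite (_ : (fun x => _) = cos \o (fun x => x + a)).
Qed.

Lemma smooth_cos (b a : R) : smooth (fun x => cos (b * x + a)).
Proof.
have := smooth_comp (smooth_cosD a) (smoothZ b smooth_id); exact.
Qed.

Lemma derive1_cos (b a : R) :
  derive1 (fun x : R => cos (b * x + a)) = fun x => b * cos (b * x + (a + pi / 2)).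
Proof.
apply: derive1_ext => x.
have -> : (fun x : R => cos (b * x + a)) = (fun x => cos (x + a)) \o ( *%R b) by [].
rewrite mulrC; apply: is_derive1_comp.
  have := smooth_is_derive (b * x) (smooth_cosD a).
  by rewrite derive1_cosD.
have := smooth_is_derive x (smoothZ b smooth_id).
by rewrite derive1Ml ?derive1_id ?mulr1//; exact: derivable_id.
Qed.

Lemma derive1M f g x : derivable f x 1 -> derivable g x 1 ->
  derive1 (fun x => f x * g x) x = f x * derive1 g x + g x * derive1 f x.
Proof.
move=> /derivableP df /derivableP dg; have D := is_deriveM df dg.
by rewrite !derive1E -[LHS]/('D_1 (f * g) x) derive_val.
Qed.

Lemma derive1_smoothM f g : smooth f -> smooth g ->
  derive1 (fun x => f x * g x) = fun x => f x * derive1 g x + g x * derive1 f x.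
Proof.
by move=> sf sg; apply/funext => x; apply: derive1M; exact: smooth_derivable.
Qed.

Lemma derive1_scale (c : R) f : smooth f ->
  derive1 (fun x => f (c * x)) = fun x => c * derive1 f (c * x).
Proof.
move=> sf; apply: derive1_ext => x; rewrite mulrC.
apply: (@is_derive1_comp _ f ( *%R c)); first exact: smooth_is_derive.
have := smooth_is_derive x (smoothZ c smooth_id).
by rewrite derive1Ml ?derive1_id ?mulr1//; exact: derivable_id.
Qed.

End smooth_real.

(** * Functions flat at the origin *)

Section flat_exp.
Context {R : realType}.

(** [flat 0] is the classical exp(-1/t) extended by 0. The power of 1/t is a parameter because the
    derivatives are combinations of the [flat k]. *)
Definition flat (k : nat) (t : R) : R := if 0 < t then t^-1 ^+ k * expR (- t^-1) else 0.

Lemma flat_gt0E k t : 0 < t -> flat k t = t^-1 ^+ k * expR (- t^-1).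
Proof. by rewrite /flat => ->. Qed.

Lemma flat_le0E k t : t <= 0 -> flat k t = 0.
Proof. by rewrite /flat ltNge => ->. Qed.

Lemma flat_ge0 k t : 0 <= flat k t.
Proof.
rewrite /flat; case: ifPn => // t0.
by rewrite mulr_ge0 ?expR_ge0// exprn_ge0// invr_ge0 ltW.
Qed.

Lemma exprn_expRN k (s : R) : 0 <= s -> s ^+ k * expR (- s) <= k`!%:R.
Proof.
move=> s0; rewrite expRN ler_pdivrMr ?expR_gt0// mulrC -ler_pdivrMr ?ltr0n ?fact_gt0//.
case: k => [|k]; first by rewrite expr0 fact0 divr1 -[1]expR0 ler_expR.
by apply: le_trans (expR_ge1Dxn k s0); rewrite lerDr ler01.
Qed.

Lemma flat_le k t : flat k t <= k`!%:R.
Proof.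
rewrite /flat; case: ifPn => // t0.
by apply: exprn_expRN; rewrite invr_ge0 ltW.
Qed.

Lemma flatS k t : flat k t = flat k.+1 t * t.
Proof.
rewrite /flat; case: ifPn => [t0|_]; last by rewrite mul0r.
by rewrite exprSr mulrAC -(mulrA (t^-1 ^+ k)) mulVf ?mulr1// gt_eqF.
Qed.

Lemma is_derive_flat k (t : R) :
  is_derive t (1 : R) (flat k) (flat k.+2 t - k%:R * flat k.+1 t).
Proof.
have [t0|t0|->] := ltgtP t 0.
- rewrite !flat_le0E ?ltW// mulr0 subr0.
  apply: (@near_eq_is_derive _ _ _ (cst 0)).
  by near=> z; rewrite flat_le0E//; near: z; exact: lt_le_nbhsl.
- pose h := (fun z : R => (z^-1 ^+ k) * expR (- z^-1)).
  apply: (@near_eq_is_derive _ _ _ h).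
    near=> z; rewrite flat_gt0E//; near: z; exact: lt_nbhsr.
  have tn0 : t != 0 by rewrite gt_eqF.
  have dV : is_derive t (1 : R) (fun z : R => z^-1) (- t ^- 2).
    by rewrite -[X in is_derive _ _ _ X]mulr1; exact: (@is_deriveV _ id).
  have dE : is_derive t (1 : R) (fun z : R => expR (- z^-1)) (expR (- t^-1) * t ^- 2).
    apply: (@is_derive1_comp _ expR (fun z => - z^-1)).
    by rewrite -[X in is_derive _ _ _ X]opprK; exact: is_deriveN.
  have dX : is_derive t (1 : R) (fun z : R => z^-1 ^+ k) ((k%:R * t^-1 ^+ k.-1) *: (- t ^- 2)).
    have -> : (fun z : R => z^-1 ^+ k) = (fun z : R => z^-1) ^+ k.
      by apply/funext => z; rewrite exprfctE.
    exact: is_deriveX.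
  apply: (@is_derive_eq _ _ _ _ _ _ _ _ (is_deriveM dX dE)).
  rewrite !flat_gt0E// /GRing.scale/= -exprVn.
  case: k {h dX} => [|k]; first by rewrite !expr0 mul0r !mul0r mulr0 addr0 subr0 mul1r mulrC.
  rewrite /= !exprS; ring.
(* At 0 the difference quotient is [flat k.+1] by [flatS]; a second use of [flatS] bounds it by
   (k+2)! |z|, hence its continuity there. *)
- rewrite !flat_le0E// mulr0 subr0; apply/is_derive1_caratheodory.
  exists (flat k.+1); split; last exact: flat_le0E.
    by move=> z; rewrite (flat_le0E k (lexx _)) !subr0; exact: flatS.
  rewrite /prop_for /continuous_at flat_le0E//; apply: norm_cvg0.
  apply: (@squeeze_cvgr _ _ _ _ (cst 0) (fun z => (k.+2)`!%:R * `|z|)).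
  - apply: nearW => z; rewrite normr_ge0 (flatS k.+1) normrM ger0_norm ?flat_ge0//=.
    by rewrite ler_wpM2r// flat_le.
  - exact: cvg_cst.
  - have N : `|z| @[z --> (0 : R)] --> (0 : R).
      by have := @norm_continuous _ R 0; rewrite /continuous_at normr0.
    by rewrite -[X in _ --> X](mulr0 ((k.+2)`!%:R)); exact: cvgMr N.
Unshelve. all: by end_near. Qed.

Inductive flat_span : (R -> R) -> Prop :=
| FS_flat k : flat_span (flat k)
| FS_add f g : flat_span f -> flat_span g -> flat_span (fun x => f x + g x)
| FS_scale c f : flat_span f -> flat_span (fun x => c * f x).

Lemma smooth_flat k : smooth (flat k).
Proof.
apply: smooth_class (FS_flat k) _ => g; elim=> {k g} [k|f g sf [df ihf] sg [dg ihg]|c f sf [df ihf]].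
- split=> [x|]; first by have [] := is_derive_flat k x.
  rewrite (derive1_ext (is_derive_flat k)) -[X in flat_span X]/(fun x => flat k.+2 x + (- (k%:R * flat k.+1 x))).
  under eq_fun do rewrite -mulNr.
  by apply: FS_add; [exact: FS_flat|exact/FS_scale/FS_flat].
- have D x : is_derive x (1 : R) (fun x => f x + g x) (derive1 f x + derive1 g x).
    by rewrite !derive1E; apply: is_deriveD; exact: derivableP.
  split=> [x|]; first by have [] := D x.
  by rewrite (derive1_ext D); exact: FS_add.
- have D x : is_derive x (1 : R) (fun x => c * f x) (c * derive1 f x).
    by rewrite !derive1E; apply: is_deriveZ; exact: derivableP.
  split=> [x|]; first by have [] := D x.
  by rewrite (derive1_ext D); exact: FS_scale.
Qed.

End flat_exp.

(** * Limits of sequences and real-valued integrals *)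

Lemma cvgn_eq (R : realType) (u v : nat -> R) (a b : R) : u =1 v ->
  u n @[n --> \oo] --> a -> v n @[n --> \oo] --> b -> a = b.
Proof.
by move=> /funext ->; exact: (@cvg_unique _ (@norm_hausdorff _ R^o)).
Qed.

Section real_integrals.
Context d {T : measurableType d} {R : realType}.
Variable mu : {measure set T -> \bar R}.
Implicit Types (f g h : T -> R).
Local Notation integ f := (mu.-integrable setT (EFin \o f)).

Lemma integ_measurable f : integ f -> measurable_fun setT f.
Proof. by move=> /integrableP[/measurable_EFinP]. Qed.

Lemma integ_le f g : measurable_fun setT f -> integ g ->
  (forall x, `|f x| <= g x) -> integ f.
Proof.
move=> mf ig fg; apply: le_integrable ig => //; first exact/measurable_EFinP.
by move=> x _ /=; rewrite lee_fin (le_trans (fg x))// ler_norm.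
Qed.

Lemma integD f g : integ f -> integ g -> integ (fun x => f x + g x).
Proof. by move=> jf jg; exact: (integrableD measurableT jf jg). Qed.

Lemma integB f g : integ f -> integ g -> integ (fun x => f x - g x).
Proof. by move=> jf jg; exact: (integrableB measurableT jf jg). Qed.

Lemma integZ (c : R) f : integ f -> integ (fun x => c * f x).
Proof. by move=> jf; exact: (integrableZl measurableT c jf). Qed.

Lemma integ_norm f : integ f -> integ (fun x => `|f x|).
Proof. by move=> *; exact: integrable_norm. Qed.

Lemma integMb f g (M : R) : integ f -> measurable_fun setT g ->
  (forall x, `|g x| <= M) -> integ (fun x => f x * g x).
Proof.
move=> jf mg gM; apply: (@integ_le _ (fun x => M * `|f x|)).
- by apply: measurable_funM => //; exact: integ_measurable.
- exact/integZ/integ_norm.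
- by move=> x; rewrite normrM mulrC ler_wpM2r.
Qed.

Lemma RintD f g : integ f -> integ g ->
  \int[mu]_x (f x + g x) = \int[mu]_x f x + \int[mu]_x g x.
Proof. by move=> *; exact: RintegralD. Qed.

Lemma RintB f g : integ f -> integ g ->
  \int[mu]_x (f x - g x) = \int[mu]_x f x - \int[mu]_x g x.
Proof. by move=> *; exact: RintegralB. Qed.

Lemma RintZ (c : R) f : integ f -> \int[mu]_x (c * f x) = c * \int[mu]_x f x.
Proof. by move=> *; exact: RintegralZl. Qed.

(** Since [fine] sends both infinities to 0, the identity holds without integrability; Fourier
    integrals of arbitrary functions can then be conjugated. *)
Lemma RintN f : \int[mu]_x (- f x) = - \int[mu]_x f x.
Proof.
rewrite /Rintegral [in LHS]integralE [in RHS]integralE.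
have -> : (fun x => (- f x)%:E)^\+%E = (fun x => (f x)%:E)^\-%E.
  exact: (funeposN (EFin \o f)).
have -> : (fun x => (- f x)%:E)^\-%E = (fun x => (f x)%:E)^\+%E.
  exact: (funenegN (EFin \o f)).
have : (0 <= \int[mu]_x (fun x => (f x)%:E)^\+%E x)%E by apply: integral_ge0.
have : (0 <= \int[mu]_x (fun x => (f x)%:E)^\-%E x)%E by apply: integral_ge0.
by case: integral => [r| |]//; case: integral => [s| |]//= _ _; rewrite ?oppr0// opprB.
Qed.

Lemma eqRint f g : f =1 g -> \int[mu]_x f x = \int[mu]_x g x.
Proof. by move=> fg; apply: eq_Rintegral => x _; exact: fg. Qed.

Lemma Rint_norm_le f : integ f -> `|\int[mu]_x f x| <= \int[mu]_x `|f x|.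
Proof. by move=> jf; exact: le_normr_Rintegral. Qed.

Lemma Rint_le_dom f g : measurable_fun setT f -> integ g ->
  (forall x, `|f x| <= g x) -> `|\int[mu]_x f x| <= \int[mu]_x g x.
Proof.
move=> mf ig fg; have jf := integ_le mf ig fg.
apply: le_trans (Rint_norm_le jf) _.
by apply: le_Rintegral => //; exact: integ_norm.
Qed.

Lemma Rint_ae f g : measurable_fun setT f -> measurable_fun setT g ->
  {ae mu, forall x, f x = g x} -> \int[mu]_x f x = \int[mu]_x g x.
Proof.
move=> mf mg fg; congr fine; apply: ae_eq_integral => //.
- exact/measurable_EFinP.
- exact/measurable_EFinP.
- by apply: filterS fg => x /= ->.
Qed.

Lemma Rint_dct (F : nat -> T -> R) f g :
  (forall n, measurable_fun setT (F n)) -> measurable_fun setT f ->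
  integ g -> (forall n x, `|F n x| <= g x) ->
  {ae mu, forall x, F n x @[n --> \oo] --> f x} ->
  \int[mu]_x F n x @[n --> \oo] --> \int[mu]_x f x.
Proof.
move=> mF mf ig Fg Ff.
have mFE n : measurable_fun setT (EFin \o F n) by exact/measurable_EFinP.
have mfE : measurable_fun setT (EFin \o f) by exact/measurable_EFinP.
have FfE : {ae mu, forall x, setT x -> (F n x)%:E @[n --> \oo] --> (f x)%:E}.
  by apply: filterS Ff => x Fx _; apply: cvg_EFin => //; exact: nearW.
have FgE : {ae mu, forall x n, setT x -> (`|(F n x)%:E| <= (g x)%:E)%E}.
  by apply: aeW => x n _; rewrite lee_fin.
have [jf _ H] := dominated_convergence measurableT mFE mfE FfE ig FgE.
by apply: fine_cvg; rewrite fineK//; exact: integrable_fin_num.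
Qed.

End real_integrals.

(** * Lebesgue integrals on the line: decay, primitives, changes of variable, parity *)

Section lebesgue_line.
Context {R : realType}.
Local Notation mu := (@lebesgue_measure R).
Local Notation integ f := (mu.-integrable setT (EFin \o f)).
Implicit Types f g F : R -> R.

Lemma integ_leR f g : measurable_fun [set: R] f -> integ g ->
  (forall x, `|f x| <= g x) -> integ f.
Proof. exact: (@integ_le _ _ _ mu). Qed.

Lemma integMbR f g (M : R) : integ f -> measurable_fun [set: R] g ->
  (forall x, `|g x| <= M) -> integ (fun x => f x * g x).
Proof. exact: (@integMb _ _ _ mu). Qed.

Lemma integ_oneDsqrV : integ (fun x => (1 + x ^+ 2)^-1).
Proof.
apply/integrableP; split.
  apply/measurable_EFinP; apply: continuous_measurable_fun.
  exact: continuous_oneDsqrV.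
under eq_integral do rewrite /= ger0_norm ?invr_ge0 ?addr_ge0// ?sqr_ge0//.
rewrite ge0_symfun_integralT; last 3 first.
- by move=> x; rewrite invr_ge0 addr_ge0// sqr_ge0.
- exact: continuous_oneDsqrV.
- by move=> x /=; rewrite sqrrN.
rewrite -set_itvcy integral0y_oneDsqr.
by rewrite -EFinM ltry.
Qed.

Lemma Rint_oneDsqrV : \int[mu]_x (1 + x ^+ 2)^-1 = pi.
Proof.
rewrite /Rintegral ge0_symfun_integralT; last 3 first.
- by move=> x; rewrite invr_ge0 addr_ge0// sqr_ge0.
- exact: continuous_oneDsqrV.
- by move=> x /=; rewrite sqrrN.
rewrite -set_itvcy integral0y_oneDsqr/=.
by rewrite mulrCA mulfV ?mulr1.
Qed.

Lemma integ_decay f (M : R) : measurable_fun setT f ->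
  (forall x, `|f x| <= M * (1 + x ^+ 2)^-1) -> integ f.
Proof.
move=> mf fM; have := @integ_le _ _ _ mu f (fun x => M * (1 + x ^+ 2)^-1) mf.
by apply => //; exact/integZ/integ_oneDsqrV.
Qed.

Lemma ae_neq0 (P : R -> Prop) : (forall x, x != 0 -> P x) -> {ae mu, forall x, P x}.
Proof.
move=> H; exists [set 0]; split; [exact: measurable_set1|exact: lebesgue_measure_set1|].
by move=> x /= nP; apply: contrapT => /eqP /H.
Qed.

(** The formula on the segments [a n, c n] passes to the limit by dominated convergence, |f| on D
    being the dominating function. Leaving D free covers both the line and the half-line. *)
Lemma FTC_exhaust F f (D : set R) (a c : nat -> R) (l1 l2 : R) :
  (forall x : R, is_derive x (1 : R) F (f x)) -> continuous f ->
  measurable D -> integ (f \_ D) ->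
  (forall n, a n < c n) -> (forall n, `[a n, c n] `<=` D) ->
  (forall x, D x -> \forall n \near \oo, a n <= x <= c n) ->
  F (c n) @[n --> \oo] --> l1 -> F (a n) @[n --> \oo] --> l2 ->
  \int[mu]_x (f \_ D) x = l1 - l2.
Proof.
move=> dF cf mD jf ac acD Dac F1 F2.
have cF : continuous F.
  move=> x; apply/differentiable_continuous/derivable1_diffP.
  by have [] := dF x.
have mf : measurable_fun setT f by exact: continuous_measurable_fun.
pose G n x := (f \_ `[a n, c n]) x.
have GE n : \int[mu]_x G n x = F (c n) - F (a n).
  rewrite /G -Rintegral_mkcond /Rintegral (@continuous_FTC2 _ f F)//.
  - exact: continuous_subspaceT.
  - split; [|by apply: cvg_at_right_filter; exact: cF|by apply: cvg_at_left_filter; exact: cF].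
    by move=> x _; have [] := dF x.
  - by move=> x _; exact: is_derive_derive1.
have L1 : \int[mu]_x G n x @[n --> \oo] --> \int[mu]_x (f \_ D) x.
  apply: (@Rint_dct _ _ _ mu G _ (fun x => `|(f \_ D) x|)) => //.
  - by move=> n; apply/measurable_restrict => //; exact: measurable_funS mf.
  - by apply/measurable_restrict => //; exact: measurable_funS mf.
  - exact: integ_norm.
  - move=> n x; rewrite /G !patchE; case: ifPn => [xac|_]; last by rewrite normr0.
    by rewrite ifT// inE; apply: (acD n); rewrite inE in xac.
  - apply: aeW => x; apply: cvg_near_cst; rewrite /G patchE.
    case: ifPn => [/set_mem Dx|Dx].
      by apply: filterS (Dac _ Dx) => n h; rewrite patchE ifT// inE/= in_itv.
    apply: nearW => n; rewrite patchE ifF//; apply: contraNF Dx => /set_mem h.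
    by rewrite inE; exact: acD h.
apply: (@cvg_unique _ (@norm_hausdorff _ R^o) _ _ _ _ L1) => /=.
under eq_fun do rewrite GE.
exact: cvgB F1 F2.
Qed.

Lemma FTC_sym F f (l1 l2 : R) : (forall x : R, is_derive x (1 : R) F (f x)) ->
  continuous f -> integ f ->
  F n.+1%:R @[n --> \oo] --> l1 -> F (- n.+1%:R) @[n --> \oo] --> l2 ->
  \int[mu]_x f x = l1 - l2.
Proof.
move=> dF cf jf F1 F2.
rewrite -(@FTC_exhaust F f setT (fun n => - n.+1%:R) (fun n => n.+1%:R) l1 l2) ?patch_setT//.
- by move=> n; rewrite gtrN// ltr0n.
- move=> x _; near=> n; rewrite -ler_norml.
  by rewrite (@le_trans _ _ n%:R)// ?ler_nat//; near: n; exact: nbhs_infty_ger.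
Unshelve. all: by end_near. Qed.

Lemma FTC_half F f (l : R) : (forall x : R, is_derive x (1 : R) F (f x)) ->
  continuous f -> integ (f \_ `[0, +oo[) -> F n.+1%:R @[n --> \oo] --> l ->
  \int[mu]_x (f \_ `[0, +oo[) x = l - F 0.
Proof.
move=> dF cf jf F1; apply: (@FTC_exhaust F f _ (fun=> 0) (fun n => n.+1%:R)) => //.
- by move=> n x /=; rewrite !in_itv/= andbT => /andP[].
- move=> x /=; rewrite in_itv/= andbT => x0; near=> n; rewrite x0/=.
  apply: (le_trans (ler_norm x)).
  by rewrite (@le_trans _ _ n%:R)// ?ler_nat//; near: n; exact: nbhs_infty_ger.
- exact: cvg_cst.
Unshelve. all: by end_near. Qed.

Lemma ge0_Rint_affine (a b : R) f : 0 < a -> continuous f -> (forall x, 0 <= f x) ->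
  (\int[mu]_x (f x)%:E = \int[mu]_x (a * f (a * x + b))%:E)%E.
Proof.
move=> a0 cf f0.
have dF x : is_derive x (1 : R) (fun x => a * x + b) a.
  have D : is_derive x (1 : R) (fun x => a * x + b) (a *: 1 + 0) by exact: is_deriveD.
  by apply: (@is_derive_eq _ _ _ _ _ _ _ _ D); rewrite addr0 /GRing.scale/= mulr1.
rewrite (@increasing_ge0_integration_by_substitutionT _ (fun x => a * x + b))//.
- apply: eq_integral => x _.
  by rewrite (derive1_ext dF) /= mulrC.
- by move=> x y xy; rewrite ltrD2r ltr_pM2l.
- rewrite (derive1_ext dF); exact: cst_continuous.
- rewrite (derive1_ext dF); exact: is_cvg_cst.
- rewrite (derive1_ext dF); exact: is_cvg_cst.
- apply/cvgrNyPle => A; near=> x.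
  rewrite -lerBrDr -ler_pdivlMl//; near: x; exact: nbhs_ninfty_le.
- apply/cvgryPge => A; near=> x.
  rewrite -lerBlDr -ler_pdivrMl//; near: x; exact: nbhs_pinfty_ge.
Unshelve. all: by end_near. Qed.

(** Both f + |f| and |f| are continuous and nonnegative, and their difference is f. *)
Lemma Rint_affine (a b : R) f : 0 < a -> continuous f -> integ f ->
  integ (fun x => f (a * x + b)) /\ \int[mu]_x f x = a * \int[mu]_x f (a * x + b).
Proof.
move=> a0 cf jf.
have cn : continuous (fun x => `|f x|).
  by move=> x; apply: cvg_norm; exact: cf.
have mf : measurable_fun setT (fun x => f (a * x + b)).
  apply: (@measurableT_comp _ _ _ _ _ _ f); first exact: continuous_measurable_fun.
  apply: continuous_measurable_fun; exact: (smooth_continuous (smooth_affine a b)).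
have jn : integ (fun x => a * `|f (a * x + b)|).
  apply/integrableP; split.
    by apply/measurable_EFinP; apply: measurable_funM => //; exact: measurableT_comp.
  under eq_integral do rewrite /= ger0_norm ?mulr_ge0 ?(ltW a0)//.
  rewrite -(ge0_Rint_affine b a0 cn)//.
  by have /integrableP[_ /=] := jf.
have jf1 : integ (fun x => f (a * x + b)).
  apply: (integ_leR mf (integZ a^-1 jn)) => x.
  by rewrite mulrA mulVf ?mul1r// gt_eqF.
split=> //.
have c2 : continuous (fun x => f x + `|f x|).
  by move=> x; apply: cvgD; [exact: cf|exact: cn].
have p2 x : 0 <= f x + `|f x| by rewrite -lerBlDl sub0r -normrN ler_norm.
have E1 : \int[mu]_x (f x + `|f x|) = a * \int[mu]_x (f (a * x + b) + `|f (a * x + b)|).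
  rewrite -RintZ; first by rewrite /Rintegral (ge0_Rint_affine b a0 c2 p2).
  by apply: integD => //; exact: integ_norm.
have E2 : \int[mu]_x `|f x| = a * \int[mu]_x `|f (a * x + b)|.
  by rewrite -RintZ; [rewrite /Rintegral (ge0_Rint_affine b a0 cn)|exact: integ_norm].
move: E1; rewrite !RintD//; try exact: integ_norm.
by rewrite mulrDr -E2 => /addIr.
Qed.

Lemma ge0_Rint_opp f : measurable_fun setT f -> (forall x, 0 <= f x) ->
  (\int[mu]_x (f x)%:E = \int[mu]_x (f (- x))%:E)%E.
Proof.
move=> mf f0.
transitivity (\int[mu]_(x in (-%R : _ -> measurableTypeR R) @^-1` setT) (f (- x))%:E)%E.
  rewrite -(@ge0_integral_pushforward _ _ (measurableTypeR R) (measurableTypeR R) R (-%R : _ -> measurableTypeR R) _ mu setT (EFin \o f))//.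
  - by apply: eq_measure_integral => //= A mA AS; exact/esym/lebesgue_measureN.
  - exact/measurable_EFinP.
  - by move=> x _; rewrite /= lee_fin f0.
by rewrite preimage_setT.
Qed.

Lemma Rint_opp f : integ f ->
  integ (fun x => f (- x)) /\ \int[mu]_x f x = \int[mu]_x f (- x).
Proof.
move=> jf; have mf := integ_measurable jf.
have mfo : measurable_fun [set: R] (fun x : R => f (- x)).
  by apply: (@measurableT_comp _ _ _ _ _ _ f) => //; exact: oppr_measurable.
have jn : integ (fun x => `|f (- x)|).
  apply/integrableP; split; first by apply/measurable_EFinP; exact: measurableT_comp.
  under eq_integral do rewrite /= normr_id.
  rewrite -(@ge0_Rint_opp (fun x => `|f x|))//; last exact: measurableT_comp.
  by have /integrableP[_ /=] := jf.
have jo : integ (fun x => f (- x)) by apply: (integ_leR mfo jn) => x.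
split=> //.
have p2 x : 0 <= f x + `|f x| by rewrite -lerBlDl sub0r -normrN ler_norm.
have E1 : \int[mu]_x (f x + `|f x|) = \int[mu]_x (f (- x) + `|f (- x)|).
  rewrite /Rintegral (@ge0_Rint_opp (fun x => f x + `|f x|))//.
  by apply: measurable_funD => //; exact: measurableT_comp.
have E2 : \int[mu]_x `|f x| = \int[mu]_x `|f (- x)|.
  by rewrite /Rintegral (@ge0_Rint_opp (fun x => `|f x|))//; exact: measurableT_comp.
move: E1; rewrite !RintD//; try exact: integ_norm.
by rewrite -E2 => /addIr.
Qed.

Lemma Rint_odd f : integ f -> (forall x, f (- x) = - f x) -> \int[mu]_x f x = 0.
Proof.
move=> /Rint_opp[jf E] odd; move: E; rewrite (eqRint mu odd) RintN => E.
by apply/eqP; rewrite -[_ == 0](mulrn_eq0 _ 2) mulr2n {1}E addNr.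
Qed.

Lemma Rint_even f : integ f -> (forall x, f (- x) = f x) ->
  \int[mu]_x f x = 2 * \int[mu]_x (f \_ `[0, +oo[) x.
Proof.
move=> jf even; have mf := integ_measurable jf.
have jp : integ (f \_ `[0, +oo[).
  apply: integ_leR (integ_norm jf) _.
    by apply/measurable_restrict => //; exact: measurable_funS mf.
  by move=> x; rewrite patchE; case: ifP => // _; rewrite normr0.
have [jo E] := Rint_opp jp.
have -> : \int[mu]_x f x = \int[mu]_x ((f \_ `[0, +oo[) x + (f \_ `[0, +oo[) (- x)).
  apply: Rint_ae => //.
    by apply: measurable_funD; [exact: (integ_measurable jp)|exact: (integ_measurable jo)].
  have pE (y : R) : (y \in (`[0, +oo[%classic : set R)) = (0 <= y).
    apply/idP/idP => [/set_mem|y0]; first by rewrite /= in_itv andbT.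
    by apply/mem_set; rewrite /= in_itv/= andbT.
  (* The two closed half-lines overlap only at 0, a null set. *)
  apply: ae_neq0 => x x0; rewrite !patchE !pE oppr_ge0 even.
  by case: (ltgtP x 0) x0 => // _ _; rewrite ?addr0 ?add0r.
by rewrite RintD// -E mulr_natl mulr2n.
Qed.

End lebesgue_line.

(** * Fubini for a bounded kernel between two integrable functions *)

Section fubini_kernel.
Context d1 d2 (T1 : measurableType d1) (T2 : measurableType d2) (R : realType).
Variable m1 : {sigma_finite_measure set T1 -> \bar R}.
Variable m2 : {sigma_finite_measure set T2 -> \bar R}.

Lemma measurable_Rint_r (F : T1 * T2 -> R) : measurable_fun setT F ->
  measurable_fun setT (fun x => \int[m2]_y F (x, y)).
Proof.
move=> mF; apply: measurableT_comp => //=.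
under eq_fun do rewrite integralE.
apply: emeasurable_funB.
- rewrite (_ : (fun x => _) = (fun x => \int[m2]_y (EFin \o F)^\+ (x, y))%E); last first.
    by apply/funext => x; apply: eq_integral => y _; rewrite !funeposE.
  by apply: measurable_fun_fubini_tonelli_F => //; apply: measurable_funepos; exact/measurable_EFinP.
- rewrite (_ : (fun x => _) = (fun x => \int[m2]_y (EFin \o F)^\- (x, y))%E); last first.
    by apply/funext => x; apply: eq_integral => y _; rewrite !funenegE.
  by apply: measurable_fun_fubini_tonelli_F => //; apply: measurable_funeneg; exact/measurable_EFinP.
Qed.

Lemma fubini_bounded_kernel (K : T1 * T2 -> R) (g : T1 -> R) (f : T2 -> R) (M : R) :
  measurable_fun setT K -> (forall z, `|K z| <= M) ->
  m1.-integrable setT (EFin \o g) -> m2.-integrable setT (EFin \o f) ->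
  \int[m1]_x (g x * \int[m2]_y (f y * K (x, y))) =
  \int[m2]_y (f y * \int[m1]_x (g x * K (x, y))).
Proof.
move=> mK KM jg jf.
have mK1 y : measurable_fun setT (fun x => K (x, y)) by exact: measurableT_comp.
have mK2 x : measurable_fun setT (fun y => K (x, y)) by exact: measurableT_comp.
have mg := integ_measurable jg; have mf := integ_measurable jf.
have jK2 x : m2.-integrable setT (EFin \o (fun y => f y * K (x, y))).
  by apply: (integMb (M := M)) => // y; exact: KM.
have jK1 y : m1.-integrable setT (EFin \o (fun x => g x * K (x, y))).
  by apply: (integMb (M := M)) => // x; exact: KM.
pose F := fun z : T1 * T2 => (g z.1 * f z.2 * K z)%:E.
have mF : measurable_fun setT F.
  apply/measurable_EFinP; apply: measurable_funM => //; apply: measurable_funM.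
    exact: measurableT_comp.
  exact: measurableT_comp.
have jF : (m1 \x m2)%E.-integrable setT F.
  apply/integrable12ltyP => //.
  have /integrableP[_ gy] := jg; have /integrableP[mEf fy] := jf.
  have f0 : (0 <= \int[m2]_y `|(EFin \o f) y|)%E by apply: integral_ge0.
  apply: (@le_lt_trans _ _ (\int[m1]_x ((`|(EFin \o g) x|) * (`|M|%:E * \int[m2]_y `|(EFin \o f) y|)))%E).
    apply: ge0_le_integral => //.
    - by move=> x _; apply: integral_ge0.
    - have mAF : measurable_fun setT (abse \o F) by exact: measurableT_comp.
      have A0 z : (0 <= (abse \o F) z)%E by exact: abse_ge0.
      have := @measurable_fun_fubini_tonelli_F _ _ _ _ _ m2 _ mAF A0.
      by [].
    - by apply: emeasurable_funM => //; apply: measurableT_comp => //; exact/measurable_EFinP.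
    - move=> x _; rewrite muleA -ge0_integralZl//; last exact: measurableT_comp.
      apply: ge0_le_integral => //.
      + by apply: measurableT_comp => //; exact: measurableT_comp.
      + by apply: measurable_funeM; exact: measurableT_comp.
      + move=> y _; rewrite /F/= -!EFinM lee_fin !normrM mulrAC ler_wpM2r//.
        by rewrite ler_wpM2l// (le_trans (KM _))// ler_norm.
  rewrite ge0_integralZr//; last 2 first.
  - by apply: measurableT_comp => //; exact/measurable_EFinP.
  - by apply: mule_ge0.
  rewrite lte_mul_pinfty//; first exact: integral_ge0.
    by rewrite ge0_fin_numE//; exact: integral_ge0.
  by rewrite lte_mul_pinfty.
have := Fubini jF.
have -> : (\int[m1]_x \int[m2]_y F (x, y) = \int[m1]_x (g x * \int[m2]_y (f y * K (x, y)))%:E)%E.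
  apply: eq_integral => x _.
  rewrite -RintZ//= /Rintegral fineK; first by apply: eq_integral => y _; rewrite /F/= mulrA.
  exact: integrable_fin_num (integZ _ (jK2 x)).
have -> : (\int[m2]_y \int[m1]_x F (x, y) = \int[m2]_y (f y * \int[m1]_x (g x * K (x, y)))%:E)%E.
  apply: eq_integral => y _.
  rewrite -RintZ//= /Rintegral fineK; first by apply: eq_integral => x _; rewrite /F/= mulrA (mulrC (f y)).
  exact: integrable_fin_num (integZ _ (jK1 y)).
by rewrite /Rintegral => ->.
Qed.

End fubini_kernel.

(** * Cosine transforms with a phase *)

Section trig_transform.
Context {R : realType}.
Local Notation mu := (@lebesgue_measure R).
Local Notation integ f := (mu.-integrable setT (EFin \o f)).
Implicit Types f g : R -> R.

(** Phase 0 gives the cosine transform, phase -pi/2 the sine transform, phase pi/2 its opposite. The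
    real and imaginary parts of Fourier integrals are sums of such terms. *)
Definition trig (th : R) g (b : R) : R := \int[mu]_r (g r * cos (b * r + th)).

Lemma measurable_cos_affine (b th : R) : measurable_fun [set: R] (fun r : R => cos (b * r + th)).
Proof.
by apply: continuous_measurable_fun; exact: (smooth_continuous (smooth_cos b th)).
Qed.

Lemma norm_cos_le (x : R) : `|cos x| <= 1.
Proof. by rewrite ler_norml cos_geN1 cos_le1. Qed.

Lemma integ_trig (th b : R) g : integ g -> integ (fun r => g r * cos (b * r + th)).
Proof.
move=> jg; apply: (integMbR (M := 1)) => //; first exact: measurable_cos_affine.
by move=> x; exact: norm_cos_le.
Qed.

Lemma trig_le (th b : R) g : integ g -> `|trig th g b| <= \int[mu]_r `|g r|.
Proof.
move=> jg; apply: (@Rint_le_dom _ _ _ mu _ (fun r => `|g r|)).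
- exact: (integ_measurable (integ_trig th b jg)).
- exact: integ_norm.
- by move=> x; rewrite normrM ler_piMr// norm_cos_le.
Qed.

Lemma trigN (th : R) g b : trig (th + pi) g b = - trig th g b.
Proof.
by rewrite /trig -RintN; apply: eqRint => r; rewrite addrA cosDpi mulrN.
Qed.

Lemma trig_opp (th b : R) g : trig th g (- b) = trig (- th) g b.
Proof.
by apply: eqRint => r; rewrite -[in RHS]cosN opprD opprK mulNr.
Qed.

(** Derivation under the integral sign, dominated by |r g(r)|; the factor r comes with a
    quarter-turn of the phase. *)
Lemma is_derive_trig (th b : R) g : integ g -> integ (fun r => r * g r) ->
  is_derive b (1 : R) (trig th g) (trig (th + pi / 2) (fun r => r * g r) b).
Proof.
move=> jg jrg.
pose F := fun (x y : R) => g y * cos (x * y + th).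
have dF (x y : R) : is_derive x (1 : R) (F ^~ y) (y * g y * cos (x * y + (th + pi / 2))).
  have -> : F ^~ y = fun x => g y * cos (y * x + th) by apply/funext => z; rewrite /F (mulrC z).
  have := smooth_is_derive x (smoothZ (g y) (smooth_cos y th)).
  rewrite derive1Ml; last exact: smooth_derivable (smooth_cos y th).
  by rewrite derive1_cos mulrA (mulrC (g y)) (mulrC y x).
have D1E x y : partial1of2 F x y = y * g y * cos (x * y + (th + pi / 2)).
  by rewrite partial1of2E; have [_ ->] := dF x y.
have bI : (`]b - 1, b + 1[%classic : set R) b.
  by rewrite /= in_itv/= ltrBlDr ltrDl ltr01.
have jF x : (`]b - 1, b + 1[%classic : set R) x -> integ (F x).
  by move=> _; exact: integ_trig.
have dF' x y : (`]b - 1, b + 1[%classic : set R) x -> setT y -> derivable (F ^~ y) x 1.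
  by move=> _ _; have [] := dF x y.
have ub x y : (`]b - 1, b + 1[%classic : set R) x -> setT y ->
    `|partial1of2 F x y| <= `|y * g y|.
  by move=> _ _; rewrite D1E normrM ler_piMr// norm_cos_le.
have dT := @derivable_under_integral R _ _ mu F setT measurableT b (b - 1) (b + 1) bI jF dF'
  (fun y => `|y * g y|) (fun y => normr_ge0 _) (integ_norm jrg) ub.
have vT := @differentiation_under_integral R _ _ mu F setT measurableT b (b - 1) (b + 1) bI jF dF'
  (fun y => `|y * g y|) (fun y => normr_ge0 _) (integ_norm jrg) ub.
apply: DeriveDef; first exact: dT.
rewrite -derive1E [LHS]vT; apply: eqRint => r.
by rewrite D1E.
Qed.

Lemma measurable_trig (th : R) g : integ g -> measurable_fun [set: R] (trig th g).
Proof.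
move=> jg; apply: (@measurable_Rint_r _ _ _ _ _ mu (fun z : R * R => g z.2 * cos (z.1 * z.2 + th))).
apply: measurable_funM.
  by apply: (@measurableT_comp _ _ _ _ _ _ g) => //; exact: (integ_measurable jg).
apply: (@measurableT_comp _ _ _ _ _ _ (@cos R)).
  by apply: continuous_measurable_fun; exact: continuous_cos.
by apply: measurable_funD => //; apply: measurable_funM.
Qed.

(** The kernel cos(b r + th) is symmetric in b and r, so Fubini moves the transform from one factor
    to the other. *)
Lemma trig_swap (th : R) f g : integ f -> integ g ->
  \int[mu]_r (g r * trig th f r) = \int[mu]_b (f b * trig th g b).
Proof.
move=> jf jg; pose K := fun z : R * R => cos (z.1 * z.2 + th).
have mK : measurable_fun setT K.
  apply: (@measurableT_comp _ _ _ _ _ _ (@cos R)).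
    by apply: continuous_measurable_fun; exact: continuous_cos.
  by apply: measurable_funD => //; apply: measurable_funM.
have E := @fubini_bounded_kernel _ _ _ _ _ mu mu K g f 1 mK (fun z => norm_cos_le _) jg jf.
apply: (etrans E); apply: eqRint => b; congr (_ * _); apply: eqRint => r.
by rewrite /K/= (mulrC r).
Qed.

End trig_transform.

(** * Test functions and weak derivatives on the line *)

Section weak_derivative.
Context {R : realType}.
Local Notation mu := (@lebesgue_measure R).
Local Notation integ f := (mu.-integrable setT (EFin \o f)).
Implicit Types f g : R -> R.

Lemma smooth_measurable f : smooth f -> measurable_fun [set: R] f.
Proof. by move=> sf; apply: continuous_measurable_fun; exact: smooth_continuous. Qed.

Definition rtest (O : set R) f := smooth f /\
  exists K : set R, [/\ compact K, K `<=` O & forall x, ~ K x -> f x = 0].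

Definition rweak (O : set R) g g' := forall f, rtest O f ->
  \int[mu]_r (g r * derive1 f r) = - \int[mu]_r (g' r * f r).

Lemma rtest_derive O f : rtest O f -> rtest O (derive1 f).
Proof.
move=> [sf [K [cK KO K0]]]; split; first exact: smooth_derive.
exists K; split=> // x nKx.
apply: is_derive_derive1; apply: (@near_eq_is_derive _ _ _ (cst 0)).
have : open (~` K) by apply: closed_openC; apply: compact_closed.
rewrite openE => /(_ x nKx); rewrite /interior/=.
by apply: filterS => y /K0 ->.
Qed.

Lemma bounded_compact_support f K : continuous f -> compact K ->
  (forall x, ~ K x -> f x = 0) -> exists M : R, forall x, `|f x| <= M.
Proof.
move=> cf cK K0.
have : compact (f @` K) by apply: continuous_compact => //; exact: continuous_subspaceT.
move=> /compact_bounded[M [_ HM]]; exists (`|M| + 1) => x.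
have [Kx|nKx] := pselect (K x); last by rewrite K0// normr0 addr_ge0.
by apply: HM; [rewrite (le_lt_trans (ler_norm M))// ltrDl|exists x].
Qed.

Lemma rtest_bounded O f : rtest O f -> exists M : R, forall x, `|f x| <= M.
Proof.
move=> [sf [K [cK _ K0]]].
by apply: bounded_compact_support cK K0; exact: smooth_continuous.
Qed.

Lemma rtest_vanish O f : rtest O f -> exists M : R, forall x, M < `|x| -> f x = 0.
Proof.
move=> [_ [K [/compact_bounded[M [_ HM]] _ K0]]]; exists (`|M| + 1) => x Mx.
apply: K0 => Kx; suff : `|x| <= `|M| + 1 by rewrite leNgt Mx.
by apply: HM => //; rewrite (le_lt_trans (ler_norm M))// ltrDl.
Qed.

Lemma rtest_mul O f g : rtest O f -> smooth g -> rtest O (fun x => f x * g x).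
Proof.
move=> [sf [K [cK KO K0]]] sg; split; first exact: smoothM.
by exists K; split=> // x /K0 ->; rewrite mul0r.
Qed.

(** As [flat 0 1] is exp(-1), the prefactor makes the value at 0 equal to 1, so that the dilated
    bumps tend to 1 everywhere. *)
Definition cbump (x : R) : R := expR 1 ^+ 2 * (flat 0 (1 + x) * flat 0 (1 - x)).

Lemma smooth_bump : smooth cbump.
Proof.
apply: smoothZ; apply: smoothM.
  rewrite (_ : (fun x => _) = flat 0 \o (fun x : R => 1 * x + 1)).
    exact: smooth_comp (smooth_flat 0) (smooth_affine 1 1).
  by apply/funext => x /=; rewrite mul1r addrC.
rewrite (_ : (fun x => _) = flat 0 \o (fun x : R => -1 * x + 1)).
  exact: smooth_comp (smooth_flat 0) (smooth_affine (-1) 1).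
by apply/funext => x /=; rewrite mulN1r addrC.
Qed.

Lemma bump0 : cbump 0 = 1.
Proof.
rewrite /cbump addr0 subr0 !flat_gt0E// !expr0 !mul1r invr1 -!expr2 -exprMn.
by rewrite -expRD subrr expR0 expr1n.
Qed.

Lemma bump_out x : 1 <= `|x| -> cbump x = 0.
Proof.
rewrite /cbump ler_normr => /orP[x1|x1].
  by rewrite (@flat_le0E _ _ (1 - x)) ?subr_le0// !mulr0.
by rewrite (@flat_le0E _ _ (1 + x)) ?mul0r ?mulr0//; lra.
Qed.

Lemma rtest_bump (n : nat) : rtest setT (fun x => cbump (n.+1%:R^-1 * x)).
Proof.
split; first exact: (smooth_comp smooth_bump (smoothZ _ smooth_id)).
exists (`[- n.+1%:R, n.+1%:R]%classic : set R); split=> //; first exact: segment_compact.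
move=> x /= xn; apply: bump_out; rewrite leNgt; apply/negP => h; apply: xn.
rewrite in_itv/= -ler_norml -(@ler_pM2l _ n.+1%:R^-1) ?invr_gt0//.
by rewrite mulVf// -[X in X * _]ger0_norm ?invr_ge0// -normrM ltW.
Qed.

Lemma cvg_bump (x : R) : cbump (n.+1%:R^-1 * x) @[n --> \oo] --> (1 : R).
Proof.
rewrite -[X in _ --> X]bump0; apply: continuous_cvg; first exact: (smooth_continuous smooth_bump).
by rewrite -[X in _ --> X](mul0r x); apply: cvgMl; exact: cvg_harmonic.
Qed.

(** Cosines have no compact support. Multiplied by the bump dilated by n + 1 they become test
    functions; the derivative of the dilated bump is O(1/n), and dominated convergence removes the
    cutoff. *)
Lemma weak_against_smooth g g' f (M : R) : integ g -> integ g' -> rweak setT g g' ->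
  smooth f -> (forall x, `|f x| <= M) -> (forall x, `|derive1 f x| <= M) ->
  \int[mu]_r (g r * derive1 f r) = - \int[mu]_r (g' r * f r).
Proof.
move=> jg jg' gg' sf fM dfM.
have [B0 B0P] := rtest_bounded (rtest_bump 0).
have [B1 B1P] := rtest_bounded (rtest_derive (rtest_bump 0)).
have EB : (fun x : R => cbump (1%:R^-1 * x)) = cbump by apply/funext => x; rewrite invr1 mul1r.
rewrite {}EB in B1P.
have {}B0P x : `|cbump x| <= B0 by have := B0P x; rewrite invr1 mul1r.
have M0 : 0 <= M := le_trans (normr_ge0 _) (fM 0).
have B00 : 0 <= B0 := le_trans (normr_ge0 _) (B0P 0).
have B10 : 0 <= B1 := le_trans (normr_ge0 _) (B1P 0).
pose t n (x : R) := cbump (n.+1%:R^-1 * x).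
have st n : smooth (t n) by have [] := rtest_bump n.
have dt n x : derive1 (t n) x = n.+1%:R^-1 * derive1 cbump (n.+1%:R^-1 * x).
  by rewrite /t derive1_scale//; exact: smooth_bump.
have E n : \int[mu]_r (g r * (t n r * derive1 f r + f r * derive1 (t n) r)) =
           - \int[mu]_r (g' r * (t n r * f r)).
  have := gg' _ (rtest_mul (rtest_bump n) sf).
  by rewrite (derive1_smoothM (st n) sf).
have n1 n : `|n.+1%:R^-1 : R| <= 1 by rewrite ger0_norm ?invr_ge0// invf_le1// ler1n.
have mg := integ_measurable jg; have mg' := integ_measurable jg'.
have mf : measurable_fun [set: R] f by apply: continuous_measurable_fun; exact: smooth_continuous.
have mdf : measurable_fun [set: R] (derive1 f).
  by apply: continuous_measurable_fun; exact: (smooth_continuous (smooth_derive sf)).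
have mt n : measurable_fun [set: R] (t n).
  by apply: continuous_measurable_fun; exact: smooth_continuous.
have mdt n : measurable_fun [set: R] (derive1 (t n)).
  by apply: continuous_measurable_fun; exact: (smooth_continuous (smooth_derive (st n))).
have L1 : \int[mu]_r (g r * (t n r * derive1 f r + f r * derive1 (t n) r)) @[n --> \oo] -->
    \int[mu]_r (g r * derive1 f r).
  apply: (@Rint_dct _ _ _ mu _ _ (fun r => (B0 * M + M * B1) * `|g r|)).
  - move=> n; apply: measurable_funM => //; apply: smooth_measurable; apply: smoothD; apply: smoothM => //.
      exact: smooth_derive.
    exact: smooth_derive.
  - exact: measurable_funM.
  - exact/integZ/integ_norm.
  - move=> n x; rewrite normrM mulrC ler_wpM2r// (le_trans (ler_normD _ _))// lerD//.
      by rewrite normrM ler_pM// B0P.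
    rewrite normrM ler_pM// dt normrM -[leRHS]mul1r ler_pM//; exact: B1P.
  - apply: aeW => x; rewrite -[X in _ --> g x * X]mul1r -[X in _ --> g x * X]addr0.
    apply: cvgMr; apply: cvgD; first by apply: cvgMl; exact: cvg_bump.
    rewrite -[X in _ --> X](mulr0 (f x)); apply: cvgMr.
    under eq_fun do rewrite dt; rewrite -(mul0r (derive1 cbump 0)).
    apply: cvgM; first exact: cvg_harmonic.
    apply: continuous_cvg; first exact: (smooth_continuous (smooth_derive smooth_bump)).
    by rewrite -[X in _ --> X](mul0r x); apply: cvgMl; exact: cvg_harmonic.
have L2 : (- (\int[mu]_r (g' r * (t n r * f r)))) @[n --> \oo] --> - (\int[mu]_r (g' r * f r)).
  apply: cvgN; apply: (@Rint_dct _ _ _ mu _ _ (fun r => (B0 * M) * `|g' r|)).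
  - by move=> n; apply: measurable_funM => //; apply: smooth_measurable; exact: smoothM.
  - exact: measurable_funM.
  - exact/integZ/integ_norm.
  - by move=> n x; rewrite normrM mulrC ler_wpM2r// normrM ler_pM// B0P.
  - apply: aeW => x; rewrite -[X in _ --> g' x * X]mul1r.
    by apply: cvgMr; apply: cvgMl; exact: cvg_bump.
exact: cvgn_eq E L1 L2.
Qed.

(** b cos(b r + th) is the r-derivative of the cosine with phase th - pi/2; the minus sign of the
    integration by parts adds pi to that phase, leaving th + pi/2. *)
Lemma trig_weak g g' (th b : R) : integ g -> integ g' -> rweak setT g g' ->
  b * trig th g b = trig (th + pi / 2) g' b.
Proof.
move=> jg jg' gg'.
have pihalfK (x : R) : x + - (pi / 2) + pi / 2 = x by rewrite subrK.
have D : derive1 (fun r => cos (b * r + (th - pi / 2))) = fun r => b * cos (b * r + th).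
  by rewrite derive1_cos pihalfK.
have /(_ (smooth_cos _ _)) := @weak_against_smooth g g' (fun r => cos (b * r + (th - pi / 2))) (1 + `|b|) jg jg' gg'.
rewrite D => E; rewrite /trig -RintZ; last exact: integ_trig.
under eqRint do rewrite mulrCA.
rewrite E.
- rewrite -RintN; apply: eqRint => r; rewrite -mulrN; congr (_ * _).
  have -> : b * r + (th + pi / 2) = b * r + (th - pi / 2) + pi by lra.
  by rewrite cosDpi.
- by move=> x; rewrite (le_trans (norm_cos_le _))// lerDl.
- move=> x; rewrite normrM (@le_trans _ _ `|b|)// ?lerDr//.
  by rewrite ler_piMr// norm_cos_le.
Qed.

(** The product of g with a test function has compact support, so the integral of its derivative is
    0. *)
Lemma rweak_smooth g (M : R) : smooth g -> integ g -> integ (derive1 g) ->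
  (forall x, `|g x| <= M) -> rweak setT g (derive1 g).
Proof.
move=> sg jg jg' gM f tf; have [sf _] := tf.
have [B BP] := rtest_bounded tf; have [B' BP'] := rtest_bounded (rtest_derive tf).
have mf : measurable_fun [set: R] f by apply: continuous_measurable_fun; exact: smooth_continuous.
have mdf : measurable_fun [set: R] (derive1 f).
  by apply: continuous_measurable_fun; exact: (smooth_continuous (smooth_derive sf)).
have j1 : integ (fun r => g r * derive1 f r) by exact: (integMbR jg mdf BP').
have j2 : integ (fun r => derive1 g r * f r) by exact: (integMbR jg' mf BP).
apply/eqP; rewrite -addr_eq0 -RintD//; apply/eqP.
have D x : is_derive x (1 : R) (fun x => g x * f x) (g x * derive1 f x + derive1 g x * f x).
  have := smooth_is_derive x (smoothM sg sf).
  by rewrite (derive1_smoothM sg sf) (mulrC (f x)).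
have [A AP] := rtest_vanish tf.
have far : \forall n \near \oo, A < n.+1%:R.
  near=> n; rewrite (@le_lt_trans _ _ n%:R)// ?ltr_nat//; near: n; exact: nbhs_infty_ger.
rewrite -(subrr 0); apply: (FTC_sym D).
- move=> x; apply: cvgD; apply: cvgM.
  + exact: smooth_continuous.
  + exact: (smooth_continuous (smooth_derive sf)).
  + exact: (smooth_continuous (smooth_derive sg)).
  + exact: smooth_continuous.
- exact: integD.
- by apply: cvg_near_cst; apply: filterS far => n An; rewrite AP ?mulr0// ger0_norm.
- by apply: cvg_near_cst; apply: filterS far => n An; rewrite AP ?mulr0// normrN ger0_norm.
Unshelve. all: by end_near. Qed.

End weak_derivative.

(** * Real Schwartz functions and their transforms *)

Section schwartz_real.
Context {R : realType}.
Local Notation mu := (@lebesgue_measure R).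
Local Notation integ f := (mu.-integrable setT (EFin \o f)).
Implicit Types f g : R -> R.

Record rs f : Prop := RS {
  rs_smooth : smooth f ;
  rs_decay : forall j k, exists M : R, forall x, (1 + `|x|) ^+ j * `|derive1n k f x| <= M }.

Lemma rs_derive f : rs f -> rs (derive1 f).
Proof.
move=> [sf df]; split; first exact: smooth_derive.
by move=> j k; have [M HM] := df j k.+1; exists M => x; rewrite -derive1Sn.
Qed.

Lemma rs_bounded f : rs f -> exists M : R, forall x, `|f x| <= M.
Proof.
move=> [_ /(_ 0%N 0%N)[M HM]]; exists M => x.
by have := HM x; rewrite expr0 mul1r.
Qed.

Lemma rs_integ f : rs f -> integ f.
Proof.
move=> [sf /(_ 2%N 0%N)[M HM]]; apply: (@integ_decay _ _ M).
  by apply: continuous_measurable_fun; exact: smooth_continuous.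
move=> x; have := HM x; rewrite derive1n0 => H.
rewrite ler_pdivlMr; last by rewrite ltr_pwDl// sqr_ge0.
apply: le_trans H; rewrite mulrC ler_wpM2r//.
by rewrite -(real_normK (num_real x)); have := normr_ge0 x; nra.
Qed.

Lemma derive1n_mulx k f : smooth f ->
  derive1n k (fun x => x * f x) = fun x => x * derive1n k f x + k%:R * derive1n k.-1 f x.
Proof.
move=> sf; elim: k => [|k ih].
  by apply/funext => x; rewrite !derive1n0 mul0r addr0.
rewrite derive1nS ih; apply: derive1_ext => x.
have D1 := is_deriveM (is_derive_id x (1 : R)) (smooth_is_derive x (smooth_derive1n k sf)).
have D2 := smooth_is_derive x (smoothZ k%:R (smooth_derive1n k.-1 sf)).
apply: (@is_derive_eq _ _ _ _ _ _ _ _ (is_deriveD D1 D2)).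
rewrite derive1Ml; last exact: smooth_derivable (smooth_derive1n _ sf).
rewrite /GRing.scale/= mulr1 -derive1nS -addrA; congr (_ + _).
(* For k = 0 the predecessor [k.-1] is again 0, but its coefficient vanishes. *)
case: k {ih D1 D2} => [|k]; first by rewrite mul0r addr0 mul1r.
by rewrite -derive1nS /= -[in RHS]natr1 mulrDl mul1r addrC.
Qed.

Lemma rs_mulx f : rs f -> rs (fun x => x * f x).
Proof.
move=> [sf df]; split; first exact: (smoothM smooth_id).
move=> j k; have [M1 H1] := df j.+1 k; have [M2 H2] := df j k.-1.
exists (M1 + k%:R * M2) => x; rewrite derive1n_mulx//.
rewrite (le_trans (ler_wpM2l _ (ler_normD _ _)))//.
rewrite mulrDr lerD//.
  apply: le_trans (H1 x); rewrite normrM mulrA ler_wpM2r// exprSr ler_wpM2l//.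
  by rewrite lerDr.
by rewrite normrM mulrCA ger0_norm// ler_wpM2l.
Qed.

Lemma trig_mulb f (th b : R) : rs f -> b * trig th f b = trig (th + pi / 2) (derive1 f) b.
Proof.
move=> rf; have [M HM] := rs_bounded rf.
apply: trig_weak; [exact: rs_integ|exact/rs_integ/rs_derive|].
by apply: rweak_smooth HM; [exact: rs_smooth|exact: rs_integ|exact/rs_integ/rs_derive].
Qed.

(** Each factor 1 + |x| costs one step: [trig_mulb] trades its |x| for a derivative of f and a new
    phase, whence the induction over all f and th. *)
Lemma trig_decay j f th : rs f -> exists M : R, forall x, (1 + `|x|) ^+ j * `|trig th f x| <= M.
Proof.
elim: j f th => [|j ih] f th rf.
  exists (\int[mu]_r `|f r|) => x; rewrite expr0 mul1r.
  exact/trig_le/rs_integ.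
have [M1 H1] := ih f th rf; have [M2 H2] := ih _ (th + pi / 2) (rs_derive rf).
exists (M1 + M2) => x; rewrite exprSr -mulrA mulrDl mul1r -normrM trig_mulb//.
by rewrite mulrDr lerD.
Qed.

Lemma derive1_trig f th : rs f -> derive1 (trig th f) = trig (th + pi / 2) (fun x => x * f x).
Proof.
move=> rf; apply: derive1_ext => x; apply: is_derive_trig; first exact: rs_integ.
exact/rs_integ/rs_mulx.
Qed.

Lemma rs_trig f th : rs f -> rs (trig th f).
Proof.
move=> rf; split.
  apply: (@smooth_class _ (fun g => exists th f, rs f /\ g = trig th f)); first by exists th, f.
  move=> g [{}th [{}f [{}rf ->]]]; split.
    move=> x; have [] := is_derive_trig th x (rs_integ rf) (rs_integ (rs_mulx rf)).
    by [].
  by exists (th + pi / 2), (fun x => x * f x); split; [exact: rs_mulx|exact: derive1_trig].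
move=> j k; elim: k f th rf => [|k ih] f th rf; first exact: trig_decay.
have [M HM] := ih _ (th + pi / 2) (rs_mulx rf).
by exists M => x; rewrite derive1Sn derive1_trig.
Qed.

End schwartz_real.

(** * Fourier inversion on Schwartz functions by Abel summation *)

Section inversion.
Context {R : realType}.
Local Notation mu := (@lebesgue_measure R).
Local Notation integ f := (mu.-integrable setT (EFin \o f)).
Implicit Types f g : R -> R.

(* The Abel summation factor, whose Fourier transform is the Poisson kernel. *)
Definition abel (e : R) (r : R) : R := expR (- (e * `|r|)).

Lemma abel_ge0 e r : 0 <= abel e r. Proof. exact: expR_ge0. Qed.

Lemma abel_le1 e r : 0 <= e -> abel e r <= 1.
Proof.
by move=> e0; rewrite -expR0 ler_expR oppr_le0 mulr_ge0.
Qed.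

Lemma continuous_abel e : continuous (abel e).
Proof.
move=> r; apply: continuous_comp; last exact: continuous_expR.
by apply: continuousN; apply: cvgMr; exact: norm_continuous.
Qed.

(** From exp(s) >= 1 + s^2/2 at s = e|r| and e <= 1 one gets e^2 (1 + r^2) <= 2 exp(e|r|), which is
    the bound with constant 2 / e^2. *)
Lemma integ_abel e : 0 < e -> e <= 1 -> integ (abel e).
Proof.
move=> e0 e1; apply: (@integ_decay _ _ (2 / e ^+ 2)).
  by apply: continuous_measurable_fun; exact: continuous_abel.
move=> r; rewrite ger0_norm ?abel_ge0// /abel expRN.
have H : 1 + (e * `|r|) ^+ 2 / 2 <= expR (e * `|r|).
  by have := @expR_ge1Dxn _ (e * `|r|) 1 (mulr_ge0 (ltW e0) (normr_ge0 r)).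
have P : 0 < 1 + r ^+ 2 by rewrite ltr_pwDl// sqr_ge0.
rewrite ler_pdivlMr// mulrC ler_pdivrMr ?expR_gt0// mulrAC ler_pdivlMr ?exprn_gt0//.
move: H; rewrite exprMn real_normK ?num_real//.
have : e ^+ 2 <= 1 by rewrite expr_le1// ltW.
set E := expR _; set e2 := e ^+ 2; set r2 := r ^+ 2; rewrite mulrDl mul1r (mulrC r2).
lra.
Qed.

Lemma Rint_abel_cos (e c : R) : 0 < e -> e <= 1 ->
  \int[mu]_r (abel e r * cos (r * c)) = 2 * e / (e ^+ 2 + c ^+ 2).
Proof.
move=> e0 e1.
have D0 : 0 < e ^+ 2 + c ^+ 2 by rewrite ltr_pwDl ?exprn_gt0 ?sqr_ge0.
(* The real part of exp((-e + ic) r) / (-e + ic), a primitive of the real part of exp((-e + ic) r).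
   It serves on r >= 0, where |r| = r; evenness gives the other half. *)
pose F r := expR (- e * r) * (c * sin (c * r) - e * cos (c * r)) / (e ^+ 2 + c ^+ 2).
pose f r := expR (- e * r) * cos (r * c).
have dF r : is_derive r (1 : R) F (f r).
  have dl (a : R) : is_derive r (1 : R) (fun r => a * r) a.
    have D : is_derive r (1 : R) (fun r => a * r) (a *: 1) by exact: is_deriveZ.
    by apply: (@is_derive_eq _ _ _ _ _ _ _ _ D); rewrite /GRing.scale/= mulr1.
  have d1 : is_derive r (1 : R) (fun r => expR (- e * r)) (expR (- e * r) * (- e)).
    by apply: (@is_derive1_comp _ expR).
  have d2 : is_derive r (1 : R) (fun r => sin (c * r)) (cos (c * r) * c).
    by apply: (@is_derive1_comp _ sin).
  have d3 : is_derive r (1 : R) (fun r => cos (c * r)) (- sin (c * r) * c).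
    by apply: (@is_derive1_comp _ cos).
  have d4 := is_deriveM d1 (is_deriveB (is_deriveZ c d2) (is_deriveZ e d3)).
  have d5 := is_deriveZ (e ^+ 2 + c ^+ 2)^-1 d4.
  have -> : F = (fun r => (e ^+ 2 + c ^+ 2)^-1 *:
      (expR (- e * r) * (c *: sin (c * r) - e *: cos (c * r)))).
    by apply/funext => y; rewrite /F mulrC.
  apply: (@is_derive_eq _ _ _ _ _ _ _ _ d5).
  have -> : f r = expR (- e * r) * cos (c * r) by rewrite /f (mulrC r).
  rewrite -[LHS]/((e ^+ 2 + c ^+ 2)^-1 * (expR (- e * r) *
    (c * (cos (c * r) * c) - e * (- sin (c * r) * c)) +
    (c * sin (c * r) - e * cos (c * r)) * (expR (- e * r) * - e))).
  field.
  by rewrite gt_eqF.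
have jA : integ (fun r => abel e r * cos (r * c)).
  apply: (integMbR (M := 1)) (integ_abel e0 e1) _ _; last by move=> x; exact: norm_cos_le.
  have := measurable_cos_affine c 0.
  by under eq_fun do rewrite addr0 mulrC.
rewrite Rint_even//; last first.
  by move=> r; rewrite /abel normrN mulNr cosN.
have Ef : (fun r => abel e r * cos (r * c)) \_ `[0, +oo[ = f \_ `[0, +oo[.
  apply/funext => r; rewrite !patchE; case: ifPn => // /set_mem.
  by rewrite /= in_itv/= andbT => r0; rewrite /abel/f ger0_norm// mulNr.
rewrite Ef (@FTC_half _ F f 0)//.
- rewrite /F mulr0 expR0 mulr0 sin0 cos0 mulr0 mulr1 !sub0r mul1r; lra.
- move=> r; apply: cvgM.
    by apply: continuous_comp; [apply: cvgMr; exact: cvg_id|exact: continuous_expR].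
  by apply: continuous_comp; [apply: cvgMl; exact: cvg_id|exact: continuous_cos].
- rewrite -Ef; apply: integ_leR (integ_norm jA) _.
    by apply/measurable_restrict => //; apply: measurable_funS (integ_measurable jA).
  by move=> x; rewrite patchE; case: ifP => // _; rewrite normr0.
(* The primitive vanishes at infinity: exp(-e N) <= 1 / (e N), and the oscillating factor is at most
   |c| + e. *)
- pose C := (`|c| + e) / (e ^+ 2 + c ^+ 2) / e.
  apply: norm_cvg0; apply: (@squeeze_cvgr _ _ _ _ (cst 0) (fun n => C * n.+1%:R^-1)).
  + apply: nearW => n; rewrite normr_ge0/= /F /C.
    have N0 : 0 < n.+1%:R :> R by [].
    set N := n.+1%:R in N0 *; clearbody N.
    rewrite (_ : _ / _ / e / N = (e * N)^-1 * (`|c| + e) / (e ^+ 2 + c ^+ 2)); last first.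
      by field; rewrite !gt_eqF.
    rewrite normrM (@ger0_norm _ (_^-1)) ?invr_ge0 ?(ltW D0)// ler_pM2r ?invr_gt0//.
    rewrite normrM ger0_norm ?expR_ge0// ler_pM ?expR_ge0//; last first.
      rewrite (le_trans (ler_normB _ _))// !normrM (gtr0_norm e0) lerD// ?ler_piMr// ?(ltW e0)//.
        by rewrite ler_norml sin_geN1 sin_le1.
      by rewrite norm_cos_le.
    rewrite mulNr expRN lef_pV2 ?posrE ?expR_gt0 ?mulr_gt0//.
    by rewrite (le_trans _ (expR_ge1Dx _))// lerDr.
  + exact: cvg_cst.
  + by rewrite -[X in _ --> X](mulr0 C); apply: cvgMr; exact: cvg_harmonic.
Qed.

Lemma cvg_abel (r : R) : abel n.+1%:R^-1 r @[n --> \oo] --> (1 : R).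
Proof.
rewrite -[X in _ --> X]expR0; apply: continuous_cvg; first exact: continuous_expR.
rewrite -[X in _ --> X]oppr0; apply: cvgN; rewrite -[X in _ --> X](mul0r `|r|).
by apply: cvgMl; exact: cvg_harmonic.
Qed.

Lemma poisson_cvg f (x M : R) : continuous f -> (forall y, `|f y| <= M) ->
  \int[mu]_y (f (n.+1%:R^-1 * y + x) * (1 + y ^+ 2)^-1) @[n --> \oo] --> pi * f x.
Proof.
move=> cf fM.
have E : pi * f x = \int[mu]_y (f x * (1 + y ^+ 2)^-1).
  by rewrite (RintZ _ integ_oneDsqrV) Rint_oneDsqrV mulrC.
have mV : measurable_fun [set: R] (fun y : R => (1 + y ^+ 2)^-1).
  by apply: continuous_measurable_fun; exact: continuous_oneDsqrV.
rewrite E; apply: (@Rint_dct _ _ _ mu _ _ (fun y => M * (1 + y ^+ 2)^-1)).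
- move=> n; apply: measurable_funM => //.
  apply: (@measurableT_comp _ _ _ _ _ _ f); first exact: continuous_measurable_fun.
  by apply: continuous_measurable_fun; exact: (smooth_continuous (smooth_affine _ _)).
- exact: measurable_funM.
- exact: integZ integ_oneDsqrV.
- move=> n y; rewrite normrM (@ger0_norm _ (1 + _)^-1) ?invr_ge0 ?addr_ge0 ?sqr_ge0//.
  by rewrite ler_wpM2r// invr_ge0 addr_ge0// sqr_ge0.
- apply: aeW => y; apply: cvgMl; apply: continuous_cvg; first exact: cf.
  rewrite -[X in _ --> X]add0r; apply: cvgD; last exact: cvg_cst.
  by rewrite -[X in _ --> X](mul0r y); apply: cvgMl; exact: cvg_harmonic.
Qed.

(** Fubini applies the Abel factor to the cosine, which produces the Poisson kernel at b - x; the
    substitution b = e y + x turns this kernel into 2 / (1 + y^2), free of e. *)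
Lemma poisson_identity f (x e M : R) : 0 < e -> e <= 1 -> continuous f ->
  (forall y, `|f y| <= M) -> integ f ->
  \int[mu]_r (abel e r * \int[mu]_b (f b * cos (r * (b - x)))) =
  2 * \int[mu]_y (f (e * y + x) * (1 + y ^+ 2)^-1).
Proof.
move=> e0 e1 cf HM jf.
pose K := fun z : R * R => cos (z.1 * (z.2 - x)).
have mK : measurable_fun setT K.
  apply: (@measurableT_comp _ _ _ _ _ _ (@cos R)).
    by apply: continuous_measurable_fun; exact: continuous_cos.
  by apply: measurable_funM => //; apply: measurable_funB.
have FE := @fubini_bounded_kernel _ _ _ _ _ mu mu K (abel e) f 1 mK
  (fun z => norm_cos_le _) (integ_abel e0 e1) jf.
apply: (etrans FE); clear FE.
pose P b := 2 * e / (e ^+ 2 + (b - x) ^+ 2).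
have P0 b : 0 < e ^+ 2 + (b - x) ^+ 2 by rewrite ltr_pwDl ?exprn_gt0 ?sqr_ge0.
have cP : continuous P.
  move=> b; apply: cvgMr; apply: cvgV; first by rewrite gt_eqF.
  apply: cvgD; first exact: cvg_cst.
  apply: (@continuous_comp _ _ _ (fun b => b - x) (fun y => y ^+ 2)); last exact: exprn_continuous.
  by apply: cvgB; [exact: cvg_id|exact: cvg_cst].
have jP : integ (fun b => f b * P b).
  apply: (integMbR (M := 2 / e)) jf _ _; first exact: continuous_measurable_fun.
  move=> b; rewrite ger0_norm; last by rewrite ltW// divr_gt0// mulr_gt0.
  rewrite /P ler_pdivrMr// mulrAC ler_pdivlMr// -mulrA ler_pM2l//.
  by rewrite -expr2 lerDl sqr_ge0.
have cfP : continuous (fun b => f b * P b) by move=> b; apply: continuousM; [exact: cf|exact: cP].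
have [_ AE] := Rint_affine x e0 cfP jP.
transitivity (\int[mu]_b (f b * P b)).
  apply: eqRint => b; congr (_ * _).
  by rewrite (Rint_abel_cos (b - x) e0 e1).
have j3 : integ (fun y => f (e * y + x) * (1 + y ^+ 2)^-1).
  apply: (@integ_decay _ _ M).
    apply: measurable_funM.
      apply: (@measurableT_comp _ _ _ _ _ _ f); first exact: continuous_measurable_fun.
      by apply: continuous_measurable_fun; exact: (smooth_continuous (smooth_affine _ _)).
    by apply: continuous_measurable_fun; exact: continuous_oneDsqrV.
  move=> y; rewrite normrM (@ger0_norm _ (1 + _)^-1) ?invr_ge0 ?addr_ge0 ?sqr_ge0//.
  by rewrite ler_wpM2r// invr_ge0 addr_ge0// sqr_ge0.
have [j4 _] := Rint_affine x e0 cfP jP.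
rewrite AE -RintZ// -RintZ//; apply: eqRint => y.
rewrite /P addrK mulrCA [RHS]mulrCA; congr (_ * _); field.
have : 0 < 1 + y ^+ 2 by rewrite ltr_pwDl// sqr_ge0.
have -> : e ^+ 2 + (e * y) ^+ 2 = e ^+ 2 * (1 + y ^+ 2) by rewrite exprMn mulrDr mulr1.
by move=> ?; rewrite !gt_eqF// mulr_gt0// exprn_gt0.
Qed.

(** By the addition formula the two double transforms add up to the integral of G, whose kernel is
    cos(r (b - x)). With the Abel factor of parameter 1/(n+1), this integral tends to that of G by
    domination and to 2 pi f(x) by [poisson_identity]. *)
Lemma trig_inversion f (x : R) : rs f ->
  trig 0 (trig 0 f) x + trig (- (pi / 2)) (trig (- (pi / 2)) f) x = 2 * pi * f x.
Proof.
move=> rf; have jf := rs_integ rf; have [M HM] := rs_bounded rf.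
have cf : continuous f by apply: smooth_continuous; exact: rs_smooth.
pose G r := \int[mu]_b (f b * cos (r * (b - x))).
have GE r : G r = trig 0 f r * cos (x * r + 0) +
    trig (- (pi / 2)) f r * cos (x * r + - (pi / 2)).
  rewrite /trig ![_ * cos (x * r + _)]mulrC -!RintZ; try exact: integ_trig.
  rewrite -RintD; try exact/integZ/integ_trig.
  apply: eqRint => b; rewrite !addr0.
  rewrite !cosB cos_pihalf sin_pihalf !mulr0 !add0r !mulr1 mulrBr cosB (mulrC x).
  ring.
have j1 : integ (fun r => trig 0 f r * cos (x * r + 0)).
  exact: integ_trig (rs_integ (rs_trig 0 rf)).
have j2 : integ (fun r => trig (- (pi / 2)) f r * cos (x * r + - (pi / 2))).
  exact: integ_trig (rs_integ (rs_trig _ rf)).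
have jG : integ G.
  have -> : G = fun r => trig 0 f r * cos (x * r + 0) +
    trig (- (pi / 2)) f r * cos (x * r + - (pi / 2)) by exact/funext.
  exact: integD.
have -> : trig 0 (trig 0 f) x + trig (- (pi / 2)) (trig (- (pi / 2)) f) x = \int[mu]_r G r.
  by rewrite (eqRint mu GE) RintD.
have nV n : 0 < (n.+1%:R^-1 : R) by rewrite invr_gt0.
have nV1 n : (n.+1%:R^-1 : R) <= 1 by rewrite invf_le1// ler1n.
have mabel n : measurable_fun [set: R] (abel n.+1%:R^-1).
  by apply: continuous_measurable_fun; exact: continuous_abel.
have L1 : \int[mu]_r (abel n.+1%:R^-1 r * G r) @[n --> \oo] --> \int[mu]_r G r.
  apply: (@Rint_dct _ _ _ mu _ _ (fun r => `|G r|)).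
  - by move=> n; apply: measurable_funM (integ_measurable jG); exact: mabel.
  - exact: integ_measurable jG.
  - exact: integ_norm.
  - by move=> n r; rewrite normrM ler_piMl// ger0_norm ?abel_ge0// abel_le1// ltW.
  - apply: aeW => r; rewrite -[X in _ --> X]mul1r; apply: cvgMl; exact: cvg_abel.
have E n := poisson_identity x (nV n) (nV1 n) cf HM jf.
have L2 : 2 * \int[mu]_y (f (n.+1%:R^-1 * y + x) * (1 + y ^+ 2)^-1) @[n --> \oo] --> 2 * (pi * f x).
  by apply: cvgMr; exact: poisson_cvg cf HM.
by rewrite (cvgn_eq E L1 L2) mulrA.
Qed.

(** A cosine transform is even and a sine transform odd, so both outer integrands are odd. These are
    the mixed terms of the complex inversion formula. *)
Lemma trig_odd f (x : R) : rs f ->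
  trig 0 (trig (- (pi / 2)) f) x = 0 /\ trig (- (pi / 2)) (trig 0 f) x = 0.
Proof.
move=> rf; split; apply: Rint_odd; try exact: integ_trig (rs_integ (rs_trig _ rf)).
- move=> r; have e : - (pi / 2) + pi = pi / 2 :> R by lra.
  have H : trig (pi / 2) f r = - trig (- (pi / 2)) f r by rewrite -trigN e.
  by rewrite trig_opp opprK H !addr0 mulrN cosN mulNr.
- move=> r; rewrite trig_opp oppr0 -[RHS]mulrN; congr (_ * _).
  by rewrite !cosB cos_pihalf sin_pihalf !mulr0 !add0r !mulr1 mulrN sinN.
Qed.

End inversion.

(** * Extending weak derivatives across the origin *)

Section removable_point.
Context {R : realType}.
Local Notation mu := (@lebesgue_measure R).
Local Notation integ f := (mu.-integrable setT (EFin \o f)).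
Implicit Types f g : R -> R.

(* A cutoff vanishing near 0 and tending to 1 elsewhere. Being a rescaled even
   function, it has an odd derivative of integral 0 whose L^1 norm is bounded in n:
   against a function continuous at 0, this derivative tends to 0. *)
Definition plug (n : nat) (x : R) : R := flat 0 ((n.+1%:R * x) ^+ 2 - 1).

Lemma smooth_plug n : smooth (plug n).
Proof.
rewrite (_ : plug n = flat 0 \o (fun x => (n.+1%:R * x) * (n.+1%:R * x) - 1)).
  apply: smooth_comp; first exact: smooth_flat.
  by apply: smoothB; [apply: smoothM; exact: smoothZ smooth_id|exact: smooth_cst].
by apply/funext => x; rewrite /plug/= expr2.
Qed.

Lemma plug_ge0 n x : 0 <= plug n x. Proof. exact: flat_ge0. Qed.

Lemma plug_le1 n x : `|plug n x| <= 1.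
Proof. by rewrite ger0_norm ?plug_ge0// -[leRHS]/(0`!%:R) flat_le. Qed.

Lemma plug_near0 n x : `|x| <= n.+1%:R^-1 -> plug n x = 0.
Proof.
move=> xn; apply: flat_le0E; rewrite subr_le0 -real_normK ?num_real// expr_le1//.
by rewrite normrM ger0_norm// mulrC -ler_pdivlMr// div1r.
Qed.

Lemma cvg_plug x : x != 0 -> plug n x @[n --> \oo] --> (1 : R).
Proof.
move=> x0; have x20 : 0 < x ^+ 2 by rewrite exprn_even_gt0.
(* exp(-1/y) >= 1 - 1/y with y = ((n+1) x)^2 - 1, and y >= n + 1 as soon as n >= 2 / x^2. *)
apply: (@squeeze_cvgr _ _ _ _ (fun n => 1 - n.+1%:R^-1) (cst 1)).
- near=> n; have := plug_le1 n x; rewrite ger0_norm ?plug_ge0// => ->; rewrite andbT.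
  have n2 : 2 / x ^+ 2 <= n.+1%:R.
    rewrite (@le_trans _ _ n%:R)// ?ler_nat//; near: n; exact: nbhs_infty_ger.
  have n1 : 1 <= n.+1%:R :> R by rewrite ler1n.
  have ny : n.+1%:R <= (n.+1%:R * x) ^+ 2 - 1.
    rewrite lerBrDr exprMn expr2 -mulrA.
    apply: (@le_trans _ _ (n.+1%:R * 2)); first by lra.
    by rewrite ler_pM2l// -ler_pdivrMr.
  rewrite /plug flat_gt0E ?(lt_le_trans _ ny)// expr0 mul1r.
  apply: le_trans (expR_ge1Dx _); rewrite lerD2l lerN2 lef_pV2 ?posrE//.
  exact: lt_le_trans ny.
- by rewrite -[X in _ --> X]subr0; apply: cvgB; [exact: cvg_cst|exact: cvg_harmonic].
- exact: cvg_cst.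
Unshelve. all: by end_near. Qed.

Lemma plug_scale n x : plug n x = plug 0 (n.+1%:R * x).
Proof. by rewrite /plug mul1r. Qed.

Lemma derive1_plug0 : derive1 (plug 0) = fun x => flat 2 (x ^+ 2 - 1) * (2 * x).
Proof.
apply: derive1_ext => x.
have D1 : is_derive x (1 : R) (fun x => x * x - 1) (2 * x).
  have D := is_deriveB (is_deriveM (is_derive_id x (1 : R)) (is_derive_id x (1 : R))) (is_derive_cst (1 : R) x (1 : R)).
  apply: (@is_derive_eq _ _ _ _ _ _ _ _ D).
  by rewrite subr0 /GRing.scale/= mulr1 mulr2n mulrDl mul1r.
have D2 := is_derive_flat 0 (x * x - 1).
rewrite mul0r subr0 in D2.
rewrite (_ : plug 0 = flat 0 \o (fun x => x * x - 1)); last first.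
  by apply/funext => y; rewrite /plug/= mul1r expr2.
by rewrite expr2; exact: is_derive1_comp.
Qed.

Lemma integ_dplug : integ (derive1 (plug 0)).
Proof.
apply: (@integ_decay _ _ 40).
  by apply: smooth_measurable; apply: smooth_derive; exact: smooth_plug.
move=> x; rewrite derive1_plug0 normrM ger0_norm ?flat_ge0// normrM ger0_norm//.
have P : 0 < 1 + x ^+ 2 by rewrite ltr_pwDl// sqr_ge0.
have x1 : 2 * `|x| <= 1 + x ^+ 2.
  by rewrite -[x ^+ 2]real_normK ?num_real//; have := sqr_ge0 (`|x| - 1); nra.
rewrite ler_pdivlMr//.
(* 40 = 2 * 4 * 5: for x^2 <= 4, [flat 2] is at most 2!, |2x| at most 4 and 1 + x^2 at most 5. *)
have [x4|x4] := lerP (x ^+ 2) 4.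
  apply: (@le_trans _ _ (2 * 4 * 5)); last by lra.
  apply: ler_pM; [by rewrite mulr_ge0 ?flat_ge0//|exact: ltW| |by lra].
  apply: ler_pM; [exact: flat_ge0|by []|exact: (flat_le 2)|].
  have : `|x| <= 2.
    by move: x4; rewrite -[x ^+ 2]real_normK ?num_real//; have := normr_ge0 x; nra.
  by lra.
set y := x ^+ 2 - 1; have y0 : 0 < y by rewrite /y; lra.
have fy : flat 2 y <= y ^- 2.
  rewrite flat_gt0E// exprVn ler_piMr ?invr_ge0 ?exprn_ge0 ?ltW//.
  by rewrite -expR0 ltr_expR oppr_lt0 invr_gt0.
(* Here y > 3, so 1 + x^2 = y + 2 <= 5/3 y, which also bounds 2|x|; the total is then at most y^-2
   (5/3 y)^2 = 25/9. *)
have yx : 1 + x ^+ 2 <= 5 / 3 * y by rewrite /y; lra.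
apply: (@le_trans _ _ (y ^- 2 * (5 / 3 * y) * (5 / 3 * y))).
  apply: ler_pM => //; [by rewrite mulr_ge0 ?flat_ge0|exact: ltW|].
  by apply: ler_pM => //; [exact: flat_ge0|exact: le_trans yx].
rewrite (_ : y ^- 2 * _ * _ = 25 / 9); first by lra.
by field; rewrite gt_eqF.
Qed.

Lemma Rint_dplug : \int[mu]_x derive1 (plug 0) x = 0.
Proof.
apply: Rint_odd; first exact: integ_dplug.
by move=> x; rewrite derive1_plug0 sqrrN !mulrN.
Qed.

Lemma rtest_plug n f : rtest setT f -> rtest [set~ 0] (fun x => f x * plug n x).
Proof.
move=> [sf [K [cK _ K0]]]; split; first exact: smoothM sf (smooth_plug n).
exists (K `&` [set x | n.+1%:R^-1 <= `|x|]); split.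
- apply: compact_closedI => //.
  rewrite (_ : [set x | _] = (fun x : R => `|x|) @^-1` [set y | n.+1%:R^-1 <= y])//.
  apply: closed_comp; last exact: closed_ge.
  by move=> x _; exact: norm_continuous.
- move=> x [_ /= xn] x0; move: xn; rewrite x0 normr0 leNgt => /negP; apply.
  by rewrite invr_gt0.
- move=> x nKx; have [Kx|/K0->] := pselect (K x); last by rewrite mul0r.
  rewrite plug_near0 ?mulr0// leNgt; apply/negP => h; apply: nKx; split=> //=.
  exact: ltW.
Qed.

Lemma Rint_plug v f (M : R) : integ v -> measurable_fun [set: R] f ->
  (forall x, `|f x| <= M) ->
  \int[mu]_r (v r * (f r * plug n r)) @[n --> \oo] --> \int[mu]_r (v r * f r).
Proof.
move=> jv mf fM; have mv := integ_measurable jv.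
have M0 : 0 <= M := le_trans (normr_ge0 _) (fM 0).
apply: (@Rint_dct _ _ _ mu _ _ (fun r => M * `|v r|)).
- move=> n; apply: measurable_funM => //; apply: measurable_funM => //.
  exact: smooth_measurable (smooth_plug n).
- exact: measurable_funM.
- exact/integZ/integ_norm.
- move=> n x; rewrite normrM mulrC ler_wpM2r// normrM -[leRHS]mulr1 ler_pM//.
  exact: plug_le1.
- apply: ae_neq0 => x x0; rewrite -[X in _ --> v x * X]mulr1.
  by apply: cvgMr; apply: cvgMr; exact: cvg_plug.
Qed.

(** Functions equal as distributions off 0 have no room for a Dirac mass at 0, being integrable: f
    times [plug n] is supported off 0 and tends to f boundedly outside a null set. *)
Lemma weak_agree_setT v w : integ v -> integ w ->
  (forall f, rtest [set~ 0] f -> \int[mu]_r (v r * f r) = \int[mu]_r (w r * f r)) ->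
  forall f, rtest setT f -> \int[mu]_r (v r * f r) = \int[mu]_r (w r * f r).
Proof.
move=> jv jw vw f tf; have [M HM] := rtest_bounded tf.
have mf := smooth_measurable (proj1 tf).
have E n := vw _ (rtest_plug n tf).
exact: cvgn_eq E (Rint_plug jv mf HM) (Rint_plug jw mf HM).
Qed.

Lemma continuous_fill g (l : R) : (forall x, x != 0 -> {for x, continuous g}) ->
  g x @[x --> 0^'+] --> l -> g x @[x --> 0^'-] --> l ->
  continuous (fun x => if x == 0 then l else g x).
Proof.
move=> cg gr gl x; set h := fun x => _.
have [->|x0] := eqVneq x 0.
  apply/left_right_continuousP; split; rewrite {2}/h eqxx.
    apply: cvg_trans gl; apply: near_eq_cvg; near=> y; rewrite /h ifF//.
    by apply/negbTE; rewrite lt_eqF//; near: y; exact: nbhs_left_lt.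
  apply: cvg_trans gr; apply: near_eq_cvg; near=> y; rewrite /h ifF//.
  by apply/negbTE; rewrite gt_eqF//; near: y; exact: nbhs_right_gt.
rewrite /continuous_at {2}/h (negbTE x0).
have N : \forall y \near nbhs (x : R), y != 0.
  have [xn|xp|xz] := ltgtP x 0; last by rewrite xz eqxx in x0.
    by apply: filterS (lt_nbhsl xn) => y yn; rewrite lt_eqF.
  by apply: filterS (lt_nbhsr xp) => y yn; rewrite gt_eqF.
apply: cvg_trans (cg x x0); apply: near_eq_cvg.
by apply: filterS N => y /negbTE y0; rewrite /h y0.
Unshelve. all: by end_near. Qed.

(** Testing against f times [plug n] leaves the extra term g f (plug n)'. One-sided limits l+ and l-
    would make it tend to (l+ - l-) f(0); as both are l, filling g in at 0 makes it continuous and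
    the term vanishes in the limit. *)
Lemma rweak_remove g g' (l : R) : integ g -> integ g' -> rweak [set~ 0] g g' ->
  (forall x, x != 0 -> {for x, continuous g}) ->
  g x @[x --> 0^'+] --> l -> g x @[x --> 0^'-] --> l ->
  rweak setT g g'.
Proof.
move=> jg jg' gg' cg gr gl f tf; have [sf [K [cK _ K0]]] := tf.
have [M HM] := rtest_bounded tf; have [M' HM'] := rtest_bounded (rtest_derive tf).
pose h x := if x == 0 then l else g x.
have ch : continuous h by exact: continuous_fill.
have mg := integ_measurable jg.
have chf : continuous (fun x => h x * f x).
  by move=> x; apply: continuousM; [exact: ch|exact: smooth_continuous].
have [B HB] : exists B : R, forall x, `|h x * f x| <= B.
  by apply: (@bounded_compact_support _ _ K) => // x /K0 ->; rewrite mulr0.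
have sp n : smooth (plug n) := smooth_plug n.
have dp n x : derive1 (plug n) x = n.+1%:R * derive1 (plug 0) (n.+1%:R * x).
  rewrite (_ : plug n = fun x => plug 0 (n.+1%:R * x)).
    by rewrite derive1_scale//; exact: smooth_plug.
  by apply/funext => y; exact: plug_scale.
have mf := smooth_measurable sf; have mdf := smooth_measurable (smooth_derive sf).
have mp n := smooth_measurable (sp n).
have mdp n := smooth_measurable (smooth_derive (sp n)).
have L1 : (- (\int[mu]_r (g' r * (f r * plug n r)))) @[n --> \oo] --> - (\int[mu]_r (g' r * f r)).
  by apply: cvgN; exact: Rint_plug jg' mf HM.
have L2 : \int[mu]_r (g r * (derive1 f r * plug n r)) @[n --> \oo] --> \int[mu]_r (g r * derive1 f r).
  exact: Rint_plug jg mdf HM'.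
have L3 : \int[mu]_y (h (n.+1%:R^-1 * y) * f (n.+1%:R^-1 * y) * derive1 (plug 0) y) @[n --> \oo] --> (0 : R).
  have -> : 0 = \int[mu]_y (h 0 * f 0 * derive1 (plug 0) y).
    by rewrite RintZ ?Rint_dplug ?mulr0//; exact: integ_dplug.
  apply: (@Rint_dct _ _ _ mu _ _ (fun y => B * `|derive1 (plug 0) y|)).
  - move=> n; apply: measurable_funM (mdp 0%N).
    apply: (@measurableT_comp _ _ _ _ _ _ (fun x => h x * f x)); first exact: continuous_measurable_fun.
    by apply: smooth_measurable; exact: smoothZ smooth_id.
  - by apply: measurable_funM (mdp 0%N).
  - exact/integZ/integ_norm/integ_dplug.
  - by move=> n y; rewrite normrM ler_wpM2r.
  - apply: aeW => y; apply: cvgMl.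
    have C0 : n.+1%:R^-1 * y @[n --> \oo] --> (0 : R).
      by rewrite -[X in _ --> X](mul0r y); apply: cvgMl; exact: cvg_harmonic.
    exact: (cvg_comp _ _ C0 (chf 0)).
have Bn n x : `|h x * f x * derive1 (plug n) x| <= B * (n.+1%:R * `|derive1 (plug 0) (n.+1%:R * x)|).
  by rewrite normrM dp [`|n.+1%:R * _|]normrM (@ger0_norm _ n.+1%:R)// ler_wpM2r// mulr_ge0.
have jn n : integ (fun x => h x * f x * derive1 (plug n) x).
  have [//||j _] := @Rint_affine R n.+1%:R 0 (derive1 (plug 0)) _ _ integ_dplug.
    exact: (smooth_continuous (smooth_derive (sp 0%N))).
  apply: integ_leR (integZ B (integZ n.+1%:R (integ_norm j))) _.
    by apply: measurable_funM (mdp n); exact: continuous_measurable_fun.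
  by move=> x; rewrite /= addr0; exact: Bn.
(* Filling in the value at 0 does not change the integral, and the Jacobian 1/(n+1) of r = y/(n+1)
   cancels the factor n + 1 of the derivative of [plug n]. *)
have E3 n : \int[mu]_r (g r * (f r * derive1 (plug n) r)) =
    \int[mu]_y (h (n.+1%:R^-1 * y) * f (n.+1%:R^-1 * y) * derive1 (plug 0) y).
  transitivity (\int[mu]_r (h r * f r * derive1 (plug n) r)).
    apply: Rint_ae.
    - by apply: measurable_funM => //; exact: smooth_measurable (smoothM sf (smooth_derive (sp n))).
    - exact: integ_measurable (jn n).
    - by apply: ae_neq0 => x /negbTE x0; rewrite /h x0 mulrA.
  have cn : continuous (fun r => h r * f r * derive1 (plug n) r).
    by move=> x; apply: cvgM; [exact: chf|exact: (smooth_continuous (smooth_derive (sp n)))].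
  have n0 : 0 < n.+1%:R^-1 :> R by rewrite invr_gt0.
  have [jj ->] := Rint_affine 0 n0 cn (jn n).
  rewrite -RintZ//; apply: eqRint => y; rewrite addr0 dp mulVKf//.
  by rewrite mulrCA (mulrA _^-1) mulVf// mul1r.
have E n : - (\int[mu]_r (g' r * (f r * plug n r))) =
    \int[mu]_r (g r * (derive1 f r * plug n r)) +
    \int[mu]_y (h (n.+1%:R^-1 * y) * f (n.+1%:R^-1 * y) * derive1 (plug 0) y).
  rewrite -E3 -(gg' _ (rtest_plug n tf)) -RintD.
  - apply: eqRint => r; rewrite (derive1_smoothM sf (sp n)) -mulrDr; congr (_ * _).
    by rewrite addrC mulrC.
  - apply: (integMbR (M := M')) jg _ _; first exact: smooth_measurable (smoothM (smooth_derive sf) (sp n)).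
    by move=> x; rewrite normrM -[leRHS]mulr1 ler_pM// plug_le1.
  - have [B1 HB1] : exists B1 : R, forall x, `|f x * derive1 (plug n) x| <= B1.
      apply: (@bounded_compact_support _ _ K) => //.
        by move=> x; apply: continuousM; [exact: smooth_continuous|exact: (smooth_continuous (smooth_derive (sp n)))].
      by move=> x /K0 ->; rewrite mul0r.
    by apply: (integMbR (M := B1)) => //; exact: smooth_measurable (smoothM sf (smooth_derive (sp n))).
have := cvgn_eq E L1 (cvgD L2 L3).
by rewrite addr0 => <-.
Qed.

End removable_point.

(** * Real and imaginary parts *)

Section complex_parts.
Context {R : realType}.
Local Notation Re := (@complex.Re R).
Local Notation Im := (@complex.Im R).
Implicit Types z w : R[i].

Lemma complexP z w : Re z = Re w -> Im z = Im w -> z = w.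
Proof. by case: z => a b; case: w => c e /= -> ->. Qed.

Lemma complex_ReM z w : Re (z * w) = Re z * Re w - Im z * Im w.
Proof. by case: z => a b; case: w. Qed.

Lemma complex_ImM z w : Im (z * w) = Re z * Im w + Im z * Re w.
Proof. by case: z => a b; case: w. Qed.

Lemma signcE n z : (-1) ^+ n * z = Complex ((-1) ^+ n * Re z) ((-1) ^+ n * Im z).
Proof.
rewrite -(signr_odd R) -(signr_odd R[i]); case: odd; case: z => a b /=.
  by rewrite !expr1 !mulN1r.
by rewrite !expr0 !mul1r.
Qed.

Lemma normcE z : normc z = Num.sqrt (Re z ^+ 2 + Im z ^+ 2).
Proof. by case: z. Qed.

Lemma normc_ge0 z : 0 <= normc z.
Proof. by rewrite normcE sqrtr_ge0. Qed.

Lemma Re_le_normc z : `|Re z| <= normc z.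
Proof. by rewrite normcE -sqrtr_sqr ler_wsqrtr// lerDl sqr_ge0. Qed.

Lemma Im_le_normc z : `|Im z| <= normc z.
Proof. by rewrite normcE -sqrtr_sqr ler_wsqrtr// lerDr sqr_ge0. Qed.

Lemma normc_le z : normc z <= `|Re z| + `|Im z|.
Proof.
rewrite normcE -[leRHS]ger0_norm ?addr_ge0// -sqrtr_sqr ler_wsqrtr//.
rewrite sqrrD !real_normK ?num_real// addrAC lerDl.
by rewrite pmulrn_lge0 ?mulr_ge0.
Qed.

End complex_parts.

(** * Integrals over an open set with negligible complement *)

Section conull_domain.
Context {R : realType}.
Local Notation mu := (@lebesgue_measure R).
Local Notation integ f := (mu.-integrable setT (EFin \o f)).
Implicit Types f g : R -> R.

(** Abstracts the two domains R and R \ {0}. The last field makes a function measurable on O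
    measurable on R, whatever its values off O. *)
Record conull (O : set R) : Prop := Conull {
  conull_meas : measurable (O : set (measurableTypeR R)) ;
  conull_null : mu (~` O) = 0 ;
  conull_sub : forall A, A `<=` ~` O -> measurable (A : set (measurableTypeR R)) }.

Lemma conullT : conull setT.
Proof.
split; [exact: measurableT|by rewrite setCT measure0|].
by move=> A; rewrite setCT subset0 => ->.
Qed.

Lemma conullC0 : conull [set~ 0].
Proof.
split; first by apply: measurableC; exact: measurable_set1.
  by rewrite setCK; exact: lebesgue_measure_set1.
by move=> A; rewrite setCK => /subset_set1[] ->.
Qed.

Variables (O : set R) (cO : conull O).

Lemma conullD : setT `\` ~` O = O. Proof. by rewrite setDE setCK setTI. Qed.

Lemma integ_conull f : measurable_fun [set: R] f -> mu.-integrable O (EFin \o f) <-> integ f.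
Proof.
move=> mf; have [mO O0 _] := cO; rewrite -[X in mu.-integrable X]conullD.
have mC : measurable (~` O : set (measurableTypeR R)) by exact: measurableC.
have mE : measurable_fun [set: measurableTypeR R] (EFin \o f) by exact/measurable_EFinP.
by split=> h; apply/(negligible_integrable mC measurableT mE O0).
Qed.

Lemma Rint_conull f : integ f -> \int[mu]_(x in O) f x = \int[mu]_x f x.
Proof.
move=> jf; have [mO O0 _] := cO; congr fine; rewrite -[X in integral _ X]conullD.
rewrite [RHS](negligible_integral _ _ jf O0)//; exact: measurableC.
Qed.

Lemma ge0_integral_conull (f : R -> \bar R) : measurable_fun [set: R] f ->
  (forall x, (0 <= f x)%E) ->
  (\int[mu]_(x in O) f x = \int[mu]_x f x)%E.
Proof.
move=> mf f0; have [mO O0 _] := cO; rewrite -[X in integral _ X]conullD.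
rewrite [RHS](ge0_negligible_integral _ _ _ _ O0)//; exact: measurableC.
Qed.

End conull_domain.

(** * Weak derivatives of higher order *)

Section weak_chain.
Context {R : realType}.
Local Notation mu := (@lebesgue_measure R).
Local Notation integ f := (mu.-integrable setT (EFin \o f)).
Implicit Types f g : R -> R.

Definition rweakn (O : set R) n g g' := forall f, rtest O f ->
  \int[mu]_r (g r * derive1n n f r) = (-1) ^+ n * \int[mu]_r (g' r * f r).

Lemma rtest_derive1n O n f : rtest O f -> rtest O (derive1n n f).
Proof. by move=> tf; elim: n => // n ih; rewrite derive1nS; exact: rtest_derive. Qed.

Lemma rweakn_step O m g (V : nat -> R -> R) k : (k < m)%N ->
  (forall k, (k <= m)%N -> rweakn O k g (V k)) -> rweak O (V k) (V k.+1).
Proof.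
move=> km gV f tf.
have := gV _ (ltnW km) _ (rtest_derive tf); rewrite -derive1Sn.
rewrite (gV _ km _ tf) exprS mulN1r mulNr.
by move/(congr1 (fun x => (-1) ^+ k * x)); rewrite mulrN !signrMK => <-.
Qed.

Lemma rweakn_of_step O m g (V : nat -> R -> R) : rweakn O 0 g (V 0%N) ->
  (forall k, (k < m)%N -> rweak O (V k) (V k.+1)) ->
  forall k, (k <= m)%N -> rweakn O k g (V k).
Proof.
move=> g0 gV; elim=> [//|k ih] km f tf.
rewrite derive1Sn (ih (ltnW km) _ (rtest_derive tf)) (gV _ km _ tf).
by rewrite exprS mulN1r mulNr mulrN.
Qed.

(** Iterated integration by parts: each power of b consumes one weak derivative and turns the phase
    by pi / 2. *)
Lemma rweak_trig_pow (m : nat) (V : nat -> R -> R) (b : R) :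
  (forall k, (k <= m)%N -> integ (V k)) ->
  (forall k, (k < m)%N -> rweak setT (V k) (V k.+1)) ->
  forall k th, (k <= m)%N -> b ^+ k * trig th (V 0%N) b = trig (th + (pi / 2) *+ k) (V k) b.
Proof.
move=> jV wV; elim=> [|k ih] th km; first by rewrite expr0 mul1r mulr0n addr0.
rewrite exprS -mulrA (ih _ (ltnW km)) (trig_weak _ _ (jV _ (ltnW km)) (jV _ km) (wV _ km)).
by rewrite (mulrSr (pi / 2)) addrA.
Qed.

(** That g and v agree weakly means that g - v is a weak derivative of 0. Then [trig_weak] says that
    the transform of g - v is b times that of 0, so almost everywhere equality is never
    established. *)
Lemma trig_weak0 g v (th b : R) : integ g -> integ v -> rweakn setT 0 g v ->
  trig th g b = trig th v b.
Proof.
move=> jg jv gv.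
have jd : integ (fun x => g x - v x) by exact: integB.
have j0 : integ (fun _ : R => 0 : R) by exact: integrable0.
have W : rweak setT (fun _ : R => 0 : R) (fun x => g x - v x).
  move=> f tf; have [M HM] := rtest_bounded tf; have mf := smooth_measurable (proj1 tf).
  have := gv f tf; rewrite expr0 mul1r derive1n0 => E.
  have jgf := integMbR jg mf HM; have jvf := integMbR jv mf HM.
  have -> : \int[mu]_r ((g r - v r) * f r) = 0.
    under eqRint do rewrite mulrBl.
    by rewrite RintB// E subrr.
  rewrite oppr0; under eqRint do rewrite mul0r.
  by rewrite Rintegral_cst ?mul0r.
have := trig_weak (th - pi / 2) b j0 jd W.
rewrite subrK {1}/trig; under eqRint do rewrite mul0r.
rewrite Rintegral_cst ?mul0r ?mulr0// => E.
apply/eqP; rewrite -subr_eq0 -RintB; try exact: integ_trig.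
by apply/eqP; rewrite [RHS]E; apply: eqRint => r; rewrite mulrBl.
Qed.

End weak_chain.

(** * Sobolev functions, matching traces and decay of the inverse transform *)

Section sobolev_real.
Context {R : realType}.
Local Notation mu := (@lebesgue_measure R).
Local Notation integ f := (mu.-integrable setT (EFin \o f)).
Local Notation Re := (@complex.Re R).
Local Notation Im := (@complex.Im R).
Implicit Types u v : R -> R[i].

Local Notation re u := (fun x => Re (u x)).
Local Notation im u := (fun x => Im (u x)).

Definition cinteg u := integ (re u) /\ integ (im u).

Lemma csmoothP u : csmooth u <-> smooth (re u) /\ smooth (im u).
Proof.
split=> [su|[sr si] n x]; last by split; exact: smoothP.
by split; split=> n x; have [] := su n x.
Qed.

Lemma measurable_conull O (f : R -> R) : conull O -> measurable_fun O f -> measurable_fun [set: R] f.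
Proof.
move=> [mO _ sO] mf _ Y mY; rewrite setTI.
rewrite -[f @^-1` Y]setTI -(setUv O) setIUl; apply: measurableU; first exact: mf.
by apply: sO => x [].
Qed.

Lemma cintegrable_conull O u : conull O -> cintegrable mu O u <-> cinteg u.
Proof.
move=> cO; split=> -[jr ji]; split.
- apply/(integ_conull cO) => //; apply: (measurable_conull cO).
  by have /integrableP[/measurable_EFinP] := jr.
- apply/(integ_conull cO) => //; apply: (measurable_conull cO).
  by have /integrableP[/measurable_EFinP] := ji.
- by apply/(integ_conull cO) => //; exact: (integ_measurable jr).
- by apply/(integ_conull cO) => //; exact: (integ_measurable ji).
Qed.

Lemma cintegralM O u (a b : R -> R) (M : R) : conull O -> cinteg u ->
  measurable_fun [set: R] a -> measurable_fun [set: R] b ->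
  (forall x, `|a x| <= M) -> (forall x, `|b x| <= M) ->
  cintegral mu O (fun x => u x * Complex (a x) (b x)) =
  Complex (\int[mu]_x (Re (u x) * a x) - \int[mu]_x (Im (u x) * b x))
          (\int[mu]_x (Re (u x) * b x) + \int[mu]_x (Im (u x) * a x)).
Proof.
move=> cO [jr ji] ma mb aM bM.
have j1 := integMbR jr ma aM; have j2 := integMbR ji mb bM.
have j3 := integMbR jr mb bM; have j4 := integMbR ji ma aM.
rewrite -RintB// -RintD// /cintegral; congr Complex.
  rewrite -(Rint_conull cO); last exact: integB.
  by apply: eq_Rintegral => x _; rewrite complex_ReM.
rewrite -(Rint_conull cO); last exact: integD.
by apply: eq_Rintegral => x _; rewrite complex_ImM.
Qed.

Lemma derive1n_cst0 n : derive1n n (fun _ : R => 0 : R) = fun=> 0.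
Proof.
elim: n => // n ih; rewrite derive1nS ih; apply: derive1_ext => x; exact: is_derive_cst.
Qed.

Lemma test_fun_parts O (phi : R -> R[i]) :
  test_fun O phi -> rtest O (re phi) /\ rtest O (im phi).
Proof.
move=> [/csmoothP[sr si] [K [cK KO K0]]].
by split; split=> //; exists K; split=> // x /K0 ->.
Qed.

Lemma test_fun_real O (f : R -> R) : rtest O f -> test_fun O (fun x => Complex (f x) 0).
Proof.
move=> [sf [K [cK KO K0]]]; split; first by apply/csmoothP; split=> //; exact: smooth_cst.
by exists K; split=> // x /K0 ->.
Qed.

Lemma weak_deriv_real O n u v : conull O -> cinteg u -> cinteg v ->
  weak_deriv O n u v <-> rweakn O n (re u) (re v) /\ rweakn O n (im u) (im v).
Proof.
move=> cO ju jv; split=> [W|[Wr Wi] phi tphi].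
  suff H f : rtest O f ->
      \int[mu]_r (Re (u r) * derive1n n f r) = (-1) ^+ n * \int[mu]_r (Re (v r) * f r) /\
      \int[mu]_r (Im (u r) * derive1n n f r) = (-1) ^+ n * \int[mu]_r (Im (v r) * f r).
    by split=> f /H[].
  move=> tf; have := W _ (test_fun_real tf).
  have [M HM] := rtest_bounded tf; have [M' HM'] := rtest_bounded (rtest_derive1n n tf).
  have mf := smooth_measurable (proj1 tf).
  have mdf := smooth_measurable (proj1 (rtest_derive1n n tf)).
  have M0 : 0 <= M := le_trans (normr_ge0 _) (HM 0).
  have M0' : 0 <= M' := le_trans (normr_ge0 _) (HM' 0).
  have cdE x : cderiv n (fun x => Complex (f x) 0) x = Complex (derive1n n f x) ((fun=> 0) x).
    by rewrite /cderiv/= derive1n_cst0.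
  rewrite (_ : (fun x => u x * _) = (fun x => u x * Complex (derive1n n f x) ((fun=> 0) x))); last first.
    by apply/funext => x; rewrite cdE.
  rewrite (cintegralM (M := M') cO ju)//; last by move=> x; rewrite normr0.
  rewrite (@cintegralM _ _ f (fun=> 0) M)//; last by move=> x; rewrite normr0.
  have z0 (g : R -> R) : \int[mu]_x (g x * 0) = 0.
    by under eqRint do rewrite mulr0; rewrite Rintegral_cst ?mul0r.
  by rewrite !z0 !subr0 !add0r signcE/= => -[].
have [tr ti] := test_fun_parts tphi.
have [Mr HMr] := rtest_bounded tr; have [Mi HMi] := rtest_bounded ti.
have [Mr' HMr'] := rtest_bounded (rtest_derive1n n tr).
have [Mi' HMi'] := rtest_bounded (rtest_derive1n n ti).
have mr := smooth_measurable (proj1 tr); have mi := smooth_measurable (proj1 ti).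
have mr' := smooth_measurable (proj1 (rtest_derive1n n tr)).
have mi' := smooth_measurable (proj1 (rtest_derive1n n ti)).
rewrite (_ : (fun x => v x * phi x) = (fun x => v x * Complex (Re (phi x)) (Im (phi x)))); last first.
  by apply/funext => x; congr (_ * _); exact: complexP.
rewrite (@cintegralM _ _ _ _ (Num.max Mr Mi) cO jv)//; last 2 first.
  by move=> x; rewrite le_max HMr.
  by move=> x; rewrite le_max HMi orbT.
rewrite (@cintegralM _ _ _ _ (Num.max Mr' Mi') cO ju)//; last 2 first.
  by move=> x; rewrite le_max HMr'.
  by move=> x; rewrite le_max HMi' orbT.
rewrite signcE/= !mulrBr !mulrDr.
by rewrite (Wr _ tr) (Wr _ ti) (Wi _ tr) (Wi _ ti).
Qed.

Lemma sobolev_derivsP m O u (v : nat -> R -> R[i]) : conull O -> sobolev_derivs m O u v <->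
  cinteg u /\ forall k, (k <= m)%N -> cinteg (v k) /\
    rweakn O k (re u) (re (v k)) /\ rweakn O k (im u) (im (v k)).
Proof.
move=> cO; split=> [[/(cintegrable_conull u cO) ju H]|[ju H]].
  split=> // k /H[/(cintegrable_conull _ cO) jv /(weak_deriv_real _ cO ju jv) W].
  by split.
split; first exact/(cintegrable_conull u cO).
move=> k /H[jv W]; split; first exact/(cintegrable_conull _ cO).
exact/(weak_deriv_real _ cO ju jv).
Qed.

(** V is the family whose traces are known, V' an arbitrary one. Order k splits into k steps of
    order 1, each of which crosses 0 using the traces of [V k], k < m, and the steps are
    reassembled. V' follows because it agrees weakly with V off 0. *)
Lemma rweakn_remove m (g : R -> R) (V V' : nat -> R -> R) : integ g ->
  (forall k, (k <= m)%N -> integ (V k)) -> (forall k, (k <= m)%N -> integ (V' k)) ->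
  (forall k, (k <= m)%N -> rweakn [set~ 0] k g (V k)) ->
  (forall k, (k <= m)%N -> rweakn [set~ 0] k g (V' k)) ->
  (forall k, (k < m)%N -> (forall x, x != 0 -> {for x, continuous (V k)}) /\
    exists l : R, V k x @[x --> 0^'+] --> l /\ V k x @[x --> 0^'-] --> l) ->
  forall k, (k <= m)%N -> rweakn setT k g (V' k).
Proof.
move=> jg jV jV' gV gV' tV k km f tf.
have W : forall k, (k <= m)%N -> rweakn setT k g (V k).
  apply: rweakn_of_step => [|j jm].
    move=> h th; rewrite expr0 mul1r derive1n0.
    apply: weak_agree_setT => // [|h' th']; first exact: jV.
    by have := gV 0%N isT _ th'; rewrite expr0 mul1r derive1n0.
  have [cV [l [lr ll]]] := tV _ jm.
  apply: rweak_remove lr ll => //; [exact/jV/ltnW|exact: jV|].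
  exact: rweakn_step jm gV.
rewrite (W _ km _ tf); congr (_ * _); apply: weak_agree_setT tf; [exact: jV|exact: jV'|].
move=> h th; have := gV _ km _ th; rewrite (gV' _ km _ th).
by move/(congr1 (fun x => (-1) ^+ k * x)); rewrite !signrMK.
Qed.

Lemma traces_sobolev_derivs m u : traces_agree m u ->
  forall v : nat -> R -> R[i], sobolev_derivs m [set~ 0] u v -> sobolev_derivs m setT u v.
Proof.
move=> [v [/(sobolev_derivsP _ _ _ conullC0)[ju Hv] tv]] v' /(sobolev_derivsP _ _ _ conullC0)[_ Hv'].
apply/(sobolev_derivsP _ _ _ conullT); split=> // k km.
have [jv'k _] := Hv' _ km; split=> //; split.
- apply: (@rweakn_remove m (re u) (fun k => re (v k)) (fun k => re (v' k))) => //.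
  + by case: ju.
  + by move=> j /Hv[[]].
  + by move=> j /Hv'[[]].
  + by move=> j /Hv[_ []].
  + by move=> j /Hv'[_ []].
  + move=> j /tv[cv [l [[lr _] [ll _]]]]; split; last by exists (Re l).
    by move=> x /cv[].
- apply: (@rweakn_remove m (im u) (fun k => im (v k)) (fun k => im (v' k))) => //.
  + by case: ju.
  + by move=> j /Hv[[]].
  + by move=> j /Hv'[[]].
  + by move=> j /Hv[_ []].
  + by move=> j /Hv'[_ []].
  + move=> j /tv[cv [l [[_ lr] [_ ll]]]]; split; last by exists (Im l).
    by move=> x /cv[].
Qed.

Lemma measurable_normc u : cinteg u -> measurable_fun [set: R] (fun x => normc (u x)).
Proof.
move=> [/integ_measurable mr /integ_measurable mi].
rewrite (_ : (fun x => _) = (@powR R ^~ 2^-1) \o (fun x => Re (u x) ^+ 2 + Im (u x) ^+ 2)).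
  apply: measurableT_comp; first exact: measurable_powR.
  by apply: measurable_funD; exact: measurable_funX.
by apply/funext => x /=; rewrite powR12_sqrt ?addr_ge0 ?sqr_ge0// normcE.
Qed.

(** Every family of derivatives on R \ {0} is one on R with the same integrals, so the infimum for R
    runs over a larger set. *)
Lemma traces_sobolev_norm m u : traces_agree m u ->
  (sobolev_norm m setT u <= sobolev_norm m [set~ 0%R] u)%E.
Proof.
move=> tu; apply: le_ereal_inf => _ [v Dv <-].
have Dv' := traces_sobolev_derivs tu Dv; exists v => //.
have [_ Hv] := (sobolev_derivsP _ _ _ conullT).1 Dv'.
apply: eq_bigr => k _; have [jk _] := Hv k (ltn_ord k).
have mE : measurable_fun [set: R] (fun x => (normc (v k x))%:E).
  by apply/measurable_EFinP; exact: measurable_normc jk.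
by rewrite (ge0_integral_conull conullC0 mE) => // x; rewrite lee_fin normc_ge0.
Qed.

Lemma traces_sobolev m u : traces_agree m u -> sobolev m setT u.
Proof. by move=> tu; have [v [Dv _]] := tu; exists v; exact: traces_sobolev_derivs Dv. Qed.

(** The real part of the inverse Fourier transform of u: phase pi / 2 gives the - sin that
    multiplies Im u. For hermitian u the imaginary part is 0. *)
Definition hinv u (b : R) : R := (2 * pi)^-1 * (trig 0 (re u) b + trig (pi / 2) (im u) b).

Lemma two_pi_gt0 : 0 < 2 * pi :> R. Proof. by rewrite mulr_gt0// pi_gt0. Qed.

Lemma two_piV_le1 : (2 * pi)^-1 <= 1 :> R.
Proof.
rewrite invf_le1 ?two_pi_gt0//; have := pi_ge2 R; lra.
Qed.

(** For each family of derivatives with total norm S, |b|^k |hinv u b| <= 2 S, the 2 coming from the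
    two parts of u. Using k = 0 and k = m with (1 + |b|)^m <= 2^m (1 + |b|^m) gives 2^m * 4 S. If u
    is not in the Sobolev space the right-hand side is infinite. *)
Lemma hinv_bound m u (b : R) :
  (((1 + `|b|) ^+ m * `|hinv u b|)%:E <= (2 ^+ m.+2)%:E * sobolev_norm m setT u)%E.
Proof.
rewrite muleC -lee_pdivrMr ?exprn_gt0// -EFinM; apply: le_ereal_inf_tmp => _ [v Dv <-].
have [[jr ji] Hv] := (sobolev_derivsP _ _ _ conullT).1 Dv.
have nv k : (k <= m)%N -> integ (fun x => normc (v k x)).
  move=> km; have [[jkr jki] _] := Hv k km.
  apply: integ_leR (integD (integ_norm jkr) (integ_norm jki)) _.
    by apply: measurable_normc; split.
  by move=> x; rewrite ger0_norm ?normc_ge0//; exact: normc_le.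
rewrite (eq_bigr (fun k : 'I_m.+1 => (\int[mu]_x normc (v k x))%:E)); last first.
  by move=> k _; rewrite fineK//; exact: (integrable_fin_num measurableT (nv k (ltn_ord k))).
rewrite sumEFin lee_fin ler_pdivrMr ?exprn_gt0//.
set S := \sum_(_ < _) _.
have NS k : (k <= m)%N -> \int[mu]_x normc (v k x) <= S.
  move=> km; rewrite /S (bigD1 (Ordinal (km : (k < m.+1)%N)))//= lerDl sumr_ge0// => j _.
  by apply: Rintegral_ge0 => x _; exact: normc_ge0.
have B k th : (k <= m)%N -> `|b| ^+ k * `|trig th (re u) b| <= S /\ `|b| ^+ k * `|trig th (im u) b| <= S.
  move=> km; have [jv0 [W0r W0i]] := Hv 0%N (leq0n m); have [[jkr jki] _] := Hv k km.
  rewrite (trig_weak0 th b jr (proj1 jv0) W0r) (trig_weak0 th b ji (proj2 jv0) W0i).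
  rewrite -!normrX -!normrM; split.
    rewrite (@rweak_trig_pow _ m (fun k => re (v k)))//.
    - apply: le_trans (trig_le _ _ jkr) _; apply: le_trans (NS k km).
      apply: le_Rintegral => //; [exact: integ_norm|exact: nv|].
      by move=> x _; exact: Re_le_normc.
    - by move=> j /Hv[[]].
    - by move=> j jm; apply: (@rweakn_step _ _ m (re u) (fun k => re (v k))) => // i /Hv[_ []].
  rewrite (@rweak_trig_pow _ m (fun k => im (v k)))//.
  - apply: le_trans (trig_le _ _ jki) _; apply: le_trans (NS k km).
    apply: le_Rintegral => //; [exact: integ_norm|exact: nv|].
    by move=> x _; exact: Im_le_normc.
  - by move=> j /Hv[[]].
  - by move=> j jm; apply: (@rweakn_step _ _ m (im u) (fun k => im (v k))) => // i /Hv[_ []].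
have H k : (k <= m)%N -> `|b| ^+ k * `|hinv u b| <= 2 * S.
  move=> km; have [Br _] := B k 0 km; have [_ Bi] := B k (pi / 2) km.
  rewrite /hinv normrM mulrCA (@le_trans _ _ (`|b| ^+ k * `|trig 0 (re u) b + trig (pi / 2) (im u) b|))//.
    by rewrite ler_piMl ?mulr_ge0// ger0_norm ?two_piV_le1// invr_ge0 ltW// two_pi_gt0.
  rewrite (le_trans (ler_wpM2l _ (ler_normD _ _)))// mulrDr; lra.
have M1 : (1 + `|b|) ^+ m <= 2 ^+ m * (1 + `|b| ^+ m).
  have [b1|b1] := lerP `|b| 1.
    apply: (@le_trans _ _ (2 ^+ m)); first by rewrite lerXn2r ?nnegrE//; lra.
    by rewrite ler_peMr// lerDl.
  apply: (@le_trans _ _ ((2 * `|b|) ^+ m)); first by rewrite lerXn2r ?nnegrE//; lra.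
  by rewrite exprMn ler_wpM2l// lerDr.
apply: (@le_trans _ _ (2 ^+ m * (1 + `|b| ^+ m) * `|hinv u b|)); first by rewrite ler_wpM2r.
have := H 0%N (leq0n m); have := H m (leqnn m); rewrite expr0 mul1r => H1 H2.
have -> : S * 2 ^+ m.+2 = 2 ^+ m * (4 * S) by rewrite !exprS; ring.
rewrite -mulrA ler_wpM2l ?exprn_ge0// mulrDl mul1r; lra.
Qed.

End sobolev_real.

(** * The inverse Fourier transform of complex Schwartz functions *)

Section inverse_fourier.
Context {R : realType}.
Local Notation mu := (@lebesgue_measure R).
Local Notation integ f := (mu.-integrable setT (EFin \o f)).
Local Notation Re := (@complex.Re R).
Local Notation Im := (@complex.Im R).
Local Notation re u := (fun x => Re (u x)).
Local Notation im u := (fun x => Im (u x)).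
Implicit Types (f g : R -> R) (u phi : R -> R[i]).

Lemma derive1nD n f g : smooth f -> smooth g ->
  derive1n n (fun x => f x + g x) = fun x => derive1n n f x + derive1n n g x.
Proof.
move=> sf sg; elim: n => // n ih; rewrite derive1nS ih; apply: derive1_ext => x.
by rewrite !derive1nS; apply: is_deriveD; apply: smooth_is_derive; exact: smooth_derive1n.
Qed.

Lemma derive1nZ n (c : R) f : smooth f ->
  derive1n n (fun x => c * f x) = fun x => c * derive1n n f x.
Proof.
move=> sf; elim: n => // n ih; rewrite derive1nS ih; apply: derive1_ext => x.
by rewrite !derive1nS; apply: is_deriveZ; apply: smooth_is_derive; exact: smooth_derive1n.
Qed.

Lemma rsD f g : rs f -> rs g -> rs (fun x => f x + g x).
Proof.
move=> [sf df] [sg dg]; split; first exact: smoothD.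
move=> j k; have [M HM] := df j k; have [N HN] := dg j k; exists (M + N) => x.
rewrite derive1nD// (le_trans (ler_wpM2l _ (ler_normD _ _)))// mulrDr.
exact: lerD.
Qed.

Lemma rsZ (c : R) f : rs f -> rs (fun x => c * f x).
Proof.
move=> [sf df]; split; first exact: smoothZ.
move=> j k; have [M HM] := df j k; exists (`|c| * M) => x.
by rewrite derive1nZ// normrM mulrCA ler_wpM2l.
Qed.

Lemma rtest_rs O f : rtest O f -> rs f.
Proof.
move=> tf; split; first by case: tf.
move=> j k; have [A HA] := rtest_vanish (rtest_derive1n k tf).
have [M HM] := rtest_bounded (rtest_derive1n k tf).
have M0 : 0 <= M := le_trans (normr_ge0 _) (HM 0).
exists ((1 + `|A|) ^+ j * M) => x; have [xA|xA] := lerP `|x| A; last first.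
  by rewrite HA// normr0 mulr0 mulr_ge0// exprn_ge0// addr_ge0.
rewrite ler_pM ?exprn_ge0// ?addr_ge0//.
by rewrite lerXn2r ?nnegrE ?addr_ge0// lerD2l (le_trans xA)// ler_norm.
Qed.

Lemma trigD th f g b : integ f -> integ g ->
  trig th (fun x => f x + g x) b = trig th f b + trig th g b.
Proof.
move=> jf jg; rewrite /trig -RintD; try exact: integ_trig.
by apply: eqRint => r; rewrite mulrDl.
Qed.

Lemma trigZ th (c : R) f b : integ f -> trig th (fun x => c * f x) b = c * trig th f b.
Proof.
move=> jf; rewrite /trig -RintZ; last exact: integ_trig.
by apply: eqRint => r; rewrite mulrA.
Qed.

Lemma trig_pihalf f b : trig (pi / 2) f b = - trig (- (pi / 2)) f b.
Proof.
have e : - (pi / 2) + pi = pi / 2 :> R by lra.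
by rewrite -trigN e.
Qed.

Lemma fourierE u xi : cinteg u -> fourier u xi =
  Complex (trig 0 (re u) xi + trig (- (pi / 2)) (im u) xi)
          (trig 0 (im u) xi - trig (- (pi / 2)) (re u) xi).
Proof.
move=> [jr ji]; rewrite /fourier /cintegral /trig; congr Complex.
  rewrite -RintD; try exact: integ_trig.
  apply: eqRint => x; rewrite complex_ReM/= cosN sinN addr0 cosB cos_pihalf sin_pihalf.
  ring.
rewrite -RintB; try exact: integ_trig.
apply: eqRint => x; rewrite complex_ImM/= cosN sinN addr0 cosB cos_pihalf sin_pihalf.
ring.
Qed.

Lemma schwartzP phi : schwartz phi <-> rs (re phi) /\ rs (im phi).
Proof.
split=> [[/csmoothP[sr si] H]|[[sr dr] [si di]]].
  split; split=> // j k; have [M HM] := H j k; exists M => x; apply: le_trans (HM x);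
    rewrite ler_wpM2l ?exprn_ge0 ?addr_ge0//.
    exact: (Re_le_normc (cderiv k phi x)).
  exact: (Im_le_normc (cderiv k phi x)).
split; first exact/csmoothP.
move=> j k; have [M HM] := dr j k; have [N HN] := di j k; exists (M + N) => x.
rewrite (le_trans (ler_wpM2l _ (normc_le _))) ?exprn_ge0 ?addr_ge0//.
by rewrite mulrDr lerD.
Qed.

(** The integral of phi(b) e^(i b r) / (2 pi), split into real and imaginary parts. *)
Definition invfour phi (r : R) : R[i] :=
  Complex ((2 * pi)^-1 * (trig 0 (re phi) r + trig (pi / 2) (im phi) r))
          ((2 * pi)^-1 * (trig (- (pi / 2)) (re phi) r + trig 0 (im phi) r)).

Lemma schwartz_invfour phi : schwartz phi -> schwartz (invfour phi).
Proof.
move=> /schwartzP[rr ri]; apply/schwartzP.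
by split; apply: rsZ; apply: rsD; exact: rs_trig.
Qed.

(** Every Schwartz function is the Fourier transform of a Schwartz function, so a distribution is
    evaluated everywhere once its Fourier transform is known. *)
Lemma fourier_invfour phi : schwartz phi -> fourier (invfour phi) = phi.
Proof.
move=> sphi; have /schwartzP[rr ri] := sphi.
have /schwartzP[pr pi'] := schwartz_invfour sphi.
apply/funext => x; rewrite fourierE; last by split; exact: rs_integ.
have J th f : rs f -> integ (trig th f) by move=> rf; exact/rs_integ/rs_trig.
have O1 th f : rs f -> trig th (trig (pi / 2) f) x = - trig th (trig (- (pi / 2)) f) x.
  move=> rf; rewrite -mulN1r -trigZ; last exact: J.
  by apply: eqRint => r; rewrite trig_pihalf mulN1r.
have p0 : 2 * pi != 0 :> R by rewrite gt_eqF// two_pi_gt0.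
apply: complexP => /=.
- rewrite !trigZ ?trigD; try (apply: integD); try exact: J; try exact: rs_integ.
  have := trig_inversion x rr; rewrite (O1 _ _ ri).
  have [E1 _] := trig_odd x ri; have [_ E2] := trig_odd x ri.
  rewrite E1 E2 => E; rewrite oppr0 !addr0 -mulrDr E mulrA mulVf// mul1r//.
- rewrite !trigZ ?trigD; try (apply: integD); try exact: J; try exact: rs_integ.
  have := trig_inversion x ri; rewrite (O1 _ _ ri).
  have [E1 E2] := trig_odd x rr.
  rewrite E1 E2 => E; rewrite !add0r -mulrBr opprK E mulrA mulVf// mul1r//.
Qed.

Lemma trig_odd0 f b : integ f -> (forall x, f (- x) = - f x) -> trig 0 f b = 0.
Proof.
move=> jf o; apply: Rint_odd; first exact: integ_trig.
by move=> x; rewrite o !addr0 mulrN cosN mulNr.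
Qed.

Lemma trig_even0 f b : integ f -> (forall x, f (- x) = f x) -> trig (- (pi / 2)) f b = 0.
Proof.
move=> jf e; apply: Rint_odd; first exact: integ_trig.
move=> x; rewrite e -[RHS]mulrN; congr (_ * _).
by rewrite !cosB cos_pihalf sin_pihalf mulrN sinN; ring.
Qed.

(** [trig_swap] moves the transforms from phi to u. For hermitian u the sine transform of Re u and
    the cosine transform of Im u vanish, and the remaining terms form [hinv u]. *)
Lemma cintegral_invfour u phi : cinteg u ->
  (forall x, Re (u (- x)) = Re (u x)) -> (forall x, Im (u (- x)) = - Im (u x)) ->
  schwartz phi ->
  cintegral mu setT (fun x => u x * invfour phi x) =
  Complex (\int[mu]_b (Re (phi b) * hinv u b)) (\int[mu]_b (Im (phi b) * hinv u b)).
Proof.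
move=> [jr ji] er oi sphi; have /schwartzP[rr ri] := sphi.
have /schwartzP[pr pi'] := schwartz_invfour sphi.
have [M HM] := rs_bounded pr; have [N HN] := rs_bounded pi'.
have jfr := rs_integ rr; have jfi := rs_integ ri.
rewrite (@cintegralM _ _ _ (re (invfour phi)) (im (invfour phi)) (Num.max M N) (@conullT R))//; first last.
- by move=> x; rewrite le_max HN orbT.
- by move=> x; rewrite le_max HM.
- exact: smooth_measurable (rs_smooth pi').
- exact: smooth_measurable (rs_smooth pr).
have Sw g f1 f2 t1 t2 : integ g -> rs f1 -> rs f2 ->
    \int[mu]_x (g x * ((2 * pi)^-1 * (trig t1 f1 x + trig t2 f2 x))) =
    (2 * pi)^-1 * (\int[mu]_b (f1 b * trig t1 g b) + \int[mu]_b (f2 b * trig t2 g b)).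
  move=> jg rf1 rf2; rewrite -!(trig_swap _ (rs_integ _) jg)//.
  have [M1 HM1] := rs_bounded (rs_trig t1 rf1); have [M2 HM2] := rs_bounded (rs_trig t2 rf2).
  have m1 := smooth_measurable (rs_smooth (rs_trig t1 rf1)).
  have m2 := smooth_measurable (rs_smooth (rs_trig t2 rf2)).
  have j1 := integMbR jg m1 HM1; have j2 := integMbR jg m2 HM2.
  rewrite -RintD// -RintZ; last exact: integD.
  by apply: eqRint => x; ring.
have Z (g f : R -> R) t : (forall b, trig t g b = 0) -> \int[mu]_b (f b * trig t g b) = 0.
  move=> z; under eqRint do rewrite z mulr0.
  by rewrite Rintegral_cst ?mul0r.
have Zr b : trig (- (pi / 2)) (re u) b = 0 by exact: trig_even0.
have Zr' b : trig (pi / 2) (re u) b = 0 by rewrite trig_pihalf Zr oppr0.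
have Zi b : trig 0 (im u) b = 0 by exact: trig_odd0.
have Fin (f : R -> R) : integ f -> \int[mu]_b (f b * hinv u b) =
    (2 * pi)^-1 * (\int[mu]_b (f b * trig 0 (re u) b) + \int[mu]_b (f b * trig (pi / 2) (im u) b)).
  move=> jf.
  have B t g : integ g -> integ (fun b => f b * trig t g b).
    move=> jg; apply: (integMbR (M := \int[mu]_r `|g r|)) => //; first exact: measurable_trig.
    by move=> x; exact: trig_le.
  rewrite -RintD; try exact: B.
  rewrite -RintZ; last by apply: integD; exact: B.
  by apply: eqRint => b; rewrite /hinv; ring.
congr Complex.
- rewrite /= Sw// Sw// (Z _ _ _ Zr') (Z _ _ _ Zi) !addr0 Fin//.
  have -> : \int[mu]_b (Re (phi b) * trig (pi / 2) (im u) b) = - \int[mu]_b (Re (phi b) * trig (- (pi / 2)) (im u) b).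
    by rewrite -RintN; apply: eqRint => b; rewrite trig_pihalf mulrN.
  exact/esym/mulrBr.
- rewrite /= Sw// Sw// (Z _ _ _ Zr) (Z _ _ _ Zi) Fin// !add0r; exact/esym/mulrDr.
Qed.

End inverse_fourier.

(** * Hermitian symmetry of ghat and of Hhat *)

Section hermitian.
Context {R : realType}.
Local Notation mu := (@lebesgue_measure R).
Local Notation integ f := (mu.-integrable setT (EFin \o f)).
Local Notation Re := (@complex.Re R).
Local Notation Im := (@complex.Im R).
Local Notation re u := (fun x => Re (u x)).
Local Notation im u := (fun x => Im (u x)).
Implicit Types (f g c : R -> R) (u phi : R -> R[i]).

Lemma bump_ge0 (x : R) : 0 <= cbump x.
Proof. by rewrite /cbump mulr_ge0 ?sqr_ge0// mulr_ge0// flat_ge0. Qed.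

(** For |x| <= 1/2 both 1 + x and 1 - x are at least 1/2, where [flat 0] is at least exp(-2). *)
Lemma bump_half (x : R) : `|x| <= 2^-1 -> expR 1 ^+ 2 * expR (- 2) ^+ 2 <= cbump x.
Proof.
rewrite ler_norml => /andP[x1 x2].
have F y : 2^-1 <= y -> expR (- 2) <= flat 0 y :> R.
  move=> y2; rewrite flat_gt0E ?(lt_le_trans _ y2) ?invr_gt0// expr0 mul1r ler_expR lerN2.
  rewrite -[leRHS]invrK lef_pV2 ?posrE//; last by rewrite (lt_le_trans _ y2).
rewrite /cbump ler_wpM2l ?sqr_ge0// expr2 ler_pM ?expR_ge0// F//; lra.
Qed.

Lemma Rint_bump_gt0 : 0 < \int[mu]_x @cbump R x.
Proof.
pose m : R := expR 1 ^+ 2 * expR (- 2) ^+ 2.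
have m0 : 0 < m by rewrite mulr_gt0// exprn_gt0// expR_gt0.
have jb : integ (@cbump R).
  have := rs_integ (rtest_rs (@rtest_bump R 0)).
  by under eq_fun do rewrite invr1 mul1r.
have ji : integ (fun x => m * (\1_(`[- 2^-1, 2^-1]%classic : set R)) x).
  by apply: integZ; exact: integrable_indic_itv.
apply: (@lt_le_trans _ _ (\int[mu]_x (m * (\1_(`[- 2^-1, 2^-1]%classic : set R)) x))).
  rewrite RintZ; last exact: integrable_indic_itv.
  rewrite mulr_gt0// /Rintegral integral_indic// setIT.
  rewrite /= lebesgue_measure_itv/= lte_fin ifT ?gtrN ?invr_gt0//=; lra.
apply: le_Rintegral => // x _; rewrite indicE.
case: (boolP (x \in _)) => [/set_mem|_]; last by rewrite mulr0 bump_ge0.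
by rewrite /= in_itv/= -ler_norml mulr1; exact: bump_half.
Qed.

Lemma rtest_shift_bump (a e : R) : 0 < e -> rtest setT (fun x => cbump (e^-1 * x - e^-1 * a)).
Proof.
move=> e0; split; first exact: (smooth_comp smooth_bump (smooth_affine _ _)).
exists (`[a - e, a + e]%classic : set R); split=> //; first exact: segment_compact.
move=> x /= nx; apply: bump_out; rewrite leNgt; apply/negP => h; apply: nx.
rewrite in_itv/= -ler_distlC distrC.
by move: h; rewrite -mulrBr normrM gtr0_norm ?invr_gt0// mulrC ltr_pdivrMr// mul1r => /ltW.
Qed.

Lemma rtestMc O f c : rtest O f -> continuous c -> integ (fun x => c x * f x).
Proof.
move=> tf cc; have [sf [K [cK _ K0]]] := tf.
have [A HA] := rtest_vanish tf.
have [M HM] : exists M : R, forall x, `|c x * f x| <= M.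
  apply: (@bounded_compact_support _ _ K) => //; last by move=> x /K0 ->; rewrite mulr0.
  by move=> x; apply: continuousM; [exact: cc|exact: smooth_continuous].
apply: (@integ_decay _ _ (M * (1 + A ^+ 2))).
  by apply: measurable_funM; [exact: continuous_measurable_fun|exact: smooth_measurable].
have M0 : 0 <= M := le_trans (normr_ge0 _) (HM 0).
move=> x; have P : 0 < 1 + x ^+ 2 by rewrite ltr_pwDl// sqr_ge0.
rewrite ler_pdivlMr//; have [xA|xA] := lerP `|x| A; last first.
  by rewrite HA// mulr0 normr0 mul0r mulr_ge0// addr_ge0// sqr_ge0.
rewrite ler_pM// ?(ltW P)// lerD2l -[leLHS]real_normK ?num_real//.
by rewrite lerXn2r ?nnegrE// (le_trans _ xA).
Qed.

(** Where c(x) > 0, a bump carried by a ball on which c exceeds c(x)/2 has a positive pairing with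
    c; the negative case is that of - c. *)
Lemma du_bois_reymond c : continuous c ->
  (forall f, rtest setT f -> \int[mu]_x (c x * f x) = 0) -> forall x, c x = 0.
Proof.
suff H c' : continuous c' ->
    (forall f, rtest setT f -> \int[mu]_x (c' x * f x) = 0) -> forall x, ~ (0 < c' x).
  move=> cc cf x; have [c0|c0|//] := ltgtP (c x) 0; last by have := H _ cc cf x.
  have := H (fun x => - c x) _ _ x; rewrite oppr_gt0 => /(_ _ _ c0) [].
    by move=> y; apply: cvgN; exact: cc.
  by move=> f /cf E; under eqRint do rewrite mulNr; rewrite RintN E oppr0.
move=> cc cf x cx.
have : \forall y \near x, c' x / 2 < c' y.
  have : c' y @[y --> x] --> c' x by exact: cc.
  by move/cvgr_gt; apply; rewrite ltr_pdivrMr// ltr_pMr// ltr1n.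
move=> /nbhs_ballP[e /= e0 He].
pose f y := cbump (e^-1 * y - e^-1 * x); have tf := rtest_shift_bump x e0.
have := cf _ tf; rewrite -/f => E0.
have jf : integ f by exact: rs_integ (rtest_rs tf).
have fpos : 0 < \int[mu]_y f y.
  have ei : 0 < e^-1 by rewrite invr_gt0.
  have cb : continuous (@cbump R) by exact: smooth_continuous smooth_bump.
  have jb : integ (@cbump R).
    have := rs_integ (rtest_rs (@rtest_bump R 0)).
    by under eq_fun do rewrite invr1 mul1r.
  have [_ E] := Rint_affine (- (e^-1 * x)) ei cb jb.
  by have := Rint_bump_gt0; rewrite E pmulr_rgt0.
have : c' x / 2 * \int[mu]_y f y <= \int[mu]_y (c' y * f y).
  rewrite -RintZ//; apply: le_Rintegral => //.
  - exact: integZ.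
  - exact: rtestMc tf cc.
  - move=> y _; have [ye|ye] := ltrP `|x - y| e.
      by rewrite ler_wpM2r ?bump_ge0// ltW//; exact: He.
    rewrite /f bump_out ?mulr0// -mulrBr normrM gtr0_norm ?invr_gt0//.
    by rewrite mulrC ler_pdivlMr// mul1r distrC.
by rewrite E0 leNgt mulr_gt0// divr_gt0.
Qed.

Lemma fourier_test f xi : rtest setT f ->
  fourier (fun x => Complex (f x) 0) xi = Complex (trig 0 f xi) (- trig (- (pi / 2)) f xi).
Proof.
move=> tf; have jf := rs_integ (rtest_rs tf).
have j0 : integ (fun _ : R => 0 : R) by exact: integrable0.
rewrite fourierE; last by split.
have Z t : trig t (fun _ : R => 0 : R) xi = 0.
  by rewrite /trig; under eqRint do rewrite mul0r; rewrite Rintegral_cst ?mul0r.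
by rewrite /= !Z addr0 sub0r.
Qed.

Lemma rtest_opp f : rtest setT f -> rtest setT (fun x => f (- x)).
Proof.
move=> tf; have [A HA] := rtest_vanish tf; have [sf _] := tf; split.
  rewrite (_ : (fun x => _) = f \o (fun x => -1 * x + 0)); first exact: smooth_comp sf (smooth_affine _ _).
  by apply/funext => x /=; rewrite addr0 mulN1r.
exists (`[- A, A]%classic : set R); split=> //; first exact: segment_compact.
move=> x /= nx; apply: HA; rewrite normrN ltNge; apply/negP => h; apply: nx.
by rewrite in_itv/= -ler_norml.
Qed.

(** sigma is real, so on a real test function f the pairing has real part given by the cosine
    transform of f and imaginary part by its sine transform. Reflecting f keeps the former and
    negates the latter; smoothness of ghat turns this weak parity into a pointwise one. *)
Lemma hermitian_fourier (sigma : R -> R) alpha (ghat : R -> R[i]) : csmooth ghat ->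
  (forall phi, test_fun setT phi ->
    distr_fourier (distr_deriv alpha (distr_of (fun t => real_complex R (sigma t)))) phi =
    distr_of ghat phi) ->
  forall x, ghat (- x) = (ghat x)^*%C.
Proof.
move=> /csmoothP[sr si] H.
have N f : rtest setT f ->
    \int[mu]_x (Re (ghat x) * f (- x)) = \int[mu]_x (Re (ghat x) * f x) /\
    \int[mu]_x (Im (ghat x) * f (- x)) = - \int[mu]_x (Im (ghat x) * f x).
  move=> tf; have tf' := rtest_opp tf.
  have D g : rtest setT g -> distr_of ghat (fun x => Complex (g x) 0) =
      Complex (\int[mu]_x (Re (ghat x) * g x)) (\int[mu]_x (Im (ghat x) * g x)).
    move=> tg; rewrite /distr_of /cintegral; congr Complex; apply: eqRint => x.
      by rewrite complex_ReM/= mulr0 subr0.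
    by rewrite complex_ImM/= mulr0 add0r.
  have S g : rtest setT g ->
      distr_fourier (distr_deriv alpha (distr_of (fun t => real_complex R (sigma t))))
        (fun x => Complex (g x) 0) =
      Complex ((-1) ^+ alpha * \int[mu]_x (sigma x * derive1n alpha (trig 0 g) x))
        ((-1) ^+ alpha * \int[mu]_x (sigma x * derive1n alpha (fun y => - trig (- (pi / 2)) g y) x)).
    move=> tg; rewrite /distr_fourier /distr_deriv signcE.
    have -> : cderiv alpha (fourier (fun x => Complex (g x) 0)) =
        fun x => Complex (derive1n alpha (trig 0 g) x) (derive1n alpha (fun y => - trig (- (pi / 2)) g y) x).
      apply/funext => x; rewrite /cderiv; congr Complex;
        by congr (derive1n _ _ _); apply/funext => y; rewrite fourier_test.
    rewrite /distr_of /cintegral; congr Complex; congr (_ * _); apply: eqRint => x /=.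
      by rewrite mul0r subr0.
    by rewrite mul0r addr0.
  have := H _ (test_fun_real tf); rewrite S// D// => -[E1 E2].
  have := H _ (test_fun_real tf'); rewrite S// D// => -[E3 E4].
  have jf := rs_integ (rtest_rs tf).
  have [jo _] := Rint_opp jf.
  have O t b : trig t (fun x => f (- x)) b = trig (- t) f b.
    have [_ E] := Rint_opp (integ_trig t b jo).
    rewrite /trig E; apply: eqRint => r; rewrite opprK; congr (_ * _).
    by rewrite -cosN opprD mulrN opprK.
  split.
    have O0 : trig 0 (fun x => f (- x)) = trig 0 f by apply/funext => y; rewrite O oppr0.
    by rewrite -E3 O0.
  rewrite -E4 -E2 -[RHS]mulrN; congr (_ * _); rewrite -RintN; apply: eqRint => x.
  rewrite -[RHS]mulrN; congr (_ * _).
  have rT := rs_trig (- (pi / 2)) (rtest_rs tf).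
  rewrite (_ : (fun y => - trig _ _ y) = (fun y => -1 * (- 1 * trig (- (pi / 2)) f y))).
    rewrite (derive1nZ _ _ (rs_smooth (rsZ _ rT))) (derive1nZ _ _ (rs_smooth rT)).
    rewrite !mulN1r opprK.
    rewrite (_ : (fun y => - trig (- (pi / 2)) f y) = (fun y => -1 * trig (- (pi / 2)) f y)).
      by rewrite (derive1nZ _ _ (rs_smooth rT)) mulN1r opprK.
    by apply/funext => y; rewrite mulN1r.
  by apply/funext => y; rewrite O opprK trig_pihalf opprK !mulN1r opprK.
have cr := smooth_continuous sr; have ci := smooth_continuous si.
have copp (c : R -> R) : continuous c -> continuous (fun x => c (- x)).
  by move=> cc x; apply: (@continuous_comp _ _ _ -%R c); [exact: opp_continuous|exact: cc].
move=> x.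
have Er : forall y, Re (ghat (- y)) - Re (ghat y) = 0.
  apply: du_bois_reymond.
    by move=> y; apply: cvgB; [exact: (copp _ cr)|exact: cr].
  move=> f tf; have j1 := rtestMc tf cr; have j2 := rtestMc tf (copp _ cr).
  under eqRint do rewrite mulrBl.
  rewrite RintB//; apply/eqP; rewrite subr_eq0; apply/eqP.
  have [Nr _] := N _ tf; rewrite -Nr.
  by have [_ ->] := Rint_opp j2; apply: eqRint => y; rewrite opprK.
have Ei : forall y, Im (ghat (- y)) + Im (ghat y) = 0.
  apply: du_bois_reymond.
    by move=> y; apply: cvgD; [exact: (copp _ ci)|exact: ci].
  move=> f tf; have j1 := rtestMc tf ci; have j2 := rtestMc tf (copp _ ci).
  under eqRint do rewrite mulrDl.
  rewrite RintD//; apply/eqP; rewrite addr_eq0; apply/eqP.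
  have [_ Ni] := N _ tf; rewrite -Ni.
  by have [_ ->] := Rint_opp j2; apply: eqRint => y; rewrite opprK.
apply: complexP; first by have /eqP := Er x; rewrite subr_eq0 => /eqP ->; case: (ghat x).
by have /eqP := Ei x; rewrite addr_eq0 => /eqP ->; case: (ghat x).
Qed.

Lemma dotpNl d (x y : 'rV[R]_d) : dotp (- x) y = - dotp x y.
Proof. by rewrite /dotp -sumrN; apply: eq_bigr => i _; rewrite !mxE mulNr. Qed.

Lemma fourier_rV_opp d (f : 'rV[R]_d -> R) xi : fourier_rV f (- xi) = (fourier_rV f xi)^*%C.
Proof.
rewrite /fourier_rV /cintegral /=; congr Complex.
  by apply: eqRint => x; rewrite dotpNl !opprK cosN !mul0r.
rewrite -RintN; apply: eqRint => x.
by rewrite dotpNl !opprK sinN !mul0r !addr0 mulrN opprK.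
Qed.

Lemma Hhat_opp d alpha (ghat : R -> R[i]) (f : 'rV[R]_d -> R) w rho :
  (forall x, ghat (- x) = (ghat x)^*%C) ->
  Hhat alpha ghat f w (- rho) = (Hhat alpha ghat f w rho)^*%C.
Proof.
move=> gh; rewrite /Hhat scaleNr fourier_rV_opp normrN gh.
have C (a : R) : (real_complex R a)^*%C = real_complex R a by apply: complexP; rewrite /= ?oppr0.
have I : Complex 0 (- rho) = (Complex 0 rho)^*%C by apply: complexP; rewrite /= ?oppr0.
set A := real_complex R (sphere_area _ _ / _); set B := real_complex R (`|rho| ^+ _).
have CA : (A^*)%C = A := C _; have CB : (B^*)%C = B := C _; clearbody A B.
have cM (x y : R[i]) : ((x * y)^*)%C = (x^*)%C * (y^*)%C by exact: rmorphM.
have cV (x : R[i]) : (x^-1^*)%C = (x^*)%C^-1 by exact: fmorphV.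
have cX (x : R[i]) n : ((x ^+ n)^*)%C = (x^*)%C ^+ n by exact: rmorphXn.
by rewrite !cM cV cX CA CB I.
Qed.

End hermitian.

(** * Integrals of functions that are not assumed measurable *)

Section arbitrary_integrals.
Context d (T : measurableType d) (R : realType) (m : {measure set T -> \bar R}).
Implicit Types (D N : set T).
Local Open Scope ereal_scope.

Import HBNNSimple.

(* Nothing is assumed measurable: the integral of a nonnegative function is a
   supremum over the simple functions below it. *)
Lemma lower_integral_le D (f g : T -> \bar R) : (forall x, D x -> 0 <= f x) ->
  (forall x, D x -> f x <= g x) -> \int[m]_(x in D) f x <= \int[m]_(x in D) g x.
Proof.
move=> f0 fg; have g0 x : D x -> 0 <= g x by move=> Dx; exact: le_trans (f0 _ Dx) (fg _ Dx).
rewrite !ge0_integralE//; apply: ge_ereal_sup => _ [h /= hf <-].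
apply: ereal_sup_ubound; exists h => //= x; apply: (le_trans (hf x)).
by rewrite /patch; case: ifPn => // /[1!inE]; exact: fg.
Qed.

(** A simple function below f stays below after multiplication by the indicator of N, and its
    integral does not change. *)
Lemma lower_integral_setI_le D N (f : T -> \bar R) : (forall x, 0 <= f x) ->
  measurable N -> m (~` N) = 0 ->
  \int[m]_(x in D) f x <= \int[m]_(x in D `&` N) f x.
Proof.
move=> f0 mN mN0; rewrite !ge0_integralE//; apply: ge_ereal_sup => _ [h /= hf <-].
have -> : sintegral m h = sintegral m (proj_nnsfun h mN).
  rewrite -!integralT_nnsfun.
  have me (g : {nnsfun T >-> R}) : measurable_fun setT (fun x => (g x)%:E).
    by apply/measurable_EFinP.
  have mNC := measurableC mN.
  rewrite (ge0_negligible_integral mNC)//; last by move=> x _; rewrite lee_fin.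
  rewrite [RHS](ge0_negligible_integral mNC)//; last by move=> x _; rewrite lee_fin.
  apply: eq_integral => x /[!inE]/= -[_ /contrapT Nx].
  by rewrite mindicE mem_set// mulr1.
apply: ereal_sup_ubound; eexists; last reflexivity.
move=> x; rewrite -[proj_nnsfun h mN x]/(h x * mindic R mN x)%R mindicE; have := hf x; rewrite /patch in_setI.
by case: (x \in N) => /=; rewrite ?mulr1 ?mulr0 ?andbT ?andbF.
Qed.

(** Lets almost everywhere hypotheses act on integrands such as w |-> ||Hhat_w||, whose
    measurability in w is not known. *)
Lemma integral_setI_conull D N (f : T -> \bar R) :
  measurable N -> m (~` N) = 0 ->
  \int[m]_(x in D) f x = \int[m]_(x in D `&` N) f x.
Proof.
move=> mN mN0.
have ge0 (g : T -> \bar R) : (forall x, 0 <= g x) ->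
    \int[m]_(x in D) g x = \int[m]_(x in D `&` N) g x.
  move=> g0; apply/eqP; rewrite eq_le lower_integral_setI_le//=.
  rewrite integral_mkcond [leRHS]integral_mkcond.
  apply: lower_integral_le => x _; first by rewrite erestrict_ge0.
  by rewrite /patch in_setI; case: (x \in D); case: (x \in N).
by rewrite integralE [RHS]integralE !ge0//.
Qed.

Lemma eq_integral_conull D N (f g : T -> \bar R) :
  measurable N -> m (~` N) = 0 -> (forall x, D x -> N x -> f x = g x) ->
  \int[m]_(x in D) f x = \int[m]_(x in D) g x.
Proof.
move=> mN mN0 fg; rewrite (integral_setI_conull _ _ mN)// [RHS](integral_setI_conull _ _ mN)//.
by apply: eq_integral => x /[!inE] -[Dx Nx]; exact: fg.
Qed.

End arbitrary_integrals.

(** * Integration against a measure with a density *)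

Section density.
Context d (T : measurableType d) (R : realType).
Variables (m m' : {measure set T -> \bar R}) (k : T -> R).
Hypotheses (k0 : forall x, 0 <= k x) (mk : measurable_fun setT k).
Hypothesis m'E : forall A, measurable A -> m' A = (\int[m]_(x in A) (k x)%:E)%E.
Local Open Scope ereal_scope.

Import HBNNSimple.

Lemma ge0_integral_density (f : T -> \bar R) : (forall x, 0 <= f x) ->
  measurable_fun setT f -> \int[m']_x f x = \int[m]_x (f x * (k x)%:E).
Proof.
move=> f0 mf; pose h := nnsfun_approx measurableT mf.
have mek : measurable_fun setT (EFin \o k) by apply/measurable_EFinP.
have meh n : measurable_fun setT (EFin \o h n) by apply/measurable_EFinP.
have -> : \int[m']_x f x = lim (\int[m']_x (EFin \o h n) x @[n --> \oo]).
  have fE x : f x = lim ((EFin \o h n) x @[n --> \oo]).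
    by apply/esym/cvg_lim => //; exact: cvg_nnsfun_approx.
  under eq_integral => x _ do rewrite fE.
  apply: monotone_convergence => //.
  - by move=> n x _ //=; rewrite lee_fin.
  - by move=> x _ a b ab; rewrite lee_fin; exact/lefP/nd_nnsfun_approx.
have -> : \int[m]_x (f x * (k x)%:E) =
    lim (\int[m]_x ((EFin \o h n) x * (k x)%:E) @[n --> \oo]).
  have fg x : f x * (k x)%:E = lim (((EFin \o h n) x * (k x)%:E) @[n --> \oo]).
    by apply/esym/cvg_lim => //; apply: cvgeZr => //; exact: cvg_nnsfun_approx.
  under eq_integral => x _ do rewrite fg.
  apply: monotone_convergence => [//| | |].
  - by move=> n; exact: emeasurable_funM.
  - by move=> n x _ /=; rewrite mule_ge0 ?lee_fin.
  - by move=> x _ a b ab/=; rewrite lee_wpmul2r ?lee_fin//; exact/lefP/nd_nnsfun_approx.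
suff suf n : \int[m']_x (EFin \o h n) x = \int[m]_x ((EFin \o h n) x * (k x)%:E).
  by under eq_fun do rewrite suf.
have hE x : (EFin \o h n) x =
    \sum_(y \in range (h n)) (y * \1_(h n @^-1` [set y]) x)%:E.
  by rewrite /= {1}fimfunE -fsumEFin.
have indich r : measurable_fun setT (fun x => (r * \1_(h n @^-1` [set r]) x)%:E).
  by apply: (measurable_comp measurableT) => //; exact: measurable_funM.
under eq_integral => x _ do rewrite hE.
under [RHS]eq_integral => x _.
  rewrite hE ge0_mule_fsuml => [|y]; last exact: nnfun_muleindic_ge0.
  over.
rewrite ge0_integral_fsum//; last by move=> y x _; exact: nnfun_muleindic_ge0.
rewrite ge0_integral_fsum//; last 2 first.
  - by move=> y; exact: emeasurable_funM.
  - by move=> y x _; rewrite mule_ge0 ?lee_fin// -lee_fin; exact: nnfun_muleindic_ge0.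
apply: eq_fsbigr => r; rewrite inE => -[t _ rt].
have r0 : (0 <= r)%R by rewrite -rt.
have mP : measurable (h n @^-1` [set r]) by exact: measurable_sfunP.
under eq_integral => x _ do rewrite EFinM.
under [RHS]eq_integral => x _ do rewrite EFinM -muleA.
rewrite ge0_integralZl//; last first.
  by apply/measurable_EFinP.
rewrite ge0_integralZl//; last 2 first.
  - apply: emeasurable_funM => //; exact/measurable_EFinP.
  - by move=> x _; rewrite mule_ge0 ?lee_fin.
rewrite integral_indic// setIT m'E// integral_mkcond; congr (_ * _).
apply: eq_integral => x _; rewrite /patch indicE.
by case: (x \in _); rewrite ?mul1e ?mul0e.
Qed.

(** Multiplication by k >= 0 commutes with positive and negative parts, so the nonnegative case
    applies to each of them. *)
Lemma integral_density (f : T -> R) : measurable_fun setT f ->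
  \int[m']_x (f x)%:E = \int[m]_x (f x * k x)%:E.
Proof.
move=> mf; have mef : measurable_fun setT (EFin \o f) by apply/measurable_EFinP.
rewrite integralE [RHS]integralE; congr (_ - _).
- rewrite ge0_integral_density//; last exact: measurable_funepos.
  apply: eq_integral => x _; rewrite !funeposE muleC maxe_pMr ?lee_fin//.
  by rewrite mule0 EFinM muleC.
- rewrite ge0_integral_density//; last exact: measurable_funeneg.
  apply: eq_integral => x _; rewrite !funenegE muleC maxe_pMr ?lee_fin//.
  by rewrite mule0 muleN EFinM muleC.
Qed.

End density.

(** * Jordan parts and total variation of a signed measure with a density *)

Section induced_variation.
Context d (T : measurableType d) (R : realType) (m : {measure set T -> \bar R}).
Variable h : T -> R.
Hypothesis ih : m.-integrable setT (EFin \o h).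
Local Notation nu := (induced_charge ih).
Local Open Scope ereal_scope.

Let mh : measurable_fun setT h := integ_measurable ih.
Let P := [set x | (0 <= h x)%R].
Let N := [set x | (h x < 0)%R].

Let mP : measurable P.
Proof.
rewrite (_ : P = h @^-1` `[0%R, +oo[); first by rewrite -[X in measurable X]setTI; exact: mh.
by apply/seteqP; split => x; rewrite /P/= in_itv/= andbT.
Qed.

Let mN : measurable N.
Proof.
rewrite (_ : N = ~` P); first exact: measurableC.
by apply/seteqP; split => x; rewrite /P/N/= ltNge => /negP.
Qed.

Let nuE A : (nu : {charge set T -> \bar R}) A = \int[m]_(x in A) (h x)%:E.
Proof. by []. Qed.

Let nuN A : A `<=` N -> (nu : {charge set T -> \bar R}) A = - \int[m]_(x in A) (- h x)%:E.
Proof.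
move=> AN; rewrite nuE -integral_ge0N; last first.
  by move=> x Ax; rewrite lee_fin oppr_ge0; apply/ltW/AN.
by apply: eq_integral => x _; rewrite /= opprK.
Qed.

Lemma induced_hahn : hahn_decomposition nu P N.
Proof.
split.
- split => // A mA AP; rewrite nuE; apply: integral_ge0 => x Ax; rewrite lee_fin; exact: AP.
- split => // A mA AN; rewrite nuN// leeNl oppe0; apply: integral_ge0 => x Ax.
  by rewrite lee_fin oppr_ge0; apply/ltW/AN.
- by apply/seteqP; split => // x _; rewrite /P/N/=; case: (leP 0%R (h x)) => ?; [left|right].
- apply/seteqP; split => // x []; rewrite /P/N/= => h1 h2.
  by have := le_lt_trans h1 h2; rewrite ltxx.
Qed.

Variables (P' N' : set T) (hd : hahn_decomposition nu P' N').

(** [hahn] comes from a choice, so the decomposition must be arbitrary here; its sets give the same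
    values as the sign sets of h by uniqueness. *)
Lemma induced_jordan_pos A : measurable A ->
  jordan_pos hd A = \int[m]_(x in A) (Num.max (h x) 0)%:E.
Proof.
move=> mA; rewrite jordan_posE cjordan_posE /crestr0/= mem_set// /crestr/=.
have [-> _] := Hahn_decomposition_uniq hd induced_hahn mA.
rewrite nuE integral_mkcondr; apply: eq_integral => x _.
rewrite /patch; case: ifPn => [/[1!inE] hx|/negP hx]; first by rewrite max_l.
by rewrite max_r// leNgt; apply/negP => hx0; apply: hx; rewrite inE; exact/ltW.
Qed.

Lemma induced_jordan_neg A : measurable A ->
  jordan_neg hd A = \int[m]_(x in A) (Num.max (- h x) 0)%:E.
Proof.
move=> mA; rewrite jordan_negE cjordan_negE /crestr0/= mem_set// /crestr/=.
have [_ ->] := Hahn_decomposition_uniq hd induced_hahn mA.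
rewrite nuN ?oppeK// integral_mkcondr; apply: eq_integral => x _.
rewrite /patch; case: ifPn => [/[1!inE] hx|/negP hx]; first by rewrite max_l// oppr_ge0 ltW.
by rewrite max_r// leNgt; apply/negP => hx0; apply: hx; rewrite inE /N/= -oppr_gt0.
Qed.

Lemma induced_variation A : measurable A ->
  charge_variation hd A = \int[m]_(x in A) `|h x|%:E.
Proof.
move=> mA; rewrite /charge_variation/= induced_jordan_pos// induced_jordan_neg//.
have mk1 : measurable_fun setT (fun x => Num.max (h x) 0%R) by exact: measurable_maxr.
have mk2 : measurable_fun setT (fun x => Num.max (- h x)%R 0%R).
  by apply: measurable_maxr => //; exact: measurableT_comp.
rewrite -ge0_integralD//; first last.
- by apply/measurable_EFinP; exact: measurable_funTS.
- by move=> x _; rewrite lee_fin le_max lexx orbT.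
- by apply/measurable_EFinP; exact: measurable_funTS.
- by move=> x _; rewrite lee_fin le_max lexx orbT.
apply: eq_integral => x _; rewrite -EFinD; congr (_%:E).
case: (ger0P (h x)) => hx.
  have e : Num.max (- h x)%R 0%R = 0%R by rewrite max_r// oppr_le0.
  by rewrite e addr0.
by rewrite max_l ?add0r// oppr_ge0 ltW.
Qed.

End induced_variation.

(** * The normalized measure of the sphere *)

Section sphere.
Context {R : realType} {d : nat}.
Implicit Types (x w : 'rV[R]_d) (A : set 'rV[R]_d).

Lemma dotpZ a b (x y : 'rV[R]_d) : dotp (a *: x) (b *: y) = a * b * dotp x y.
Proof.
rewrite /dotp big_distrr/=; apply: eq_bigr => i _; rewrite !mxE; ring.
Qed.

Lemma dotp_ge0 x : 0 <= dotp x x.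
Proof. by apply: sumr_ge0 => i _; rewrite -expr2 sqr_ge0. Qed.

Lemma enormZ a x : enorm (a *: x) = `|a| * enorm x.
Proof. by rewrite /enorm dotpZ sqrtrM -?expr2 ?sqr_ge0// sqrtr_sqr. Qed.

Lemma enorm_ge0 x : 0 <= enorm x. Proof. exact: sqrtr_ge0. Qed.

Lemma radial_proj_usphere x : 0 < enorm x -> usphere R d (radial_proj x).
Proof.
move=> x0; rewrite /usphere/= /radial_proj enormZ ger0_norm ?invr_ge0 ?enorm_ge0//.
by rewrite mulVf// gt_eqF.
Qed.

Lemma radial_proj_id w : usphere R d w -> radial_proj w = w.
Proof. by move=> sw; rewrite /radial_proj sw invr1 scale1r. Qed.

Lemma measurable_usphere : measurable (usphere R d).
Proof.
rewrite (_ : usphere R d = @enorm R d @^-1` [set 1])//.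
by rewrite -[X in measurable X]setTI; exact: measurable_enorm.
Qed.

Lemma sphere_measureE A : sphere_measure R d A =
  ((sphere_area R d)^-1%:E * (d%:R%:E *
    lebesgue_rV R d ((@radial_proj R d @^-1` A) `&` @punctured_ball R d)))%E.
Proof. by []. Qed.

Lemma sphere_measureC0 : sphere_measure R d (~` usphere R d) = 0%E.
Proof.
rewrite sphere_measureE (_ : _ `&` _ = set0) ?measure0 ?mule0//.
apply/seteqP; split => // x [/= h /andP[x0 _]]; apply: h.
exact: radial_proj_usphere.
Qed.

(** A copy of [sphere_measure] that carries the finite measure structure required by the product
    with Lebesgue measure. *)
Definition sphm : set 'rV[R]_d -> \bar R := sphere_measure R d.

HB.instance Definition _ := Measure.on sphm.

(** No volume is computed. Were the total surface infinite, [sphere_area] would be [fine] of it,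
    namely 0; as 0^-1 = 0, the normalized measure would be zero, hence still finite. *)
Let finite_sphm : fin_num_fun sphm.
Proof.
move=> A mA; rewrite /sphm.
have [S0|Soo] := boolP (surface_measure d setT \is a @fin_num R).
  rewrite ge0_fin_numE//; apply: (@le_lt_trans _ _ (sphere_measure R d setT)).
    by apply: le_measure; rewrite ?inE.
  change (((sphere_area R d)^-1%:E * surface_measure d setT)%E < +oo)%E.
  by rewrite -(fineK S0) -EFinM ltry.
rewrite (_ : sphere_measure R d A = ((sphere_area R d)^-1%:E * surface_measure d A)%E)//.
have -> : sphere_area R d = 0.
  have := measure_ge0 (@surface_measure R d) setT.
  by rewrite /sphere_area; case: (surface_measure d setT) Soo.
by rewrite invr0 mul0e.
Qed.

HB.instance Definition _ := Measure_isFinite.Build _ _ _ sphm finite_sphm.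

End sphere.
Arguments sphm R d : clear implicits.

(** * Measurability of complex-valued functions *)

Section complex_measurability.
Context d (T : measurableType d) (R : realType).
Local Notation Re := (@complex.Re R).
Local Notation Im := (@complex.Im R).
Implicit Types (u v : T -> R[i]).

Definition cmeasurable u := measurable_fun setT (fun x => Re (u x)) /\
  measurable_fun setT (fun x => Im (u x)).

Lemma cmeasurable_real (f : T -> R) : measurable_fun setT f ->
  cmeasurable (fun x => real_complex R (f x)).
Proof. by move=> mf; split. Qed.

Lemma cmeasurableM u v : cmeasurable u -> cmeasurable v -> cmeasurable (fun x => u x * v x).
Proof.
move=> [u1 u2] [v1 v2]; split.
  under eq_fun do rewrite complex_ReM.
  by apply: measurable_funB; exact: measurable_funM.
under eq_fun do rewrite complex_ImM.
by apply: measurable_funD; exact: measurable_funM.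
Qed.

Lemma cmeasurableX u n : cmeasurable u -> cmeasurable (fun x => u x ^+ n).
Proof.
move=> mu; elim: n => [|n ih]; first by split; exact: measurable_cst.
have -> : (fun x => u x ^+ n.+1) = (fun x => u x * u x ^+ n).
  by apply/funext => x; rewrite exprS.
exact: cmeasurableM.
Qed.

Lemma cmeasurableV u : cmeasurable u -> cmeasurable (fun x => (u x)^-1).
Proof.
move=> [u1 u2].
have E z : z^-1 = Complex (Re z / (Re z ^+ 2 + Im z ^+ 2)) (- (Im z / (Re z ^+ 2 + Im z ^+ 2))).
  by case: z.
have mD : measurable_fun setT (fun x => (Re (u x) ^+ 2 + Im (u x) ^+ 2)^-1).
  rewrite (_ : (fun _ => _) = (@powR R ^~ (-1)) \o (fun x => Re (u x) ^+ 2 + Im (u x) ^+ 2)).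
    apply: measurableT_comp; first exact: measurable_powR.
    by apply: measurable_funD; exact: measurable_funX.
  by apply/funext => x /=; rewrite powR_inv1// addr_ge0// sqr_ge0.
split.
  under eq_fun do rewrite E; exact: measurable_funM.
under eq_fun do rewrite E; apply: measurableT_comp => //; exact: measurable_funM.
Qed.

End complex_measurability.

Lemma cmeasurable_comp d d' (T : measurableType d) (T' : measurableType d') (R : realType)
  (u : T -> R[i]) (g : T' -> T) :
  cmeasurable u -> measurable_fun setT g -> cmeasurable (fun x => u (g x)).
Proof.
by move=> [u1 u2] mg; split; [exact: (measurableT_comp u1 mg)|exact: (measurableT_comp u2 mg)].
Qed.

(** * Joint measurability in (w, rho) and (w, b) of Hhat and of its inverse transform *)

Section Hhat_measurability.
Context {R : realType} {d : nat}.
Local Notation V := 'rV[R]_d.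
Local Notation Re := (@complex.Re R).
Local Notation Im := (@complex.Im R).
Implicit Types (f : V -> R) (ghat : R -> R[i]).

Lemma measurable_dotp : measurable_fun setT (fun z : V * V => dotp z.1 z.2).
Proof.
apply: measurable_sum => i; apply: measurable_funM.
  exact: (measurableT_comp (measurable_rV_coord i) measurable_fst).
exact: (measurableT_comp (measurable_rV_coord i) measurable_snd).
Qed.

Lemma measurable_scaleV : measurable_fun setT (fun z : V * R => z.2 *: z.1).
Proof.
apply: measurable_fun_rV => i; under eq_fun do rewrite mxE.
apply: measurable_funM; first exact: measurable_snd.
exact: (measurableT_comp (measurable_rV_coord i) measurable_fst).
Qed.

Lemma cmeasurable_fourier_rV f : measurable_fun setT f -> cmeasurable (fourier_rV f).
Proof.
move=> mf.
have mf2 : measurable_fun setT (fun z : V * V => f z.2).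
  exact: (measurableT_comp mf measurable_snd).
have me (u : R -> R) : measurable_fun setT u ->
    measurable_fun setT (fun z : V * V => u (- dotp z.1 z.2)).
  move=> mu; apply: (measurableT_comp mu); apply: measurableT_comp => //.
  exact: measurable_dotp.
have mc : measurable_fun setT (fun z : V * V => cos (- dotp z.1 z.2)).
  by apply: me; apply: continuous_measurable_fun; exact: continuous_cos.
have ms : measurable_fun setT (fun z : V * V => sin (- dotp z.1 z.2)).
  by apply: me; apply: continuous_measurable_fun; exact: continuous_sin.
split.
- apply: (@measurable_Rint_r _ _ _ _ _ (lebesgue_rV R d)
    (fun z => Re (real_complex R (f z.2) * expi (- dotp z.1 z.2)))).
  under eq_fun do rewrite complex_ReM /= mul0r subr0.
  exact: measurable_funM.
- apply: (@measurable_Rint_r _ _ _ _ _ (lebesgue_rV R d)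
    (fun z => Im (real_complex R (f z.2) * expi (- dotp z.1 z.2)))).
  under eq_fun do rewrite complex_ImM /= mul0r addr0.
  exact: measurable_funM.
Qed.

Lemma csmooth_cmeasurable (u : R -> R[i]) : csmooth u -> cmeasurable u.
Proof. by move=> /csmoothP[s1 s2]; split; exact: smooth_measurable. Qed.

Lemma cmeasurable_Hhat alpha ghat f : csmooth ghat -> measurable_fun setT f ->
  cmeasurable (fun z : V * R => Hhat alpha ghat f z.1 z.2).
Proof.
move=> sg mf; apply: cmeasurableM; last first.
  exact: (cmeasurable_comp (cmeasurable_fourier_rV mf) measurable_scaleV).
apply: cmeasurableM; first by split; exact: measurable_cst.
apply: cmeasurableM; last first.
  apply: cmeasurableV.
  exact: (cmeasurable_comp (csmooth_cmeasurable sg) measurable_snd).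
apply: cmeasurableM.
  by apply: cmeasurableX; split; [exact: measurable_cst|exact: measurable_snd].
apply: cmeasurable_real; apply: measurable_funX; apply: measurableT_comp => //.
Qed.

Lemma measurable_hinv (u : V -> R -> R[i]) : cmeasurable (fun z : V * R => u z.1 z.2) ->
  measurable_fun setT (fun z : V * R => hinv (u z.1) z.2).
Proof.
move=> [u1 u2].
have mt (g : V * R -> R) (th : R) : measurable_fun setT g ->
    measurable_fun setT (fun z : V * R => trig th (fun r => g (z.1, r)) z.2).
  move=> mg.
  have mF : measurable_fun setT (fun y : (V * R) * R => g (y.1.1, y.2) * cos (y.1.2 * y.2 + th)).
    have m1 : measurable_fun setT (fun y : (V * R) * R => y.1.1) by exact: measurableT_comp.
    have m2 : measurable_fun setT (fun y : (V * R) * R => y.1.2) by exact: measurableT_comp.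
    have m3 : measurable_fun setT (fun y : (V * R) * R => y.2) by exact: measurable_snd.
    apply: measurable_funM; first exact: (measurableT_comp mg (measurable_fun_pair m1 m3)).
    apply: measurableT_comp; first by apply: continuous_measurable_fun; exact: continuous_cos.
    by apply: measurable_funD => //; exact: measurable_funM.
  exact: (measurable_Rint_r (@lebesgue_measure R) mF).
apply: measurable_funM => //; apply: measurable_funD.
  exact: (mt _ 0 u1).
exact: (mt _ (pi / 2) u2).
Qed.

End Hhat_measurability.

(** * Weighted integral of the inverse transform on one line *)

Section profile.
Context {R : realType}.
Local Notation leb := (@lebesgue_measure R).
Implicit Types (u : R -> R[i]).
Local Open Scope ereal_scope.

Lemma sobolev_norm_ge0 m O u : 0 <= sobolev_norm m O u :> \bar R.
Proof.
apply: le_ereal_inf_tmp => _ [v _ <-]; apply: sume_ge0 => k _.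
by apply: integral_ge0 => x _; rewrite lee_fin normc_ge0.
Qed.

(** [hinv_bound] at m = p + 2 gives 2^(p+4); two of its powers are spent as (1 + |b|)^2 >= 1 + b^2,
    and pi is the integral of 1 / (1 + b^2). *)
Lemma integral_hinv_le p u :
  \int[leb]_b ((1 + `|b|) ^+ p * `|hinv u b|)%:E <=
  (2 ^+ (p + 4) * pi)%:E * sobolev_norm (p + 2) setT u.
Proof.
have C0 : (0 < 2 ^+ (p + 4) * pi :> R)%R by rewrite mulr_gt0 ?exprn_gt0 ?pi_gt0.
have := @hinv_bound R (p + 2) u.
have := sobolev_norm_ge0 (p + 2) setT u.
case: sobolev_norm => [s|_ _|//]; last by rewrite gt0_muley ?lte_fin// leey.
rewrite lee_fin => s0 hb.
pose c := (2 ^+ (p + 4) * s)%R.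
have c0 : (0 <= c)%R by rewrite mulr_ge0// exprn_ge0.
apply: (@le_trans _ _ (\int[leb]_b (c%:E * ((1 + b ^+ 2)^-1)%:E))).
  apply: lower_integral_le => b _; first by rewrite lee_fin mulr_ge0// exprn_ge0// addr_ge0.
  have := hb b; rewrite -EFinM !lee_fin => {}hb.
  have b1 : (0 < 1 + b ^+ 2)%R by rewrite ltr_pwDl// sqr_ge0.
  rewrite ler_pdivlMr//; apply: le_trans (_ : (1 + `|b|) ^+ (p + 2) * `|hinv u b| <= _)%R; last first.
    by move: hb; rewrite /c (_ : (p + 2).+2 = (p + 4)%N)// !addnS addn0.
  rewrite mulrAC ler_wpM2r// exprD ler_wpM2l ?exprn_ge0 ?addr_ge0//.
  by rewrite sqrrD expr1n real_normK ?num_real// lerD2r lerDl mul1r mulrn_wge0.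
rewrite ge0_integralZl//; first last.
- by move=> b _; rewrite lee_fin invr_ge0 addr_ge0// sqr_ge0.
- by apply/measurable_EFinP; exact: (integ_measurable (@integ_oneDsqrV R)).
have -> : \int[leb]_b ((1 + b ^+ 2)^-1)%:E = pi%:E.
  rewrite -(@Rint_oneDsqrV R) fineK//.
  exact: (integrable_fin_num measurableT (@integ_oneDsqrV R)).
by rewrite -!EFinM lee_fin /c mulrAC.
Qed.

End profile.

(** * Sets of full measure and the product of the sphere and the line *)

Lemma ae_conull d (T : measurableType d) (R : realType) (m : {measure set T -> \bar R})
  (P : T -> Prop) : {ae m, forall x, P x} ->
  exists N, [/\ measurable N, m (~` N) = 0%E & forall x, N x -> P x].
Proof.
move=> [A [mA mA0 PA]]; exists (~` A); split; [exact: measurableC|by rewrite setCK|].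
by move=> x Ax; apply: contrapT => Px; apply/Ax/PA.
Qed.

Section sphere_line.
Context (R : realType) (d : nat).
Local Notation V := 'rV[R]_d.

(* [lebesgue_measure] lives on [measurableTypeR R], whose display differs from
   the one of [R]; the pushforward by the identity changes the display. *)
Definition to_line (z : V * measurableTypeR R) : V * R := z.

Lemma measurable_to_line : measurable_fun setT to_line.
Proof. by move=> _ A mA; rewrite setTI. Qed.

Definition sphere_line : {measure set (V * R)%type -> \bar R} :=
  measure_function_pushforward__canonical__measure_function_Measure
    (sphm R d \x @lebesgue_measure R)%E measurable_to_line.

Local Open Scope ereal_scope.

Lemma ge0_integral_sphere_line (f : V * R -> \bar R) : measurable_fun setT f ->
  (forall z, 0 <= f z) ->
  \int[sphere_line]_z f z = \int[sphm R d]_w \int[@lebesgue_measure R]_b f (w, b).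
Proof.
move=> mf f0; rewrite ge0_integral_pushforward//.
  exact: (fubini_tonelli1 (m1 := sphm R d) (m2 := @lebesgue_measure R)).
exact: measurable_to_line.
Qed.

Lemma measurable_sphere_line : measurable (usphere R d `*` [set: R]).
Proof. by apply: measurableX => //; exact: measurable_usphere. Qed.

Lemma sphere_lineC0 : sphere_line (~` (usphere R d `*` [set: R])) = 0.
Proof.
have -> : ~` (usphere R d `*` [set: R]) = (~` usphere R d) `*` [set: R].
  apply/seteqP; split => z /= h; first by split => // Sz; exact: h.
  by move=> [Sz _]; case: h.
transitivity ((sphm R d \x @lebesgue_measure R) ((~` usphere R d) `*` setT)) => //.
rewrite product_measure1E//; last exact: (measurableC (@measurable_usphere R d)).
by rewrite [X in X * _](_ : _ = 0) ?mul0e//; exact: (@sphere_measureC0 R d).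
Qed.

Lemma integrable_sphere_line (f : V * R -> \bar R) :
  sphere_line.-integrable setT f -> (sphm R d \x @lebesgue_measure R).-integrable setT f.
Proof.
move=> /integrableP[mf ioo]; apply/integrableP; split => //.
apply: le_lt_trans ioo; rewrite ge0_integral_pushforward//; first exact: measurable_to_line.
exact: measurableT_comp.
Qed.

(** The inner real-valued integral is truncated by [fine]; it equals the extended one only on the
    slices where f is integrable, which form a set of full measure. *)
Lemma fubini_sphere_line (f : V * R -> R) :
  sphere_line.-integrable setT (EFin \o f) ->
  (\int[sphere_line]_z f z)%R =
  (\int[sphere_measure R d]_(w in usphere R d) \int[@lebesgue_measure R]_b f (w, b))%R.
Proof.
move=> jf; have jf' := integrable_sphere_line jf.
have mf := integ_measurable jf.
have [N [mN N0 jN]] := ae_conull (ae_integrable1 jf').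
rewrite /Rintegral; congr fine.
transitivity (\int[sphm R d \x @lebesgue_measure R]_z (f z)%:E).
  rewrite integral_pushforward//; [exact: measurable_to_line|exact/measurable_EFinP].
rewrite -(integral12_prod_meas1 jf') /fubini_F.
rewrite -[LHS]/(\int[sphere_measure R d]_w \int[@lebesgue_measure R]_b (f (w, b))%:E).
rewrite [LHS](integral_setI_conull _ _ (@measurable_usphere R d)) ?sphere_measureC0// setTI.
apply: (eq_integral_conull mN) => // w _ Nw; rewrite fineK//.
exact: integrable_fin_num (jN w Nw).
Qed.

End sphere_line.

(** * The measure with density [hinv] and its weighted total variation *)

Section measure_of_profile.
Context {R : realType} {d : nat}.
Local Notation V := 'rV[R]_d.
Local Notation leb := (@lebesgue_measure R).
Local Notation S := (usphere R d).
Local Notation sm := (sphere_measure R d).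
Variables (p : nat) (u : V -> R -> R[i]).
Hypothesis mu : cmeasurable (fun z : V * R => u z.1 z.2).
Local Open Scope ereal_scope.

Definition profile_density (z : V * R) : R := hinv (u z.1) z.2.
Local Notation h := profile_density.
Local Notation P := (sphere_line R d).

Let mh : measurable_fun setT h := measurable_hinv mu.
Let K (z : V * R) : R := ((1 + `|z.2|) ^+ p * `|h z|)%R.

Let mK : measurable_fun setT K.
Proof.
apply: measurable_funM; last exact: measurableT_comp.
by apply: measurable_funX; apply: measurable_funD => //; exact: measurableT_comp.
Qed.

Let K0 z : (0 <= K z)%R. Proof. by rewrite mulr_ge0// exprn_ge0// addr_ge0. Qed.

Let G w := \int[leb]_b (K (w, b))%:E.

Let G0 w : 0 <= G w. Proof. by apply: integral_ge0 => b _; rewrite lee_fin. Qed.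

Let mG : measurable_fun setT G.
Proof.
have mEK : measurable_fun setT (EFin \o K) by exact/measurable_EFinP.
have K0' z : 0 <= (EFin \o K) z by rewrite lee_fin.
have := @measurable_fun_fubini_tonelli_F _ _ _ _ _ leb _ mEK K0'.
by [].
Qed.

Variable C : R.
Hypothesis C0 : (0 < C)%R.
Hypothesis G_bound : forall w, \int[leb]_b ((1 + `|b|) ^+ p * `|hinv (u w) b|)%:E <=
  C%:E * sobolev_norm (p + 2) setT (u w).

Let G_le w : (C^-1)%:E * G w <= sobolev_norm (p + 2) setT (u w).
Proof.
by rewrite lee_pdivrMl//; exact: G_bound.
Qed.

(** C is pulled out here, where the integrand G is measurable: it could not be pulled out of the
    integral of the Sobolev norm, which is only compared with C^-1 G pointwise. *)
Let GE : \int[P]_z (K z)%:E = C%:E * \int[sm]_(w in S) ((C^-1)%:E * G w).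
Proof.
rewrite ge0_integral_sphere_line//; last first.
  exact/measurable_EFinP.
rewrite -ge0_integralZl//; first last.
- by rewrite lee_fin ltW.
- by move=> w _; rewrite mule_ge0// lee_fin invr_ge0 ltW.
- by apply: measurable_funeM; exact: measurable_funTS.
- exact: measurable_usphere.
rewrite -[LHS]/(\int[sm]_w G w) [LHS](integral_setI_conull _ _ measurable_usphere) ?sphere_measureC0//.
rewrite setTI.
by apply: eq_integral => w _; rewrite muleA -EFinM mulfV ?gt_eqF// mul1e.
Qed.

Lemma profile_tonelli_le :
  \int[P]_z (K z)%:E <= C%:E * \int[sm]_(w in S) sobolev_norm (p + 2) setT (u w).
Proof.
rewrite GE; apply: lee_wpmul2l; first by rewrite lee_fin ltW.
apply: lower_integral_le => w _; last exact: G_le.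
by rewrite mule_ge0// lee_fin invr_ge0 ltW.
Qed.

Hypothesis traces : {ae sm, forall w, traces_agree (p + 2) (u w)}.
Hypothesis fin : \int[sm]_(w in S) sobolev_norm (p + 2) [set~ 0%R] (u w) < +oo.

(** The finiteness hypothesis concerns the norm on R \ {0}, which dominates the norm on R only for
    the w with matching traces; both integrals are first restricted to those w. *)
Lemma profile_tonelli_lty : \int[P]_z (K z)%:E < +oo.
Proof.
have [N [mN N0 tN]] := ae_conull traces.
rewrite GE lte_mul_pinfty ?lee_fin ?ltW//; apply: le_lt_trans fin.
rewrite (integral_setI_conull _ _ mN)// [leRHS](integral_setI_conull _ _ mN)//.
apply: lower_integral_le => w [Sw Nw]; first by rewrite mule_ge0// lee_fin invr_ge0 ltW.
by apply: (le_trans (G_le w)); apply/traces_sobolev_norm/tN.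
Qed.

Lemma profile_integrable : P.-integrable setT (EFin \o h).
Proof.
apply/integrableP; split; first exact/measurable_EFinP.
apply: le_lt_trans profile_tonelli_lty; apply: lower_integral_le => z _; first exact: abse_ge0.
by rewrite lee_fin ler_peMl// exprn_ege1// lerDl.
Qed.

Definition profile_measure : {charge set (V * R)%type -> \bar R} :=
  induced_charge profile_integrable.

Lemma profile_tv : tv_norm profile_measure p = \int[P]_z (K z)%:E.
Proof.
rewrite /tv_norm (ge0_integral_density (m := P) (k := fun z => `|h z|%R)) //.
- exact: measurableT_comp.
- by move=> A mA; exact: induced_variation.
- apply/measurable_EFinP; apply: measurable_funX; apply: measurable_funD => //.
  exact: measurableT_comp.
Qed.

Lemma profile_weighted : weighted_measure profile_measure p.
Proof.
split; last by rewrite profile_tv; exact: profile_tonelli_lty.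
move=> A mA AS0; apply: null_set_integral => //.
  by apply/measurable_funTS/measurable_EFinP.
apply/eqP; rewrite -measure_le0 -(@sphere_lineC0 R d); apply: le_measure; rewrite ?inE//.
  exact: (measurableC (@measurable_sphere_line R d)).
move=> z Az [Sz _]; have : (A `&` (S `*` setT)) z by [].
by rewrite AS0.
Qed.

Lemma profile_tv_le : tv_norm profile_measure p <=
  C%:E * \int[sm]_(w in S) sobolev_norm (p + 2) setT (u w).
Proof. by rewrite profile_tv; exact: profile_tonelli_le. Qed.

End measure_of_profile.

(** * Measurability from continuity, through grids *)

Section grid.
Context (R : realType) (d : nat).
Local Notation V := 'rV[R]_d.

Lemma normV_le (x : V) (e : R) : 0 <= e -> (forall i, `|x ord0 i| <= e) -> `|x| <= e.
Proof.
move=> e0 xe; have [->//|x0] := eqVneq `|x| 0.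
have [[i j] /= E] := mx_norm_neq0 x0.
by rewrite -[`|x|]/(mx_norm x) E (ord1 i).
Qed.

Definition cell (n : nat) (z : V * R) : 'rV[int]_d * int :=
  (\row_i Num.floor (n.+1%:R * z.1 ord0 i), Num.floor (n.+1%:R * z.2)).

Definition corner (n : nat) (k : 'rV[int]_d * int) : V * R :=
  (\row_i ((k.1 ord0 i)%:~R / n.+1%:R), k.2%:~R / n.+1%:R).

Lemma corner_floor n (t : R) : `|t - (Num.floor (n.+1%:R * t))%:~R / n.+1%:R| <= n.+1%:R^-1.
Proof.
have n0 : 0 < n.+1%:R :> R by [].
rewrite -(ler_pM2l n0) -[X in X * `|_|]ger0_norm ?ltW// -normrM mulrBr mulrCA !mulfV ?gt_eqF//.
rewrite mulr1; have /andP[] := floor_itv (n.+1%:R * t).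
by rewrite intrD1 => a b; rewrite ger0_norm; lra.
Qed.

Lemma cell_corner n z : `|z - corner n (cell n z)| <= n.+1%:R^-1.
Proof.
rewrite prod_normE ge_max; apply/andP; split; last exact: corner_floor.
by apply: normV_le => // i; rewrite !mxE; exact: corner_floor.
Qed.

Lemma cvg_corner z : corner n (cell n z) @[n --> \oo] --> z.
Proof.
apply/cvgrPdist_le => e e0; near=> n; apply: (le_trans (cell_corner n z)).
by apply/ltW; near: n; exact: (near_infty_natSinv_lt (PosNum e0)).
Unshelve. all: by end_near. Qed.

Lemma measurable_cell n k : measurable (cell n @^-1` [set k]).
Proof.
have mfl (g : V * R -> R) c : measurable_fun setT g ->
    measurable [set z | Num.floor (n.+1%:R * g z) = c].
  move=> mg; rewrite (_ : mkset _ = (fun z => n.+1%:R * g z) @^-1` `[c%:~R, (c + 1)%:~R[).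
    rewrite -[X in measurable X]setTI.
    have mng : measurable_fun setT (fun z => n.+1%:R * g z) by exact: measurable_funM.
    exact: mng.
  apply/seteqP; split => z /=; rewrite in_itv/=; first by move=> <-; exact: floor_itv.
  by move=> h; apply: floor_def.
rewrite (_ : _ @^-1` _ = (\bigcap_(i in [set: 'I_d])
    [set z : V * R | Num.floor (n.+1%:R * z.1 ord0 i) = k.1 ord0 i]) `&`
    [set z : V * R | Num.floor (n.+1%:R * z.2) = k.2]).
  apply: measurableI; last exact: mfl.
  apply: fin_bigcap_measurable => // i _; apply: mfl.
  exact: (measurableT_comp (measurable_rV_coord i) measurable_fst).
apply/seteqP; split => [z /= zk|z [/= h1 h2]].
  by split; [move=> i _ /=|]; rewrite -zk/= ?mxE.
case: k h1 h2 => k1 k2 /= h1 h2; rewrite /cell h2; congr (_, _).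
by apply/rowP => i; rewrite mxE; exact: h1.
Qed.

Lemma measurable_grid n (G : V * R -> R) :
  measurable_fun setT (fun z => G (corner n (cell n z))).
Proof.
move=> _ Y mY; rewrite setTI.
rewrite (_ : _ @^-1` _ = \bigcup_k (if G (corner n k) \in Y then cell n @^-1` [set k] else set0)).
  apply: countable_bigcupT_measurable => [|k]; first exact: countableP.
  by case: ifP => _ //; exact: measurable_cell.
apply/seteqP; split => [z /= zY|z [k _]].
  by exists (cell n z) => //; rewrite mem_set.
by case: ifPn => [/[1!inE] GY /= ->|].
Qed.

(** The sigma-algebra of V * R is generated by coordinates. At a point of D, G is the limit of its
    values at the corners of finer and finer grid cells; each approximation is constant on countably
    many measurable cells. Corners may leave D, since G is defined everywhere. *)
Lemma measurable_continuous_on (D : set (V * R)) (G : V * R -> R) : measurable D ->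
  (forall z, D z -> {for z, continuous G}) ->
  measurable_fun setT (fun z => \1_D z * G z).
Proof.
move=> mD cG; apply: (measurable_fun_cvg (h := fun n z => \1_D z * G (corner n (cell n z)))).
  by move=> n; apply: measurable_funM; [exact: measurable_indic|exact: measurable_grid].
move=> z _; rewrite indicE; case: (boolP (z \in D)) => [/set_mem Dz|_].
  apply: cvgM; first exact: cvg_cst.
  by apply: continuous_cvg; [exact: cG|exact: cvg_corner].
by under eq_fun do rewrite mul0r; rewrite mul0r; exact: cvg_cst.
Qed.

End grid.

(** * Integrals against the Jordan parts as iterated integrals *)

Section charge_pairing.
Context {R : realType} {d : nat}.
Local Notation V := 'rV[R]_d.
Local Notation leb := (@lebesgue_measure R).
Local Notation S := (usphere R d).
Local Notation sm := (sphere_measure R d).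
Local Notation P := (sphere_line R d).
Variables (h : V * R -> R) (jh : P.-integrable setT (EFin \o h)).
Variables (Pos Neg : set (V * R)) (hd : hahn_decomposition (induced_charge jh) Pos Neg).

(** A Schwartz function on S x R is controlled only there, so it is cut off to S x R before
    measurability is claimed. *)
Lemma Rint_line_modif (m : {measure set (V * R)%type -> \bar R}) (phi : V * R -> R) :
  m (~` (S `*` setT)) = 0%E ->
  \int[m]_z phi z = \int[m]_z (\1_(S `*` setT) z * phi z).
Proof.
move=> m0; rewrite /Rintegral; congr fine.
apply: (eq_integral_conull (@measurable_sphere_line R d) m0) => z _ Sz.
by rewrite indicE mem_set// mul1r.
Qed.

Lemma jordan_pairing (phi : V * R -> R) (M : R) :
  measurable_fun setT (fun z => \1_(S `*` setT) z * phi z) ->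
  (forall w b, S w -> `|phi (w, b)| <= M) ->
  \int[jordan_pos hd]_z phi z - \int[jordan_neg hd]_z phi z =
  \int[sm]_(w in S) \int[leb]_b (phi (w, b) * h (w, b)).
Proof.
move=> mphi phiM; have mh := integ_measurable jh.
pose psi z := \1_(S `*` setT) z * phi z.
(* The cut-off function is 0 off S x R, so its bound must be nonnegative, even when no point of the
   sphere forces M to be. *)
have M0 : 0 <= Num.max M 0 by rewrite le_max lexx orbT.
have psiM z : `|psi z| <= Num.max M 0.
  rewrite /psi indicE; case: (boolP (z \in _)) => [/set_mem[Sz _]|_].
    by rewrite mul1r le_max; case: z Sz => w b /= Sw; rewrite phiM.
  by rewrite mul0r normr0.
have mp : measurable_fun setT (fun z => Num.max (h z) 0) by exact: measurable_maxr.
have mn : measurable_fun setT (fun z => Num.max (- h z) 0).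
  by apply: measurable_maxr => //; exact: measurableT_comp.
have jp : P.-integrable setT (EFin \o (fun z => Num.max (h z) 0)).
  apply: (integ_le _ (integ_norm jh)) => // z /=; rewrite ger0_norm ?le_max ?lexx ?orbT//.
  by rewrite ge_max ler_norm normr_ge0.
have jn : P.-integrable setT (EFin \o (fun z => Num.max (- h z) 0)).
  apply: (integ_le _ (integ_norm jh)) => // z /=; rewrite ger0_norm ?le_max ?lexx ?orbT//.
  by rewrite ge_max -normrN ler_norm normr_ge0.
have mC := measurableC (@measurable_sphere_line R d).
have zero (k : V * R -> R) : measurable_fun setT k ->
    (\int[P]_(z in ~` (S `*` setT)) (k z)%:E = 0)%E.
  move=> mk; apply: null_set_integral => //; last exact: sphere_lineC0.
  by apply/measurable_funTS/measurable_EFinP.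
have p0 : jordan_pos hd (~` (S `*` setT)) = 0%E := etrans (induced_jordan_pos hd mC) (zero _ mp).
have n0 : jordan_neg hd (~` (S `*` setT)) = 0%E := etrans (induced_jordan_neg hd mC) (zero _ mn).
rewrite (Rint_line_modif _ p0) (Rint_line_modif _ n0).
rewrite /Rintegral (integral_density (m := P) (k := fun z => Num.max (h z) 0))//; first last.
- by move=> A mA; exact: (induced_jordan_pos hd mA).
- by move=> z; rewrite le_max lexx orbT.
rewrite (integral_density (m := P) (k := fun z => Num.max (- h z) 0))//; first last.
- by move=> A mA; exact: (induced_jordan_neg hd mA).
- by move=> z; rewrite le_max lexx orbT.
rewrite -/(Rintegral P setT (fun z => psi z * Num.max (h z) 0)).
rewrite -/(Rintegral P setT (fun z => psi z * Num.max (- h z) 0)).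
have jM (k : V * R -> R) : P.-integrable setT (EFin \o k) ->
    P.-integrable setT (EFin \o (fun z => psi z * k z)).
  move=> jk; have := integMb jk mphi psiM; congr (_.-integrable _ _).
  by apply/funext => z /=; rewrite mulrC.
rewrite -RintB; [|exact: jM|exact: jM].
have -> : \int[P]_z (psi z * Num.max (h z) 0 - psi z * Num.max (- h z) 0) =
    \int[P]_z (psi z * h z).
  apply: eqRint => z; rewrite -mulrBr; congr (_ * _); case: (ger0P (h z)) => hz.
    by rewrite max_r ?oppr_le0// subr0.
  by rewrite max_l ?oppr_ge0 ?ltW// sub0r opprK.
rewrite (fubini_sphere_line (jM _ jh)); apply: eq_Rintegral => w /set_mem Sw.
by apply: eqRint => b; rewrite /psi indicE mem_set ?mul1r.
Qed.

End charge_pairing.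

(** * Restriction of Schwartz functions on S x R to the lines {w} x R *)

Section slices.
Context {R : realType} {d : nat}.
Local Notation V := 'rV[R]_d.
Local Notation S := (usphere R d).
Implicit Types (F : V * R -> R) (w : V).

Lemma usphere_neq0 w : S w -> w != 0.
Proof.
apply: contraPneq => ->; rewrite /usphere/= -(scale0r (0 : V)) enormZ normr0 mul0r => /eqP.
by rewrite eq_sym oner_eq0.
Qed.

Lemma radial_ext_id F w b : S w -> radial_ext F (w, b) = F (w, b).
Proof. by move=> Sw; rewrite /radial_ext/= radial_proj_id. Qed.

Lemma slice_quot F w b : (fun h => h^-1 *: ((F \o shift (w, b)) (h *: ((0, 1) : V * R)) - F (w, b))) =
  (fun h : R => h^-1 *: (((fun b => F (w, b)) \o shift b) (h *: (1 : R)) - F (w, b))).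
Proof. apply/funext => h /=.
by rewrite (_ : _ + _ = (h *: (0 : V) + w, h *: (1 : R) + b))// scaler0 add0r. Qed.

Lemma iderive_slice k F w b :
  iderive (nseq k ((0, 1) : V * R)) F (w, b) = derive1n k (fun b => F (w, b)) b.
Proof.
elim: k b => // k ih b; rewrite derive1nS derive1E.
have -> : derive1n k (fun b => F (w, b)) = fun b => iderive (nseq k ((0, 1) : V * R)) F (w, b).
  by apply/funext => c; rewrite ih.
by rewrite /= /derive slice_quot.
Qed.

(** On {w} x R the radial extension is F itself, and the direction (0, 1) stays in the slice: its
    iterated derivatives are those in b. *)
Lemma rschwartz_slice F w : S w -> rschwartz_sphere F -> rs (fun b => F (w, b)).
Proof.
move=> Sw [sF dF].
have e : (fun b => F (w, b)) = (fun b => radial_ext F (w, b)).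
  by apply/funext => b; rewrite radial_ext_id.
have e1 k : derive1n k (fun b => F (w, b)) =
    fun b => iderive (nseq k ((0, 1) : V * R)) (radial_ext F) (w, b).
  by rewrite e; apply/funext => b; rewrite iderive_slice.
split=> [|j k].
  split=> k b; rewrite e1.
  have [D _] := sF (nseq k (0, 1)) (0, 1) (w, b) (usphere_neq0 Sw).
  by move: D; rewrite /derivable slice_quot.
have [M HM] := dF j (nseq k (0, 1)); exists M => b.
by rewrite e1; exact: HM.
Qed.

Lemma rschwartz_bounded F : rschwartz_sphere F ->
  exists M, forall w b, S w -> `|F (w, b)| <= M.
Proof.
move=> [_ dF]; have [M HM] := dF 0%N [::]; exists M => w b Sw.
by have := HM w b Sw; rewrite expr0 mul1r /= radial_ext_id.
Qed.

Lemma measurable_rschwartz F : rschwartz_sphere F ->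
  measurable_fun setT (fun z => \1_(S `*` setT) z * F z).
Proof.
move=> [sF _].
have -> : (fun z => \1_(S `*` setT) z * F z) = (fun z => \1_(S `*` setT) z * radial_ext F z).
  apply/funext => -[w b]; rewrite indicE; case: (boolP (_ \in _)) => [/set_mem[/= Sw _]|_].
    by rewrite radial_ext_id.
  by rewrite !mul0r.
apply: measurable_continuous_on; first exact: measurable_sphere_line.
by move=> z [Sz _]; have [] := sF [::] 0 z (usphere_neq0 Sz).
Qed.

Lemma schwartz_slice (phi : V * R -> R[i]) w : S w -> schwartz_sphere phi ->
  schwartz (fun b => phi (w, b)).
Proof.
by move=> Sw [s1 s2]; apply/schwartzP; split;
  [exact: (rschwartz_slice Sw s1)|exact: (rschwartz_slice Sw s2)].
Qed.

End slices.

(** * The measure extends the functional *)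

Section profile_extends.
Context {R : realType} {d : nat}.
Local Notation V := 'rV[R]_d.
Local Notation leb := (@lebesgue_measure R).
Local Notation S := (usphere R d).
Local Notation sm := (sphere_measure R d).
Local Notation P := (sphere_line R d).
Local Notation Re := (@complex.Re R).
Local Notation Im := (@complex.Im R).
Variables (m : nat) (u : V -> R -> R[i]) (H : V -> distr R).
Hypothesis traces : {ae sm, forall w, traces_agree m (u w)}.
Hypothesis hermitian : forall w r, u w (- r) = (u w r)^*%C.
Hypothesis HE : forall w psi, S w -> schwartz psi -> H w (fourier psi) = distr_of (u w) psi.
Variable jh : P.-integrable setT (EFin \o profile_density u).

(** The slice is the Fourier transform of its [invfour], on which [H w] is integration against u w;
    [cintegral_invfour] then brings out the density. *)
Lemma slice_pairing phi w : traces_agree m (u w) -> S w -> schwartz_sphere phi ->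
  H w (fun b => phi (w, b)) =
  Complex (\int[leb]_b (Re (phi (w, b)) * profile_density u (w, b)))
          (\int[leb]_b (Im (phi (w, b)) * profile_density u (w, b))).
Proof.
move=> tw Sw sphi; have ss := schwartz_slice Sw sphi.
rewrite -[X in H w X](fourier_invfour ss) HE//; last exact: schwartz_invfour.
have [v [cu _]] := traces_sobolev tw.
have cuu : cinteg (u w) by apply: (iffLR (cintegrable_conull _ _) cu); exact: conullT.
apply: (cintegral_invfour cuu _ _ ss) => r; rewrite hermitian; by case: (u w r).
Qed.

Lemma profile_extends : extends (induced_charge jh) H.
Proof.
move=> phi sphi; have [N [mN N0 tN]] := ae_conull traces.
(* c stands for the real or the imaginary part, to treat both at once. *)
have slice (c : R[i] -> R) : (forall a b, c (Complex a b) = a) \/ (forall a b, c (Complex a b) = b) ->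
    \int[sm]_(w in S) c (H w (fun b => phi (w, b))) =
    \int[sm]_(w in S) \int[leb]_b (c (phi (w, b)) * profile_density u (w, b)).
  move=> cE; rewrite /Rintegral; congr fine; apply: (eq_integral_conull mN N0) => w Sw Nw.
  rewrite (slice_pairing (tN w Nw) Sw sphi); congr (_%:E).
  case: cE => cE; rewrite cE; apply: eqRint => b; congr (_ * _).
    by case: (phi (w, b)) => x y; rewrite cE.
  by case: (phi (w, b)) => x y; rewrite cE.
have [sr si] := sphi; have [Mr HMr] := rschwartz_bounded sr; have [Mi HMi] := rschwartz_bounded si.
rewrite /cintegral (slice Re); last by left.
rewrite (slice Im); last by right.
rewrite -(jordan_pairing (hahn (induced_charge jh)) (measurable_rschwartz sr) HMr).
by rewrite -(jordan_pairing (hahn (induced_charge jh)) (measurable_rschwartz si) HMi).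
Qed.

End profile_extends.

(** * Directional derivatives through restriction to lines *)

Section directional.
Context {R : realType} {E : normedModType R}.
Implicit Types (G : E -> R) (z v : E).

(** The two difference quotients coincide. One-variable rules thus give directional ones without
    total differentiability of G. *)
Lemma is_derive_line G z v (l : R) :
  is_derive (0 : R) (1 : R) (fun h => G (h *: v + z)) l -> is_derive z v G l.
Proof.
have e : (fun h : R => h^-1 *: (((fun h => G (h *: v + z)) \o shift 0) (h *: (1 : R)) - G (0 *: v + z))) =
    (fun h : R => h^-1 *: ((G \o shift z) (h *: v) - G z)).
  by apply/funext => h /=; rewrite addr0 scale0r add0r [h *: 1]mulr1.
by move=> [dL L]; split; move: dL L; rewrite /derivable /derive e.
Qed.

Lemma is_derive_alongM G G' z v l l' : is_derive z v G l -> is_derive z v G' l' ->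
  is_derive z v (fun x => G x * G' x) (G z * l' + G' z * l).
Proof. by move=> d1 d2; exact: is_deriveM. Qed.

Lemma derive_line G z v (l : R) : is_derive z v G l ->
  is_derive (0 : R) (1 : R) (fun h => G (h *: v + z)) l.
Proof.
have e : (fun h : R => h^-1 *: (((fun h => G (h *: v + z)) \o shift 0) (h *: (1 : R)) - G (0 *: v + z))) =
    (fun h : R => h^-1 *: ((G \o shift z) (h *: v) - G z)).
  by apply/funext => h /=; rewrite addr0 scale0r add0r [h *: 1]mulr1.
by move=> [dL L]; split; move: dL L; rewrite /derivable /derive e.
Qed.

Lemma is_derive_along_comp (g : R -> R) G z v (l k : R) :
  is_derive (G z) (1 : R) g k -> is_derive z v G l -> is_derive z v (fun x => g (G x)) (k * l).
Proof.
move=> dg dG; apply: is_derive_line; have dL := derive_line dG.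
have dg' : is_derive (G (0 *: v + z)) (1 : R) g k by rewrite scale0r add0r.
apply: (@is_derive_eq _ _ _ _ _ _ _ _ (@is_derive1_comp _ g (fun h => G (h *: v + z)) 0 _ _ dg' dL)).
by rewrite mulrC.
Qed.

End directional.

(** On a line the coordinates are affine and the squared norm is quadratic; this covers both. *)
Lemma is_derive_quadratic (R : realType) (a b c : R) :
  is_derive (0 : R) (1 : R) (fun h => a * h ^+ 2 + b * h + c) b.
Proof.
apply/is_derive1_caratheodory; exists (fun h => a * h + b); split.
- by move=> h; rewrite expr0n/= !mulr0 !add0r subr0 addrK; ring.
- exact: smooth_continuous (smooth_affine a b) 0.
- by rewrite mulr0 add0r.
Qed.

(** * An algebra of functions stable under directional derivatives *)

Section symbols.
Context {R : realType} {d : nat}.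
Local Notation V := 'rV[R]_d.
Local Notation T := (V * R)%type.
Local Notation S := (usphere R d).
Implicit Types (G F : T -> R) (z v : T).

(* Closed under directional derivatives away from the line {0} x R, and
   consisting of functions bounded on the compact subsets of S x R. *)
Inductive symbol : (T -> R) -> Prop :=
| symbol_cst c : symbol (fun=> c)
| symbol_coord i : symbol (fun z => z.1 ord0 i)
| symbol_line : symbol (fun z => z.2)
| symbol_inv : symbol (fun z => (enorm z.1)^-1)
| symbol_comp g G : smooth g -> symbol G -> symbol (fun z => g (G z))
| symbolD G F : symbol G -> symbol F -> symbol (fun z => G z + F z)
| symbolM G F : symbol G -> symbol F -> symbol (fun z => G z * F z).

Lemma symbol_sum (I : Type) (s : seq I) (F : I -> T -> R) :
  (forall i, symbol (F i)) -> symbol (fun z => \sum_(i <- s) F i z).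
Proof.
move=> sF; elim: s => [|i s ih]; first by under eq_fun do rewrite big_nil; exact: symbol_cst.
by under eq_fun do rewrite big_cons; exact: symbolD.
Qed.

Lemma symbol_prod (I : Type) (s : seq I) (F : I -> T -> R) :
  (forall i, symbol (F i)) -> symbol (fun z => \prod_(i <- s) F i z).
Proof.
move=> sF; elim: s => [|i s ih]; first by under eq_fun do rewrite big_nil; exact: symbol_cst.
by under eq_fun do rewrite big_cons; exact: symbolM.
Qed.

Lemma dotp_gt0 (x : V) : x != 0 -> 0 < dotp x x.
Proof.
move=> x0; rewrite lt_neqAle dotp_ge0 andbT eq_sym; apply: contra x0.
rewrite /dotp psumr_eq0 => [/allP h|i _]; last by rewrite -expr2 sqr_ge0.
apply/eqP/rowP => i; rewrite mxE; have := h i; rewrite mem_index_enum => /(_ isT)/=.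
by rewrite mulf_eq0 orbb => /eqP.
Qed.

Lemma enorm_gt0 (x : V) : x != 0 -> 0 < enorm x.
Proof. by move=> x0; rewrite sqrtr_gt0 dotp_gt0. Qed.

Lemma dotp_affine h (x y : V) :
  dotp (h *: x + y) (h *: x + y) = dotp x x * h ^+ 2 + 2 * dotp x y * h + dotp y y.
Proof.
rewrite /dotp !mulr_sumr !mulr_suml -!big_split/=; apply: eq_bigr => i _; rewrite !mxE; ring.
Qed.

(** The chain rule through the squared norm, its root and the inverse. The value is written as a
    product of generators, so that it is visibly a symbol. *)
Lemma is_derive_enormV z v : z.1 != 0 ->
  is_derive z v (fun z : T => (enorm z.1)^-1)
    ((\sum_(i < d) v.1 ord0 i * z.1 ord0 i) * (- (1) * ((enorm z.1)^-1 * ((enorm z.1)^-1 * (enorm z.1)^-1)))).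
Proof.
move=> z0; have e0 := enorm_gt0 z0; have d0 := dotp_gt0 z0.
have dD : is_derive z v (fun z : T => dotp z.1 z.1) (2 * dotp v.1 z.1).
  apply: is_derive_line => /=; under eq_fun do rewrite dotp_affine.
  exact: is_derive_quadratic.
have dS := is_derive_along_comp (G := fun z : T => dotp z.1 z.1) (is_derive1_sqrt d0) dD.
have dV : is_derive (enorm z.1) (1 : R) (fun x => x^-1) (- (enorm z.1) ^- 2).
  by rewrite -[X in is_derive _ _ _ X]mulr1; apply: (@is_deriveV _ id); rewrite gt_eqF.
apply: (is_derive_eq (is_derive_along_comp (G := fun z : T => enorm z.1) dV dS)).
rewrite -/(dotp v.1 z.1) -/(enorm z.1); field; rewrite ?gt_eqF//.
Qed.

Lemma symbol_derive G v : symbol G ->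
  exists2 G', symbol G' & forall z, z.1 != 0 -> is_derive z v G (G' z).
Proof.
elim=> {G} [c|i|||g G sg sG [G' sG' dG]|G F sG [G' sG' dG] sF [F' sF' dF]|G F sG [G' sG' dG] sF [F' sF' dF]].
- by exists (fun=> 0); [exact: symbol_cst|move=> z _; exact: is_derive_cst].
- exists (fun=> v.1 ord0 i); first exact: symbol_cst.
  move=> z _; apply: is_derive_line => /=.
  have := is_derive_quadratic 0 (v.1 ord0 i) (z.1 ord0 i).
  by congr (is_derive _ _ _ _); apply/funext => h; rewrite !mxE mul0r add0r mulrC.
- exists (fun=> v.2); first exact: symbol_cst.
  move=> z _; apply: is_derive_line => /=.
  have := is_derive_quadratic 0 v.2 z.2.
  by congr (is_derive _ _ _ _); apply/funext => h; rewrite mul0r add0r mulrC.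
- exists (fun z => (\sum_(i < d) v.1 ord0 i * z.1 ord0 i) *
    (- (1) * ((enorm z.1)^-1 * ((enorm z.1)^-1 * (enorm z.1)^-1)))); last by move=> z; exact: is_derive_enormV.
  apply: symbolM.
    by apply: symbol_sum => i; apply: symbolM; [exact: symbol_cst|exact: symbol_coord].
  do 2?apply: symbolM; first exact: symbol_cst.
  + exact: symbol_inv.
  + by apply: symbolM; exact: symbol_inv.
- exists (fun z => derive1 g (G z) * G' z); last first.
    by move=> z z0; exact: (is_derive_along_comp (smooth_is_derive (G z) sg) (dG z z0)).
  by apply: symbolM => //; exact: (@symbol_comp (derive1 g) G (smooth_derive sg) sG).
- exists (fun z => G' z + F' z); first exact: symbolD.
  by move=> z z0; apply: is_deriveD; [exact: dG|exact: dF].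
- exists (fun z => G z * F' z + F z * G' z).
    by apply: symbolD; exact: symbolM.
  by move=> z z0; apply: is_derive_alongM; [exact: dG|exact: dF].
Qed.

Lemma symbol_continuous G z : symbol G -> z.1 != 0 -> {for z, continuous G}.
Proof.
move=> sG z0; elim: sG => {G} [c|i|||g G sg _ cG|G F _ cG _ cF|G F _ cG _ cF].
- exact: cst_continuous.
- exact: (@continuous_comp _ _ _ fst (fun x : V => x ord0 i) z cvg_fst (@coord_continuous _ _ _ _ _ _)).
- exact: cvg_snd.
- have cd : {for z, continuous (fun z : T => dotp z.1 z.1)}.
    rewrite /dotp; elim: (index_enum _) => [|i s ih].
      rewrite (_ : (fun z : T => _) = cst 0); last by apply/funext => y; rewrite big_nil.
      exact: cst_continuous.
    rewrite (_ : (fun z : T => _) = (fun z : T => z.1 ord0 i * z.1 ord0 i +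
      \sum_(j <- s) z.1 ord0 j * z.1 ord0 j)); last by apply/funext => y; rewrite big_cons.
    rewrite /prop_for /continuous_at; apply: cvgD ih.
    have ci : {for z, continuous (fun y : T => y.1 ord0 i)}.
      exact: (@continuous_comp _ _ _ fst (fun x : V => x ord0 i) z cvg_fst (@coord_continuous _ _ _ _ _ _)).
    exact: (cvgM ci ci).
  have cs : {for z, continuous (fun z : T => enorm z.1)}.
    exact: (@continuous_comp _ _ _ (fun z : T => dotp z.1 z.1) Num.sqrt z cd (@sqrt_continuous R _)).
  by apply: cvgV cs; rewrite gt_eqF// enorm_gt0.
- by apply: (@continuous_comp _ _ _ G g z cG); exact: smooth_continuous.
- exact: cvgD.
- exact: cvgM.
Qed.

Lemma near_neq0 z : z.1 != 0 -> \near z, z.1 != 0.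
Proof.
move=> z0; have cf : y.1 @[y --> z] --> z.1 by exact: cvg_fst.
exact: cvgr_neq0 cf z0.
Qed.

Lemma symbol_iderive vs G : symbol G ->
  exists2 G', symbol G' & forall z, z.1 != 0 -> iderive vs G z = G' z.
Proof.
move=> sG; elim: vs => [|v vs [G' sG' GG']]; first by exists G.
have [G'' sG'' dG] := symbol_derive v sG'; exists G'' => // z z0 /=.
(* The formula for the inner derivatives holds only where z.1 != 0, but on a neighbourhood of z, so
   it can be differentiated. *)
rewrite (@near_eq_derive _ _ _ _ G'); first by have := dG z z0 => -[_ ->].
by near=> y; apply: GG'; near: y; exact: near_neq0.
Unshelve. all: by end_near. Qed.

Lemma symbol_smooth_on G : symbol G -> smooth_on [set z | z.1 != 0] G.
Proof.
move=> sG vs v z /= z0; have [G' sG' GG'] := symbol_iderive vs sG.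
have nG : \near z, G' z = iderive vs G z.
  by near=> y; apply/esym/GG'; near: y; exact: near_neq0.
split.
  have [G'' _ dG] := symbol_derive v sG'.
  by apply: (near_eq_derivable nG); have [] := dG z z0.
have := symbol_continuous sG' z0; rewrite /prop_for /continuous_at GG'// => cG.
exact: cvg_trans (near_eq_cvg nG) cG.
Unshelve. all: by end_near. Qed.

Lemma symbol_bounded G K : symbol G ->
  exists M, forall w b, S w -> `|b| <= K -> `|G (w, b)| <= M.
Proof.
elim=> {G} [c|i|||g G sg _ [M HM]|G F _ [M HM] _ [N HN]|G F _ [M HM] _ [N HN]].
- by exists `|c|.
- exists 1 => w b Sw _ /=; rewrite -(@ler_pXn2r _ 2) ?nnegrE// expr1n real_normK ?num_real//.
  have : dotp w w = 1 by have := Sw; rewrite /usphere/= /enorm => h; rewrite -(sqr_sqrtr (dotp_ge0 w)) h expr1n.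
  rewrite /dotp (bigD1 i)//= expr2 => <-; rewrite lerDl; apply: sumr_ge0 => j _.
  by rewrite -expr2 sqr_ge0.
- by exists K.
- by exists 1 => w b Sw _ /=; rewrite Sw invr1 normr1.
- have [N HN] : exists N, forall x, `|x| <= M -> `|g x| <= N.
    have cg : compact (g @` `[- M, M]).
      apply: continuous_compact; last exact: segment_compact.
      by apply: continuous_subspaceT => x; exact: smooth_continuous.
    move: cg => /compact_bounded[N [_ HN]]; exists (`|N| + 1) => x xM.
    apply: HN; first by rewrite (le_lt_trans (ler_norm N))// ltrDl.
    by exists x => //=; rewrite in_itv/= -ler_norml.
  by exists N => w b Sw bK; apply/HN/HM.
- by exists (M + N) => w b Sw bK; rewrite (le_trans (ler_normD _ _))// lerD ?HM ?HN.
- by exists (M * N) => w b Sw bK; rewrite normrM ler_pM ?HM ?HN.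
Qed.

End symbols.

(** * Schwartz functions approximating indicators of boxes *)

Section box_test_functions.
Context {R : realType} {d : nat}.
Local Notation V := 'rV[R]_d.
Local Notation T := (V * R)%type.
Local Notation S := (usphere R d).
Implicit Types (F G : T -> R) (z v : T) (a : V) (p q : R).

Lemma iderive_vanish p q G vs : (forall z, (z.2 < p) || (q < z.2) -> G z = 0) ->
  forall z, (z.2 < p) || (q < z.2) -> iderive vs G z = 0.
Proof.
move=> G0; elim: vs => // v vs ih z zpq /=.
rewrite (@near_eq_derive _ _ _ _ (fun=> 0)) ?derive_cst//.
have cs : y.2 @[y --> z] --> z.2 by exact: cvg_snd.
case/orP: zpq => h; near=> y; apply: ih.
- by apply/orP; left; near: y; exact: cvgr_lt cs _ h.
- by apply/orP; right; near: y; exact: cvgr_gt cs _ h.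
Unshelve. all: by end_near. Qed.

(** Derivatives vanish for b outside [p, q], and for the remaining b they are symbols, bounded on
    the sphere times a bounded interval; this replaces decay estimates. *)
Lemma symbol_rschwartz F p q : symbol (radial_ext F) ->
  (forall z, (z.2 < p) || (q < z.2) -> radial_ext F z = 0) -> rschwartz_sphere F.
Proof.
move=> sF F0; split; first exact: symbol_smooth_on.
move=> k vs; have [G sG FG] := symbol_iderive vs sF.
pose K := `|p| + `|q|.
have [M HM] := symbol_bounded K sG; exists ((1 + K) ^+ k * `|M|) => w b Sw.
have K0 : 0 <= K by rewrite addr_ge0.
case: (boolP ((b < p) || (q < b))) => [h|].
  by rewrite (iderive_vanish _ F0)// normr0 mulr0 mulr_ge0// exprn_ge0// addr_ge0.
rewrite negb_or -!leNgt => /andP[pb bq].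
have bK : `|b| <= K.
  rewrite /K ler_norml; have := ler_norm q; have := ler_norm (- p); rewrite normrN.
  have := normr_ge0 p; have := normr_ge0 q; lra.
rewrite FG ?usphere_neq0//; apply: ler_pM => //.
- by rewrite lerXn2r ?nnegrE ?addr_ge0// lerD2l.
- by rewrite (le_trans (HM _ _ Sw bK))// ler_norm.
Qed.

(** Equal to exp(-1 / ((n+1)(t - c))) for t > c and 0 otherwise: it tends to the indicator of t > c
    at every t, the endpoint included. *)
Definition step (n : nat) (c t : R) : R := flat 0 (n.+1%:R * t + - (n.+1%:R * c)).

Lemma smooth_step n c : smooth (step n c).
Proof. exact: smooth_comp (smooth_flat 0) (smooth_affine _ _). Qed.

Lemma step_ge0 n c t : 0 <= step n c t. Proof. exact: flat_ge0. Qed.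

Lemma step_le1 n c t : step n c t <= 1.
Proof. by have := flat_le 0 (n.+1%:R * t + - (n.+1%:R * c)); rewrite fact0. Qed.

Lemma step0 n c t : t <= c -> step n c t = 0.
Proof. by move=> tc; rewrite /step flat_le0E// subr_le0 ler_pM2l. Qed.

Lemma cvg_step c t : step n c t @[n --> \oo] --> ((c < t)%R%:R : R).
Proof.
case: ltP => [ct|tc]; last by under eq_fun do rewrite step0//; exact: cvg_cst.
have e n : step n c t = expR (- (n.+1%:R^-1 * (t - c)^-1)).
  rewrite /step -mulrBr flat_gt0E ?mulr_gt0 ?subr_gt0// expr0 mul1r invfM//.
have H : - (n.+1%:R^-1 * (t - c)^-1) @[n --> \oo] --> (0 : R).
  rewrite -[X in _ --> X]oppr0; apply: cvgN; rewrite -[X in _ --> X](mul0r (t - c)^-1).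
  by apply: cvgMl; exact: cvg_harmonic.
have : expR (- (n.+1%:R^-1 * (t - c)^-1)) @[n --> \oo] --> expR (0 : R).
  by apply: continuous_cvg H; exact: continuous_expR.
rewrite expR0.
by apply: cvg_trans; apply: near_eq_cvg; apply: nearW => n; rewrite e.
Qed.

Definition boxfun n a p q z : R :=
  (\prod_(i <- index_enum 'I_d) step n (a ord0 i) (z.1 ord0 i)) *
  (step n p z.2 * step n (- q) (- z.2)).

(** Bounded in b, where Schwartz functions must decay, but only bounded below in the coordinates of
    R^d, which need no decay on the sphere. *)
Definition box a p q : set T :=
  [set z : T | (forall i, a ord0 i < z.1 ord0 i) /\ p < z.2 < q].

Lemma boxfun_rschwartz n a p q : rschwartz_sphere (boxfun n a p q).
Proof.
apply: (@symbol_rschwartz _ p q).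
- rewrite /radial_ext /boxfun/=; apply: symbolM.
    apply: symbol_prod => i; under eq_fun do rewrite mxE.
    apply: (symbol_comp (smooth_step n (a ord0 i))); apply: symbolM.
      exact: symbol_inv.
    exact: symbol_coord.
  apply: symbolM.
    exact: (symbol_comp (smooth_step n p) symbol_line).
  have sm := smooth_comp (smooth_step n (- q)) (smooth_affine (-1) 0).
  have e : (fun z : T => step n (- q) (- z.2)) =
      (fun z : T => (step n (- q) \o (fun x : R => -1 * x + 0)) z.2).
    by apply/funext => z /=; rewrite mulN1r addr0.
  by rewrite e; exact: (symbol_comp sm symbol_line).
- move=> z; rewrite /radial_ext /boxfun/= => /orP[h|h].
    by rewrite (step0 n (ltW h)) mul0r mulr0.
  by rewrite [X in _ * (_ * X)]step0 ?mulr0// lerN2 ltW.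
Qed.

Lemma boxfun_ge0 n a p q z : 0 <= boxfun n a p q z.
Proof. by rewrite mulr_ge0 ?prodr_ge0 ?mulr_ge0// => *; exact: step_ge0. Qed.

Lemma boxfun_le1 n a p q z : boxfun n a p q z <= 1.
Proof.
rewrite mulr_ile1 ?mulr_ge0 ?step_ge0//.
- by apply: prodr_ge0 => i _; exact: step_ge0.
- by apply: prodr_ile1 => i _; rewrite step_ge0 step_le1.
- by rewrite mulr_ile1 ?step_ge0 ?step_le1.
Qed.

Lemma cvg_boxfun a p q z : boxfun n a p q z @[n --> \oo] --> (\1_(box a p q) z : R).
Proof.
have -> : \1_(box a p q) z = (\prod_(i <- index_enum 'I_d) ((a ord0 i < z.1 ord0 i)%R%:R : R)) *
    ((p < z.2)%R%:R * (- q < - z.2)%R%:R).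
  rewrite indicE; case: (boolP (z \in box a p q)) => [/set_mem[h /andP[h1 h2]]|].
    by rewrite big1 => [|i _]; rewrite ?h// h1 ltrN2 h2 !mul1r.
  move=> /negP zB; apply/esym/eqP; rewrite !mulf_eq0.
  case: (boolP (p < z.2)) => pz; rewrite ?eqxx ?orbT//= oner_eq0/= ltrN2.
  case: (boolP (z.2 < q)) => zq; rewrite ?eqxx ?orbT//= oner_eq0/= orbF.
  apply/negPn/negP => /prodf_neq0 h; apply/zB/mem_set; split; last by rewrite pz.
  by move=> i; have := h i isT; rewrite pnatr_eq0 eqb0 negbK.
apply: cvgM; last by apply: cvgM; exact: cvg_step.
elim: (index_enum _) => [|i s ih].
  by under eq_fun do rewrite big_nil; rewrite big_nil; exact: cvg_cst.
under eq_fun do rewrite big_cons; rewrite big_cons; apply: cvgM ih; exact: cvg_step.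
Qed.

Lemma measurable_step n c : measurable_fun [set: R] (step n c).
Proof. by apply: smooth_measurable; exact: smooth_step. Qed.

Lemma measurable_boxfun n a p q : measurable_fun setT (boxfun n a p q).
Proof.
apply: measurable_funM.
  apply: measurable_prod => i _; apply: (measurableT_comp (measurable_step n _)).
  exact: (measurableT_comp (measurable_rV_coord i) measurable_fst).
apply: measurable_funM; first exact: (measurableT_comp (measurable_step n p) measurable_snd).
apply: (measurableT_comp (measurable_step n (- q))); apply: measurableT_comp => //.
Qed.

Lemma measurable_box a p q : measurable (box a p q).
Proof.
rewrite (_ : box a p q = (\bigcap_(i in [set: 'I_d]) ((fun z : T => z.1 ord0 i) @^-1` `]a ord0 i, +oo[)) `&`
    (snd @^-1` `]p, q[)).
  apply: measurableI.
    apply: fin_bigcap_measurable => // i _; rewrite -[X in measurable X]setTI.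
    have := measurableT_comp (@measurable_rV_coord R d i) (@measurable_fst _ _ V R).
    by apply.
  rewrite -[X in measurable X]setTI; have := @measurable_snd _ _ V R.
  by apply.
apply/seteqP; split => z /=; rewrite !in_itv/=.
  by move=> [h1 h2]; split => // i _ /=; rewrite in_itv/= andbT.
by move=> [h1 h2]; split => // i; have := h1 i I; rewrite /= in_itv/= andbT.
Qed.

Lemma cvg_int_boxfun (m : {finite_measure set T -> \bar R}) a p q :
  \int[m]_z boxfun n a p q z @[n --> \oo] --> fine (m (box a p q)).
Proof.
have -> : fine (m (box a p q)) = \int[m]_z \1_(box a p q) z.
  by rewrite /Rintegral integral_indic ?setIT//; exact: measurable_box.
apply: (@Rint_dct _ _ _ m _ _ (cst 1)).
- by move=> n; exact: measurable_boxfun.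
- by apply: measurable_indic; exact: measurable_box.
- exact: finite_measure_integrable_cst.
- by move=> n z; rewrite ger0_norm ?boxfun_ge0 ?boxfun_le1.
- by apply: aeW => z; exact: cvg_boxfun.
Qed.

End box_test_functions.

(** * Uniqueness of the extending measure *)

Section uniqueness.
Context {R : realType} {d : nat}.
Local Notation V := 'rV[R]_d.
Local Notation T := (V * R)%type.
Implicit Types (nu mu : {charge set T -> \bar R}) (H : V -> distr R).

Definition boxes : set (set T) := [set B | exists a p q, B = box a p q].

Lemma boxes_setI : setI_closed boxes.
Proof.
move=> _ _ [a [p [q ->]]] [a' [p' [q' ->]]].
exists (\row_i Num.max (a ord0 i) (a' ord0 i)), (Num.max p p'), (Num.min q q').
apply/seteqP; split => [z [[h1 /andP[h2 h3]] [h1' /andP[h2' h3']]]|z [h1 /andP[h2 h3]]].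
  split; last by rewrite gt_max lt_min h2 h2' h3 h3'.
  by move=> i; rewrite mxE gt_max h1 h1'.
move: h2 h3; rewrite gt_max lt_min => /andP[h2 h2'] /andP[h3 h3'].
by split; split; rewrite ?h2 ?h2' ?h3 ?h3'// => i; have := h1 i; rewrite mxE gt_max => /andP[].
Qed.

Definition bigbox (n : nat) : set T := box (const_mx (- n%:R)) (- n%:R) n%:R.

Lemma bigcup_bigbox : \bigcup_n bigbox n = setT.
Proof.
apply/seteqP; split => // z _.
pose K := \sum_(i < d) `|z.1 ord0 i| + `|z.2|.
have [n Kn] : exists n : nat, K < n%:R.
  by exists (Num.bound K); apply: archi_boundP; rewrite addr_ge0// sumr_ge0.
have zK i : `|z.1 ord0 i| <= K.
  rewrite /K (bigD1 i)//= -addrA lerDl addr_ge0// sumr_ge0//.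
have z2K : `|z.2| <= K by rewrite /K lerDr sumr_ge0.
exists n => //; split => [i|]; first rewrite mxE.
  by have := le_lt_trans (zK i) Kn; rewrite ltr_norml => /andP[].
by have := le_lt_trans z2K Kn; rewrite ltr_norml.
Qed.

Lemma measurable_boxes : measurable = <<s boxes >> :> set (set T).
Proof.
apply/seteqP; split; last first.
  apply: smallest_sub; first exact: sigma_algebra_measurable.
  by move=> _ [a [p [q ->]]]; exact: measurable_box.
pose X : measurableType _ := g_sigma_algebraType boxes.
have mbox a p q : @measurable _ X (box a p q).
  by apply: sub_sigma_algebra; exists a, p, q.
have m1 i : measurable_fun [set: X] (fun z : X => (z : T).1 ord0 i).
  move=> _; apply: (measurability _ (RGenOInfty.measurableE R)) => //.
  move=> /= _ [_ [t ->] <-]; rewrite setTI.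
  (* The half-space where coordinate i exceeds t is the union of boxes with bound t in that
     coordinate and with the other bounds going to infinity. *)
  rewrite [X in measurable X](_ : _ = \bigcup_n
      box (\row_j (if j == i then t else - n%:R)) (- n%:R) n%:R).
    by apply: bigcupT_measurable => n; exact: mbox.
  apply/seteqP; split => [z /=|z [n _ [h _]] /=]; rewrite in_itv/= andbT.
    move=> tz; have [n _ [h1 h2]] : (\bigcup_n bigbox n) z by rewrite bigcup_bigbox.
    exists n => //; split => // j; rewrite mxE; case: eqP => [->//|_].
    by have := h1 j; rewrite mxE.
  by have := h i; rewrite mxE eqxx.
have m2 : measurable_fun [set: X] (fun z : X => (z : T).2).
  move=> _; apply: (measurability _ (RGenOInfty.measurableE R)) => //.
  move=> /= _ [_ [t ->] <-]; rewrite setTI.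
  rewrite [X in measurable X](_ : _ = \bigcup_n box (const_mx (- n%:R)) t n%:R).
    by apply: bigcupT_measurable => n; exact: mbox.
  apply/seteqP; split => [z /=|z [n _ [_ /andP[h _]]] /=]; rewrite in_itv/= andbT//.
  move=> tz; have [n _ [h1 /andP[_ h2]]] : (\bigcup_n bigbox n) z by rewrite bigcup_bigbox.
  by exists n => //; split => //; rewrite tz.
have mid : measurable_fun [set: X] (fun z : X => ((z : T).1, (z : T).2)).
  by apply: measurable_fun_pair => //; exact: measurable_fun_rV.
move=> A mA; have := mid measurableT A mA; rewrite setTI; congr (_ _).
by apply/seteqP; split => -[].
Qed.

Lemma extends_boxfun nu mu H n a p q : extends nu H -> extends mu H ->
  \int[jordan_pos (hahn nu)]_z boxfun n a p q z - \int[jordan_neg (hahn nu)]_z boxfun n a p q z =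
  \int[jordan_pos (hahn mu)]_z boxfun n a p q z - \int[jordan_neg (hahn mu)]_z boxfun n a p q z.
Proof.
have s0 : rschwartz_sphere (fun _ : T => (0 : R)).
  by apply: (@symbol_rschwartz _ _ _ 0 0) => //; exact: symbol_cst.
have sb : schwartz_sphere (fun z : T => Complex (boxfun n a p q z) 0).
  by split => //=; exact: boxfun_rschwartz.
move=> Hnu Hmu; have := Hmu _ sb; rewrite (Hnu _ sb).
by move=> /(congr1 (@complex.Re R)).
Qed.

(** The negative parts are moved across the equality, so that each side is the value of a
    nonnegative measure. *)
Lemma extends_box nu mu H a p q : extends nu H -> extends mu H ->
  (jordan_pos (hahn nu) (box a p q) + jordan_neg (hahn mu) (box a p q) =
   jordan_pos (hahn mu) (box a p q) + jordan_neg (hahn nu) (box a p q))%E.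
Proof.
move=> Hnu Hmu.
have c1 := cvgB (@cvg_int_boxfun R d (jordan_pos (hahn nu)) a p q) (@cvg_int_boxfun R d (jordan_neg (hahn nu)) a p q).
have c2 := cvgB (@cvg_int_boxfun R d (jordan_pos (hahn mu)) a p q) (@cvg_int_boxfun R d (jordan_neg (hahn mu)) a p q).
have E : fine (jordan_pos (hahn nu) (box a p q)) - fine (jordan_neg (hahn nu) (box a p q)) =
    fine (jordan_pos (hahn mu) (box a p q)) - fine (jordan_neg (hahn mu) (box a p q)).
  apply: (cvgn_eq _ (c1 _) (c2 _)) => n; exact: (extends_boxfun n a p q Hnu Hmu).
have mB := measurable_box a p q.
have fin (m : {finite_measure set T -> \bar R}) : m (box a p q) = (fine (m (box a p q)))%:E.
  by rewrite fineK// fin_num_measure.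
rewrite (fin (jordan_pos (hahn nu))) (fin (jordan_neg (hahn nu))).
rewrite (fin (jordan_pos (hahn mu))) (fin (jordan_neg (hahn mu))) -!EFinD; congr (_%:E).
lra.
Qed.

(** The pi-system theorem concerns nonnegative measures, so it is applied to nu+ + mu- and mu+ +
    nu-, finite on the exhausting boxes; finiteness of the parts then allows subtracting back. *)
Lemma extends_unique nu mu H : extends nu H -> extends mu H ->
  forall A, measurable A -> nu A = mu A.
Proof.
move=> Hnu Hmu A mA.
pose m1 := measure_add (jordan_pos (hahn nu)) (jordan_neg (hahn mu)).
pose m2 := measure_add (jordan_pos (hahn mu)) (jordan_neg (hahn nu)).
have fin (m : {finite_measure set T -> \bar R}) B : measurable B -> m B = (fine (m B))%:E.
  by move=> mB; rewrite fineK// fin_num_measure.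
have : m1 A = m2 A.
  apply: (measure_unique boxes bigbox) => //.
  - exact: measurable_boxes.
  - exact: boxes_setI.
  - by move=> n; do 3!eexists.
  - exact: bigcup_bigbox.
  - by move=> _ [a [p [q ->]]];
    exact: (etrans (measure_addE _ _ _) (etrans (extends_box a p q Hnu Hmu) (esym (measure_addE _ _ _)))).
  - move=> n; have mB := @measurable_box R d (const_mx (- n%:R)) (- n%:R) n%:R.
    have E := etrans (measure_addE (jordan_pos (hahn nu)) (jordan_neg (hahn mu)) _)
      (congr2 adde (fin (jordan_pos (hahn nu)) _ mB) (fin (jordan_neg (hahn mu)) _ mB)).
    by rewrite [X in (X < _)%E]E; exact: (ltry (_ + _)).
have dec (k : {charge set T -> \bar R}) :
    k A = (fine (jordan_pos (hahn k) A) - fine (jordan_neg (hahn k) A))%:E.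
  rewrite (jordan_decomp (hahn k) mA) /cadd/= cscaleN1 EFinB.
  by congr (_ - _)%E; [exact: (fin (jordan_pos (hahn k)))|exact: (fin (jordan_neg (hahn k)))].
have sum (m m' : {finite_measure set T -> \bar R}) :
    measure_add m m' A = (fine (m A) + fine (m' A))%:E.
  exact: etrans (measure_addE _ _ _) (congr2 adde (fin m _ mA) (fin m' _ mA)).
have cross (x y x' y' : R) : x + y' = x' + y -> x - y = x' - y' by move=> ?; lra.
move=> /(etrans (esym (sum (jordan_pos (hahn nu)) (jordan_neg (hahn mu))))) E.
have {}E := EFin_inj (etrans E (sum (jordan_pos (hahn mu)) (jordan_neg (hahn nu)))).
by rewrite (dec nu) (dec mu) (cross _ _ _ _ E).
Qed.

End uniqueness.

Theorem theorem5p13 (R : realType) (d : nat) (d_gt0 : (0 < d)%N)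
    (sigma : R -> R) (alpha : nat) (ghat : R -> R[i])
    (hsigma : admissible d sigma alpha ghat) (p : nat) :
  exists2 C : R, 0 < C &
  forall f : 'rV[R]_d -> R, weightedL1 p f ->
  {ae sphere_measure R d, forall w, sobolev (p + 2)%N [set~ 0%R] (Hhat alpha ghat f w)} ->
  (\int[sphere_measure R d]_(w in usphere R d)
     sobolev_norm (p + 2)%N [set~ 0%R] (Hhat alpha ghat f w) < +oo)%E ->
  {ae sphere_measure R d, forall w, traces_agree (p + 2)%N (Hhat alpha ghat f w)} ->
  forall H : 'rV[R]_d -> distr R,
  (forall w, usphere R d w -> tempered (H w) /\
     forall psi, schwartz psi ->
       distr_fourier (H w) psi = distr_of (Hhat alpha ghat f w) psi) ->
  exists mu : {charge set ('rV[R]_d * R)%type -> \bar R},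
  [/\ weighted_measure mu p,
      extends mu H,
      (forall nu : {charge set ('rV[R]_d * R)%type -> \bar R},
         weighted_measure nu p -> extends nu H ->
         forall A, measurable A -> nu A = mu A),
      {ae sphere_measure R d, forall w, sobolev (p + 2)%N setT (Hhat alpha ghat f w)} &
      (tv_norm mu p <=
       C%:E * \int[sphere_measure R d]_(w in usphere R d)
                sobolev_norm (p + 2)%N setT (Hhat alpha ghat f w))%E].
Proof.
have C0 : 0 < 2 ^+ (p + 4) * pi :> R by rewrite mulr_gt0 ?exprn_gt0 ?pi_gt0.
(* The constant of [integral_hinv_le], which depends on p alone. *)
exists (2 ^+ (p + 4) * pi) => // f [mf _] _ fin traces H HE.
have mu := cmeasurable_Hhat alpha (adm_smooth hsigma) mf.
have bnd w := integral_hinv_le p (Hhat alpha ghat f w).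
have herm w r : Hhat alpha ghat f w (- r) = (Hhat alpha ghat f w r)^*%C.
  by apply: Hhat_opp; exact: (hermitian_fourier (adm_smooth hsigma) (adm_fourier hsigma)).
have HE' w psi : usphere R d w -> schwartz psi ->
    H w (fourier psi) = distr_of (Hhat alpha ghat f w) psi.
  by move=> Sw; apply: (HE w Sw).2.
have ext := profile_extends traces herm HE' (profile_integrable mu C0 bnd traces fin).
exists (profile_measure mu C0 bnd traces fin); split => //.
- exact: profile_weighted.
- by move=> nu _ enu A mA; exact: (extends_unique enu ext).
- by apply: (filterS _ traces) => w; exact: traces_sobolev.
- exact: profile_tv_le.
Qed.
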